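(* Let $\Lambda\subset(0,\infty)^2$ be a set of parameters $(\epsilon,\delta)$, and for each $(\epsilon,\delta)\in\Lambda$ let $(u^{\epsilon,\delta},p^{\epsilon,\delta},U^{\epsilon,\delta})$ be the solution, with maximal existence time $T_{\epsilon,\delta}\in(0,\infty]$, of the relaxation system with smooth initial data $(u_0^{\epsilon,\delta},p_0^{\epsilon,\delta},U_0^{\epsilon,\delta})$. Assume that there is a constant $C>0$ independent of $(\epsilon,\delta)$ such that for all $(\epsilon,\delta)\in\Lambda$: $\delta\le C\sqrt\epsilon$, $$\|u_0^{\epsilon,\delta}-u_0^{NS}\|_{H^1}+\sqrt\epsilon\,\|p_0^{\epsilon,\delta}-p_0^{NS}\|_{H^1}+(\epsilon+\delta)\|U_0^{\epsilon,\delta}\|_{H^1}\le C(\epsilon+\delta),$$ $$\|\nabla\operatorname{div}u_0^{\epsilon,\delta}\|_{L^2}+\delta\left(\|\Delta p_0^{\epsilon,\delta}\|_{L^2}+\|\nabla\operatorname{div}U_0^{\epsilon,\delta}\|_{L^2}\right)\le C(\epsilon+\delta),$$ and, for some $a>0$ independent of $(\epsilon,\delta)$, $$\|\Delta(u_0^{\epsilon,\delta},p_0^{\epsilon,\delta},U_0^{\epsilon,\delta})\|_{L^2}\le C(\epsilon+\delta)^{-a}.$$ Then for every $T>0$ there exist constants $C_T>0$ and $\eta_T>0$, independent of $(\epsilon,\delta)$, such that for all $(\epsilon,\delta)\in\Lambda$ with $\epsilon+\delta\le\eta_T$ and $T<T_{\epsilon,\delta}$, $$\sup_{0<t<T}\left(\|u^{\epsilon,\delta}(t,\cdot)-u^{NS}(t,\cdot)\|_{H^1}+\sqrt\epsilon\,\|p^{\epsilon,\delta}(t,\cdot)-p^{NS}(t,\cdot)\|_{H^1}\right)\le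 C_T(\epsilon+\delta).$$
   Context: $\mathbb T^2=\mathbb R^2/\mathbb Z^2$. All norms $L^2,L^\infty,H^1$ are over $\mathbb T^2$; matrices use the Frobenius norm; norms of tuples are computed by summing the squares of the components' norms. Conventions: $(\nabla u)_{ij}=\partial_{x_i}u_j$, $\operatorname{div}=\nabla\cdot$, $(\nabla\cdot U)_j=\sum_i\partial_{x_i}U_{ij}$, $(u\otimes v)_{ij}=u_iv_j$. Incompressible Navier-Stokes equations: $(p^{NS},u^{NS}):[0,\infty)\times\mathbb T^2\to\mathbb R\times\mathbb R^2$ is the smooth solution of $$\nabla\cdot u^{NS}=0,\quad \partial_t u^{NS}+\nabla\cdot(u^{NS}\otimes u^{NS})=-\nabla p^{NS}+\Delta u^{NS},\quad u^{NS}(0,\cdot)=u_0^{NS},$$ with smooth initial datum $u_0^{NS}$ (independent of $(\epsilon,\delta)$), normalized by $\int_{\mathbb T^2}p^{NS}(t,x)\,dx=0$ for all $t$; $p_0^{NS}=p^{NS}(0,\cdot)$. Relaxation system, for $\epsilon,\delta>0$, with unknowns $p^{\epsilon,\delta}\in\mathbb R$, $u^{\epsilon,\delta}\in\mathbb R^2$, $U^{\epsilon,\delta}\in\mathbb R^{2\times2}$ on $[0,T_{\epsilon,\delta})\times\mathbb T^2$: $$\epsilon\partial_t p^{\epsilon,\delta}+\nabla\cdot u^{\epsilon,\delta}=0,\quad \partial_t u^{\epsilon,\delta}+\nabla\cdot U^{\epsilon,\delta}+\nabla p^{\epsilon,\delta}=0,\quad \delta\partial_tU^{\epsilon,\delta}+\nabla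 u^{\epsilon,\delta}=u^{\epsilon,\delta}\otimes u^{\epsilon,\delta}-U^{\epsilon,\delta},$$ with $(u^{\epsilon,\delta},p^{\epsilon,\delta},U^{\epsilon,\delta})(0,\cdot)=(u_0^{\epsilon,\delta},p_0^{\epsilon,\delta},U_0^{\epsilon,\delta})$ smooth. This is a symmetrizable hyperbolic system, so a unique local-in-time smooth solution exists; $T_{\epsilon,\delta}$ denotes its maximal existence time. Constants may depend on $u_0^{NS}$ and on the constants in the hypotheses, but not on $(\epsilon,\delta)$. *)

(* Defs.v *)
From Stdlib Require Import Reals.
From Coquelicot Require Import Coquelicot.
Open Scope R_scope.

(* Functions on the torus R^2/Z^2 are functions R -> R -> R that are 1-periodic
   in each variable; vector and matrix fields are families of such functions
   indexed by the coordinate directions. *)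

Inductive axis := X1 | X2.

Definition sum2 (f : axis -> R) : R := f X1 + f X2.

Definition sfield := R -> R -> R.
Definition vfield := axis -> sfield.
Definition mfield := axis -> axis -> sfield.

Definition partial (i : axis) (f : sfield) : sfield :=
  match i with
  | X1 => fun x y => Derive (fun s => f s y) x
  | X2 => fun x y => Derive (fun s => f x s) y
  end.

Definition ex_partial (i : axis) (f : sfield) (x y : R) : Prop :=
  match i with
  | X1 => ex_derive (fun s => f s y) x
  | X2 => ex_derive (fun s => f x s) y
  end.

Definition periodic (f : sfield) : Prop :=
  forall x y, f (x + 1) y = f x y /\ f x (y + 1) = f x y.

Definition grad (f : sfield) : vfield := fun i => partial i f.
Definition vgrad (u : vfield) : mfield := fun i j => partial i (u j).
Definition div (u : vfield) : sfield :=
  fun x y => sum2 (fun i => partial i (u i) x y).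
Definition mdiv (U : mfield) : vfield :=
  fun j x y => sum2 (fun i => partial i (U i j) x y).
Definition laplacian (f : sfield) : sfield :=
  fun x y => sum2 (fun i => partial i (partial i f) x y).
Definition vlaplacian (u : vfield) : vfield := fun i => laplacian (u i).
Definition mlaplacian (U : mfield) : mfield := fun i j => laplacian (U i j).
Definition tensor (u v : vfield) : mfield := fun i j x y => u i x y * v j x y.

Definition sminus (f g : sfield) : sfield := fun x y => f x y - g x y.
Definition vminus (u v : vfield) : vfield := fun i => sminus (u i) (v i).

(* Only applied to continuous integrands, for which the iterated Riemann
   integral over the unit square is the integral over the torus. *)
Definition integral (f : sfield) : R :=
  RInt (fun x => RInt (fun y => f x y) 0 1) 0 1.

Definition normL2 (f : sfield) : R := sqrt (integral (fun x y => (f x y) ^ 2)).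
Definition normL2v (u : vfield) : R := sqrt (sum2 (fun i => (normL2 (u i)) ^ 2)).
Definition normL2m (U : mfield) : R :=
  sqrt (sum2 (fun i => sum2 (fun j => (normL2 (U i j)) ^ 2))).

Definition normH1 (f : sfield) : R := sqrt ((normL2 f) ^ 2 + (normL2v (grad f)) ^ 2).
Definition normH1v (u : vfield) : R := sqrt (sum2 (fun i => (normH1 (u i)) ^ 2)).
Definition normH1m (U : mfield) : R :=
  sqrt (sum2 (fun i => sum2 (fun j => (normH1 (U i j)) ^ 2))).

Definition normL2_tuple (u : vfield) (p : sfield) (U : mfield) : R :=
  sqrt ((normL2v u) ^ 2 + (normL2 p) ^ 2 + (normL2m U) ^ 2).

Fixpoint Ck (n : nat) (f : sfield) : Prop :=
  (forall x y, continuous (fun z : R * R => f (fst z) (snd z)) (x, y)) /\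
  match n with
  | O => True
  | S m => forall i, (forall x y, ex_partial i f x y) /\ Ck m (partial i f)
  end.

Definition torus_smooth (f : sfield) : Prop :=
  periodic f /\ forall n, Ck n f.

Definition in_time (T : Rbar) (t : R) : Prop := 0 <= t /\ Rbar_lt t T.

(* C^n on [0,T) x R^2, up to and including t = 0.  The continuous function g is
   the time derivative for t > 0 and hence, by the mean value theorem, the right
   derivative at t = 0.  It is not written with Derive, which at t = 0 would
   involve the irrelevant values of f at negative times. *)
Fixpoint Ck_time (T : Rbar) (n : nat) (f : R -> sfield) : Prop :=
  (forall t x y, in_time T t ->
     filterlim (fun z : R * R * R => f (fst (fst z)) (snd (fst z)) (snd z))
       (within (fun z : R * R * R => 0 <= fst (fst z)) (locally (t, x, y)))
       (locally (f t x y))) /\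
  match n with
  | O => True
  | S m =>
      (forall i, (forall t x y, in_time T t -> ex_partial i (f t) x y) /\
                 Ck_time T m (fun t => partial i (f t))) /\
      exists g : R -> sfield,
        (forall t x y, 0 < t -> Rbar_lt t T ->
           is_derive (fun s => f s x y) t (g t x y)) /\
        Ck_time T m g
  end.

Definition torus_smooth_time (T : Rbar) (f : R -> sfield) : Prop :=
  (forall t, in_time T t -> periodic (f t)) /\ forall n, Ck_time T n f.

(* In both systems below the equations are imposed for t > 0; they extend to
   t = 0 by continuity of the derivatives. *)

Record NS_solution (u0 : vfield) (u : R -> vfield) (p : R -> sfield) : Prop := {
  NS_smooth_u : forall i, torus_smooth_time p_infty (fun t => u t i);
  NS_smooth_p : torus_smooth_time p_infty p;
  NS_incompressible : forall t x y, 0 < t -> div (u t) x y = 0;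
  NS_momentum : forall t j x y, 0 < t ->
    Derive (fun s => u s j x y) t + mdiv (tensor (u t) (u t)) j x y
    = - grad (p t) j x y + vlaplacian (u t) j x y;
  NS_initial : forall j x y, u 0 j x y = u0 j x y;
  NS_pressure_mean : forall t, 0 <= t -> integral (p t) = 0
}.

Record relax_solution (eps del : R) (T : Rbar)
    (u0 : vfield) (p0 : sfield) (U0 : mfield)
    (u : R -> vfield) (p : R -> sfield) (U : R -> mfield) : Prop := {
  relax_time_pos : Rbar_lt 0 T;
  relax_smooth_u : forall i, torus_smooth_time T (fun t => u t i);
  relax_smooth_p : torus_smooth_time T p;
  relax_smooth_U : forall i j, torus_smooth_time T (fun t => U t i j);
  relax_p : forall t x y, 0 < t -> Rbar_lt t T ->
    eps * Derive (fun s => p s x y) t + div (u t) x y = 0;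
  relax_u : forall t j x y, 0 < t -> Rbar_lt t T ->
    Derive (fun s => u s j x y) t + mdiv (U t) j x y + grad (p t) j x y = 0;
  relax_U : forall t i j x y, 0 < t -> Rbar_lt t T ->
    del * Derive (fun s => U s i j x y) t + vgrad (u t) i j x y
    = tensor (u t) (u t) i j x y - U t i j x y;
  relax_initial_u : forall i x y, u 0 i x y = u0 i x y;
  relax_initial_p : forall x y, p 0 x y = p0 x y;
  relax_initial_U : forall i j x y, U 0 i j x y = U0 i j x y
}.

(* (u, p, U) is a smooth solution on [0,T) and T is the maximal existence time
   for the initial data (u0, p0, U0). *)
Definition maximal_relax_solution (eps del : R) (T : Rbar)
    (u0 : vfield) (p0 : sfield) (U0 : mfield)
    (u : R -> vfield) (p : R -> sfield) (U : R -> mfield) : Prop :=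
  relax_solution eps del T u0 p0 U0 u p U /\
  forall T' u' p' U',
    relax_solution eps del T' u0 p0 U0 u' p' U' -> Rbar_le T' T.

Definition total_error (eps : R) (u uNS : vfield) (p pNS : sfield) : R :=
  normH1v (vminus u uNS) + sqrt eps * normH1 (sminus p pNS).

(* Main.v *)
Require Import Defs.
From Stdlib Require Import Reals ZArith Lra Lia Psatz FunctionalExtensionality.
From Stdlib Require Import Classical ClassicalEpsilon.
From Coquelicot Require Import Coquelicot.
Open Scope R_scope.

(** The limit solves the relaxation system up to small residuals: put [u = uN], [p = pN] and
    [U = uN (x) uN - grad uN] ([stress]). The error solves the linear relaxation system
    [lin_sys] with sources. This system has constant coefficients, so that space derivatives
    of solutions are solutions, and it dissipates the energy
    [eps |q|^2 + |w|^2 + del |W|^2] ([energy_identity]); the dissipation [|W|^2] absorbs the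
    source of the third equation, which costs its square only.

    Two residuals are too large for the rate [eta = eps + del], and each is removed by a
    corrector ([error_system]). The first equation has the defect [eps d_t pN], which is
    compensated by adding [eps phi] to the velocity, where [div phi = d_t pN]; such a [phi]
    exists because the limit pressure has mean zero ([divergence_potential]). And [U] does not
    start near [stress]; subtracting [exp (- t / del)] times its initial distance makes the
    stress error vanish initially, and leaves a force of order [eta] in [L^1] in time. All
    sources are then bounded by the error plus [eta], in [L^2] and in [H^1], as long as
    [|u - uN| <= 1] ([h1_power_le]), and Gronwall's lemma gives an [H^1] error of order [eta]
    ([E1_estimate]).

    The condition [|u - uN| <= 1] does not follow from smallness in [H^1], which narrowly fails
    to embed into the bounded functions in two dimensions. But the second derivatives of
    [u] lose at most a power of [eta] ([second_energy_estimate]), and by [sup_interpolation]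
    a function of size [eta] in [H^1] with second derivatives of size [eta^(-a)] is small in
    the supremum norm: the Sobolev inequality for [f^(n+2)], with [n] at least [a], uses
    the second derivatives once and the [H^1] norm [n + 1] times. A continuity argument in
    time closes the circle ([bootstrap]). *)

Notation RA := R_AbsRing (only parsing).
Notation R3 := (R * R * R)%type (only parsing).
Notation RN := R_NormedModule (only parsing).
Notation RC := R_CompleteNormedModule (only parsing).
Notation ts := torus_smooth_time (only parsing).
Notation ts_v T w := (forall j : axis, torus_smooth_time T (fun t => w t j)) (only parsing).
Notation ts_m T W := (forall i j : axis, torus_smooth_time T (fun t => W t i j)) (only parsing).

Tactic Notation "field_ext" ident(a) ident(b) :=
  apply functional_extensionality; intros a; apply functional_extensionality; intros b.

(** For [lra], which does not instantiate hypotheses over the coordinate directions. *)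
Ltac axes H :=
  let H1 := fresh "axis" in let H2 := fresh "axis" in
  pose proof (H X1) as H1; pose proof (H X2) as H2; cbv beta in H1, H2;
  lazymatch type of H1 with
  | forall _ : axis, _ => axes H1; axes H2; clear H1 H2
  | _ => idtac
  end.

(** By compactness of the unit interval, continuity at [p0] is uniform in the variable of
    integration. *)
Lemma continuous_RInt_parameter {P : UniformSpace} (F : P -> R -> R) (p0 : P) :
  (forall y, 0 <= y <= 1 ->
     continuous (fun z : P * R => F (fst z) (snd z)) (p0, y)) ->
  locally p0 (fun p => ex_RInt (F p) 0 1) ->
  continuous (fun p => RInt (F p) 0 1) p0.
Proof.
  intros HF Hint.
  apply filterlim_locally; intros eps.
  assert (He : 0 < eps / 4) by (destruct eps; simpl; lra).
  assert (Hd : forall y, exists d : posreal, 0 <= y <= 1 ->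
    forall p s, ball p0 d p -> Rabs (s - y) < d ->
      Rabs (F p s - F p0 y) < eps / 4).
  { intros y.
    destruct (classic (0 <= y <= 1)) as [Hy|Hy].
    - specialize (HF y Hy).
      destruct (proj1 (filterlim_locally _ _) HF (mkposreal _ He)) as [d Hd].
      exists d. intros _ p s Hp Hs.
      apply (Hd (p, s)). split; [exact Hp | exact Hs].
    - exists (mkposreal 1 Rlt_0_1). intros H; contradiction. }
  pose (delta := fun y => proj1_sig (constructive_indefinite_description _ (Hd y))).
  assert (Hdelta : forall y, 0 <= y <= 1 ->
    forall p s, ball p0 (delta y) p -> Rabs (s - y) < delta y ->
      Rabs (F p s - F p0 y) < eps / 4).
  { intros y. unfold delta.
    destruct (constructive_indefinite_description _ (Hd y)) as [d H]. exact H. }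
  destruct (compactness_value_1d 0 1 delta) as [d Hcov].
  assert (Hp0 : ex_RInt (F p0) 0 1) by (apply (locally_singleton _ _ Hint)).
  assert (Hunif : forall p, ball p0 d p -> forall s, 0 <= s <= 1 ->
    Rabs (F p s - F p0 s) <= eps / 2).
  { intros p Hp s Hs.
    apply Rnot_lt_le; intros Hlt. apply (Hcov s Hs).
    intros (t & Ht & Hst & Hdt).
    assert (H1 := Hdelta t Ht p s (ball_le _ _ _ Hdt _ Hp) Hst).
    assert (H2 := Hdelta t Ht p0 s (ball_center _ _) Hst).
    apply (Rlt_irrefl (eps / 2)). eapply Rlt_le_trans; [exact Hlt|].
    replace (F p s - F p0 s) with ((F p s - F p0 t) - (F p0 s - F p0 t)) by ring.
    eapply Rle_trans; [apply Rabs_triang|]. rewrite Rabs_Ropp. lra. }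
  assert (Hball : locally p0 (ball p0 d)) by (exists d; auto).
  generalize (filter_and _ _ Hint Hball). apply filter_imp.
  intros p [Hip Hp].
  change (Rabs (RInt (F p) 0 1 - RInt (F p0) 0 1) < eps).
  assert (E : RInt (F p) 0 1 - RInt (F p0) 0 1
              = RInt (fun s => F p s - F p0 s) 0 1).
  { symmetry. apply is_RInt_unique.
    apply (is_RInt_minus (V := RN)); apply (RInt_correct (V := RC)); assumption. }
  rewrite E.
  apply Rle_lt_trans with ((1 - 0) * (eps / 2)).
  - apply abs_RInt_le_const; [lra | | apply Hunif; exact Hp].
    apply (ex_RInt_minus (V := RN)); assumption.
  - destruct eps; simpl; lra.
Qed.

(** * Space-time regularity *)

(** Extending a field by its initial value to negative times turns the
    one-sided continuity at the initial time into continuity in the ordinary sense. *)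
Definition clamped (f : R -> sfield) : R3 -> R :=
  fun z => f (Rmax 0 (fst (fst z))) (snd (fst z)) (snd z).

Definition cont_time (T : Rbar) (f : R -> sfield) : Prop :=
  forall t x y, Rbar_lt (Rmax 0 t) T -> continuous (clamped f) (t, x, y).

Lemma in_time_Rmax T t : Rbar_lt (Rmax 0 t) T -> in_time T (Rmax 0 t).
Proof. intros H; split; [apply Rmax_l | exact H]. Qed.

Lemma in_time_Rmax_eq t : 0 <= t -> Rmax 0 t = t.
Proof. intros; apply Rmax_right; assumption. Qed.

Lemma continuous_Rmax0 t : continuous (fun s => Rmax 0 s) t.
Proof.
  apply continuous_ext with (f := fun s => (s + Rabs s) / 2).
  - intros s. unfold Rmax. destruct (Rle_dec 0 s).
    + rewrite Rabs_pos_eq by assumption; simpl; lra.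
    + rewrite Rabs_left by lra; simpl; lra.
  - apply (continuous_mult (K := RA)); [|apply continuous_const].
    apply (continuous_plus (V := RN)); [apply continuous_id|].
    apply continuous_Rabs_comp, continuous_id.
Qed.

Lemma continuous_z_t (t x y : R) : continuous (fun z : R3 => fst (fst z)) (t, x, y).
Proof. apply (continuous_comp (fun z : R3 => fst z) fst); apply continuous_fst. Qed.
Lemma continuous_z_x (t x y : R) : continuous (fun z : R3 => snd (fst z)) (t, x, y).
Proof. apply (continuous_comp (fun z : R3 => fst z) snd); [apply continuous_fst|apply continuous_snd]. Qed.
Lemma continuous_z_y (t x y : R) : continuous (fun z : R3 => snd z) (t, x, y).
Proof. apply continuous_snd. Qed.

Lemma cont_time_within T f :
  cont_time T f <->
  (forall t x y, in_time T t ->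
     filterlim (fun z : R3 => f (fst (fst z)) (snd (fst z)) (snd z))
       (within (fun z : R3 => 0 <= fst (fst z)) (locally (t, x, y)))
       (locally (f t x y))).
Proof.
  split.
  - intros H t x y [H0 HT].
    apply (filterlim_within_ext (F := locally (t, x, y)) _ (clamped f)).
    + intros z Hz. unfold clamped. now rewrite in_time_Rmax_eq.
    + assert (E : f t x y = clamped f (t, x, y)).
      { unfold clamped; simpl. now rewrite in_time_Rmax_eq. }
      rewrite E. intros P HP. unfold filtermap, within.
      assert (Hc := H t x y). rewrite in_time_Rmax_eq in Hc by assumption.
      specialize (Hc HT P HP). unfold filtermap in Hc. revert Hc. apply filter_imp; auto.
  - intros H t x y HT.
    specialize (H (Rmax 0 t) x y (in_time_Rmax _ _ HT)).
    unfold continuous. unfold clamped at 2; simpl.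
    eapply (filterlim_comp _ _ _
      (fun z : R3 => (Rmax 0 (fst (fst z)), snd (fst z), snd z))
      (fun z : R3 => f (fst (fst z)) (snd (fst z)) (snd z))); [|exact H].
    intros Q HQ. unfold filtermap. unfold within in HQ.
    assert (Hc : continuous (fun z : R3 => (Rmax 0 (fst (fst z)), snd (fst z), snd z)) (t, x, y)).
    { assert (Hpair : forall (V W : UniformSpace) (a : V * W), continuous (fun z => (fst z, snd z)) a)
        by (intros; apply continuous_ext with (f := fun z => z); [intros []; reflexivity|apply continuous_id]).
      apply (continuous_comp_2 (fun z : R3 => (Rmax 0 (fst (fst z)), snd (fst z))) (fun z => snd z) (fun a b => (a, b)));
      [|apply continuous_z_y|apply (Hpair (prod_UniformSpace R_UniformSpace R_UniformSpace) R_UniformSpace)].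
      apply (continuous_comp_2 (fun z : R3 => Rmax 0 (fst (fst z))) (fun z => snd (fst z)) (fun a b => (a, b)));
      [|apply continuous_z_x|apply (Hpair R_UniformSpace R_UniformSpace)].
      apply (continuous_comp (fun z : R3 => fst (fst z)) (fun s => Rmax 0 s)); [apply continuous_z_t|apply continuous_Rmax0]. }
    specialize (Hc _ HQ). unfold filtermap in Hc. revert Hc. apply filter_imp.
    intros z Hz. apply Hz. simpl. apply Rmax_l.
Qed.

Lemma locally_in_time T t : Rbar_lt (Rmax 0 t) T ->
  locally t (fun s => Rbar_lt (Rmax 0 s) T).
Proof.
  intros H.
  assert (Hc := continuous_Rmax0 t).
  apply (Hc (fun s => Rbar_lt s T)). apply (open_Rbar_lt' _ _ H).
Qed.

Lemma locally_pos_time T t : 0 < t -> Rbar_lt t T ->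
  locally t (fun s => 0 < s /\ Rbar_lt s T).
Proof.
  intros H0 HT. apply filter_and.
  - apply (open_gt 0); exact H0.
  - apply (open_Rbar_lt' _ _ HT).
Qed.

Lemma continuous_clamped_comp {P : UniformSpace} T f (tau a b : P -> R) (p : P) :
  cont_time T f -> Rbar_lt (Rmax 0 (tau p)) T ->
  continuous tau p -> continuous a p -> continuous b p ->
  continuous (fun z => f (Rmax 0 (tau z)) (a z) (b z)) p.
Proof.
  intros Hf HT Ht Ha Hb.
  apply (continuous_comp_2 (fun z => (tau z, a z)) b
    (fun u y => f (Rmax 0 (fst u)) (snd u) y)); [|exact Hb|].
  - apply (continuous_comp_2 tau a (fun s x => (s, x))); [exact Ht|exact Ha|].
    apply continuous_ext with (f := fun z => z); [intros []; reflexivity|apply continuous_id].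
  - apply (Hf _ _ _ HT).
Qed.

Lemma continuous_slice {P : UniformSpace} T f t (a b : P -> R) (p : P) :
  cont_time T f -> in_time T t -> continuous a p -> continuous b p ->
  continuous (fun z => f t (a z) (b z)) p.
Proof.
  intros Hf [H0 HT] Ha Hb.
  assert (H := continuous_clamped_comp T f (fun _ => t) a b p Hf).
  cbv beta in H. rewrite !(in_time_Rmax_eq t H0) in H.
  apply H; auto. apply continuous_const.
Qed.

Lemma cont_time_ext T f g :
  (forall t x y, in_time T t -> f t x y = g t x y) ->
  cont_time T f -> cont_time T g.
Proof.
  intros E H t x y HT.
  apply continuous_ext_loc with (g := clamped f); [|apply H; exact HT].
  assert (Hl : locally (t, x, y) (fun z : R3 => Rbar_lt (Rmax 0 (fst (fst z))) T)).
  { assert (Hc : continuous (fun z : R3 => fst (fst z)) (t, x, y)).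
    { apply (continuous_comp (fun z : R3 => fst z) fst); apply continuous_fst. }
    apply (Hc _ (locally_in_time T t HT)). }
  revert Hl. apply filter_imp. intros z Hz. unfold clamped.
  apply E. apply in_time_Rmax. exact Hz.
Qed.

Lemma cont_time_const T c : cont_time T (fun _ _ _ => c).
Proof. intros t x y _. apply continuous_const. Qed.

Lemma cont_time_plus T f g : cont_time T f -> cont_time T g ->
  cont_time T (fun t x y => f t x y + g t x y).
Proof.
  intros Hf Hg t x y HT.
  apply (continuous_plus (V := RN) (clamped f) (clamped g)); auto.
Qed.

Lemma cont_time_mult T f g : cont_time T f -> cont_time T g ->
  cont_time T (fun t x y => f t x y * g t x y).
Proof.
  intros Hf Hg t x y HT.
  apply (continuous_mult (K := RA) (clamped f) (clamped g)); auto.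
Qed.

Definition swap (f : R -> sfield) : R -> sfield := fun t x y => f t y x.

Lemma cont_time_swap T f : cont_time T f -> cont_time T (swap f).
Proof.
  intros Hf t x y HT.
  apply (continuous_clamped_comp T f (fun z => fst (fst z)) (fun z : R3 => snd z)
    (fun z => snd (fst z)) (t, x, y) Hf HT);
  [apply continuous_z_t|apply continuous_z_y|apply continuous_z_x].
Qed.

Lemma cont_time_freeze_y T f c : cont_time T f ->
  cont_time T (fun t x _ => f t x c).
Proof.
  intros Hf t x y HT.
  apply (continuous_clamped_comp T f (fun z => fst (fst z)) (fun z : R3 => snd (fst z))
    (fun _ => c) (t, x, y) Hf HT);
  [apply continuous_z_t|apply continuous_z_x|apply continuous_const].
Qed.

Definition Iy (f : R -> sfield) : R -> sfield :=
  fun t x y => RInt (fun s => f t x s) 0 y.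

Lemma ex_RInt_slice_y T f t x a b : cont_time T f -> in_time T t ->
  ex_RInt (fun s => f t x s) a b.
Proof.
  intros Hf Ht. apply (ex_RInt_continuous (V := RC)).
  intros z _. apply (continuous_slice T f t (fun _ => x) (fun s => s)); auto;
  [apply continuous_const|apply continuous_id].
Qed.

(** A fixed interval of integration lets the endpoint be treated as one more parameter. *)
Lemma Iy_rescale T f t x y : cont_time T f -> in_time T t ->
  RInt (fun s => y * f t x (y * s)) 0 1 = Iy f t x y.
Proof.
  intros Hf Ht. unfold Iy.
  assert (H := RInt_comp_lin (V := RC) (fun s => f t x s) y 0 0 1).
  replace (y * 0 + 0) with 0 in H by ring. replace (y * 1 + 0) with y in H by ring.
  rewrite <- H by (apply (ex_RInt_slice_y T); assumption).
  apply RInt_ext. intros s _. rewrite Rplus_0_r. reflexivity.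
Qed.

Lemma cont_time_Iy T f : cont_time T f -> cont_time T (Iy f).
Proof.
  intros Hf t x y HT.
  assert (Hl : locally (t, x, y) (fun z : R3 => Rbar_lt (Rmax 0 (fst (fst z))) T)).
  { apply (continuous_z_t t x y _ (locally_in_time T t HT)). }
  apply continuous_ext_loc with (g := fun z : R3 =>
    RInt (fun s => snd z * f (Rmax 0 (fst (fst z))) (snd (fst z)) (snd z * s)) 0 1).
  - revert Hl. apply filter_imp. intros z Hz. apply (Iy_rescale T); [exact Hf|].
    apply in_time_Rmax; exact Hz.
  - apply (continuous_RInt_parameter (P := prod_UniformSpace (prod_UniformSpace R_UniformSpace R_UniformSpace) R_UniformSpace)
     (fun (z : R3) s => snd z * f (Rmax 0 (fst (fst z))) (snd (fst z)) (snd z * s))).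
    + intros s Hs.
      assert (Hf1 : continuous (fun u : R3 * R => fst u) (t, x, y, s)) by apply continuous_fst.
      assert (Hy : continuous (fun u : R3 * R => snd (fst u)) (t, x, y, s)).
      { apply (continuous_comp (fun u : R3 * R => fst u) (fun z => snd z)); [exact Hf1|apply continuous_z_y]. }
      apply (continuous_mult (K := RA)); [exact Hy|].
      apply (continuous_clamped_comp T f (fun u : R3 * R => fst (fst (fst u)))
         (fun u => snd (fst (fst u))) (fun u => snd (fst u) * snd u)); [exact Hf|exact HT| | |].
      * apply (continuous_comp (fun u : R3 * R => fst u) (fun z => fst (fst z))); [exact Hf1|apply continuous_z_t].
      * apply (continuous_comp (fun u : R3 * R => fst u) (fun z => snd (fst z))); [exact Hf1|apply continuous_z_x].
      * apply (continuous_mult (K := RA)); [exact Hy|apply continuous_snd].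
    + revert Hl. apply filter_imp. intros z Hz.
      apply (ex_RInt_continuous (V := RC)). intros s _.
      apply (continuous_mult (K := RA)); [apply continuous_const|].
      apply (continuous_slice T f _ (fun _ => snd (fst z)) (fun s => snd z * s)); [exact Hf|apply in_time_Rmax; exact Hz|apply continuous_const|].
      apply (continuous_mult (K := RA)); [apply continuous_const|apply continuous_id].
Qed.

Definition dt_rel (T : Rbar) (f g : R -> sfield) : Prop :=
  forall t x y, 0 < t -> Rbar_lt t T -> is_derive (fun s => f s x y) t (g t x y).

Lemma Ck_time_cont T n f : Ck_time T n f -> cont_time T f.
Proof. intros H. apply cont_time_within. destruct n; apply H. Qed.

Lemma Ck_time_S T n f : Ck_time T (S n) f <->
  cont_time T f /\
  (forall i, (forall t x y, in_time T t -> ex_partial i (f t) x y) /\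
             Ck_time T n (fun t => partial i (f t))) /\
  exists g, dt_rel T f g /\ Ck_time T n g.
Proof. rewrite cont_time_within. reflexivity. Qed.

Lemma Ck_time_0 T f : Ck_time T 0 f <-> cont_time T f.
Proof. rewrite cont_time_within. simpl. tauto. Qed.

Lemma in_time_pos T t : 0 < t -> Rbar_lt t T -> in_time T t.
Proof. intros; split; [lra|assumption]. Qed.

Lemma dt_rel_ext T f f' g : (forall t x y, in_time T t -> f t x y = f' t x y) ->
  dt_rel T f g -> dt_rel T f' g.
Proof.
  intros E H t x y H0 HT. apply is_derive_ext_loc with (f := fun s => f s x y).
  - generalize (locally_pos_time T t H0 HT). apply filter_imp. intros s [Hs HsT].
    apply E, in_time_pos; assumption.
  - apply H; assumption.
Qed.

Lemma Ck_time_ext T n : forall f g,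
  (forall t x y, in_time T t -> f t x y = g t x y) -> Ck_time T n f -> Ck_time T n g.
Proof.
  induction n as [|n IH]; intros f g E H.
  - rewrite Ck_time_0 in *. eapply cont_time_ext; eauto.
  - rewrite Ck_time_S in *. destruct H as (H1 & H2 & h & H3 & H4).
    assert (Es : forall t, in_time T t -> f t = g t).
    { intros t Ht. field_ext x y. apply E; exact Ht. }
    split; [eapply cont_time_ext; eauto|split].
    + intros i. destruct (H2 i) as [Hi1 Hi2]. split.
      * intros t x y Ht. rewrite <- Es by exact Ht. apply Hi1; exact Ht.
      * eapply IH; [|exact Hi2]. intros t x y Ht. simpl. rewrite Es by exact Ht. reflexivity.
    + exists h. split; [eapply dt_rel_ext; eauto|exact H4].
Qed.

Lemma Ck_time_pred T n : forall f, Ck_time T (S n) f -> Ck_time T n f.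
Proof.
  induction n as [|n IH]; intros f H.
  - apply Ck_time_0. eapply Ck_time_cont; eauto.
  - rewrite Ck_time_S in H |- *. destruct H as (H1 & H2 & g & H3 & H4).
    split; [exact H1|split].
    + intros i. destruct (H2 i). split; auto.
    + exists g; auto.
Qed.

Lemma Ck_time_shorten T T' n : Rbar_le T' T -> forall f, Ck_time T n f -> Ck_time T' n f.
Proof.
  intros HT.
  assert (Hlt : forall t : R, Rbar_lt t T' -> Rbar_lt t T)
    by (intros t Ht; eapply Rbar_lt_le_trans; eauto).
  assert (Hc : forall f, cont_time T f -> cont_time T' f).
  { intros f Hf t x y Ht. apply Hf, Hlt, Ht. }
  induction n as [|n IH]; intros f H.
  - rewrite Ck_time_0 in *. auto.
  - rewrite Ck_time_S in *. destruct H as (H1 & H2 & g & H3 & H4).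
    split; [auto|split].
    + intros i. destruct (H2 i) as [Hi1 Hi2]. split; [|auto].
      intros t x y [Ht HtT]. apply Hi1. split; auto.
    + exists g. split; [|auto]. intros t x y H0 Ht. apply H3; auto.
Qed.

Lemma partial_plus i f g x y : ex_partial i f x y -> ex_partial i g x y ->
  partial i (fun x y => f x y + g x y) x y = partial i f x y + partial i g x y.
Proof. destruct i; intros Hf Hg; apply Derive_plus; assumption. Qed.

Lemma partial_mult i f g x y : ex_partial i f x y -> ex_partial i g x y ->
  partial i (fun x y => f x y * g x y) x y
  = partial i f x y * g x y + f x y * partial i g x y.
Proof. destruct i; intros Hf Hg; apply (Derive_mult (fun s => _)  (fun s => _)); assumption. Qed.

Lemma ex_partial_plus i f g x y : ex_partial i f x y -> ex_partial i g x y ->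
  ex_partial i (fun x y => f x y + g x y) x y.
Proof. destruct i; intros Hf Hg; apply (ex_derive_plus (V := RN) (fun s => _) (fun s => _)); assumption. Qed.

Lemma ex_partial_mult i f g x y : ex_partial i f x y -> ex_partial i g x y ->
  ex_partial i (fun x y => f x y * g x y) x y.
Proof. destruct i; intros Hf Hg; apply (ex_derive_mult (fun s => _) (fun s => _)); assumption. Qed.

Lemma partial_const i c x y : partial i (fun _ _ => c) x y = 0.
Proof. destruct i; simpl; apply Derive_const. Qed.

Lemma ex_partial_const i c x y : ex_partial i (fun _ _ => c) x y.
Proof. destruct i; simpl; apply (ex_derive_const (V := RN)). Qed.

Lemma Ck_time_const T n : forall c, Ck_time T n (fun _ _ _ => c).
Proof.
  induction n as [|n IH]; intros c.
  - apply Ck_time_0, cont_time_const.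
  - apply Ck_time_S. split; [apply cont_time_const|split].
    + intros i. split; [intros; apply ex_partial_const|].
      apply Ck_time_ext with (f := fun _ _ _ => 0); [|apply IH].
      intros; symmetry; apply partial_const.
    + exists (fun _ _ _ => 0). split; [|apply IH]. intros t x y _ _. apply (is_derive_const (V := RN)).
Qed.

Lemma Ck_time_plus T n : forall f g, Ck_time T n f -> Ck_time T n g ->
  Ck_time T n (fun t x y => f t x y + g t x y).
Proof.
  induction n as [|n IH]; intros f g Hf Hg.
  - rewrite Ck_time_0 in *. apply cont_time_plus; assumption.
  - rewrite Ck_time_S in *.
    destruct Hf as (F1 & F2 & f' & F3 & F4). destruct Hg as (G1 & G2 & g' & G3 & G4).
    split; [apply cont_time_plus; assumption|split].
    + intros i. destruct (F2 i) as [F5 F6]. destruct (G2 i) as [G5 G6]. split.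
      * intros t x y Ht. apply ex_partial_plus; auto.
      * eapply Ck_time_ext; [|apply IH; [exact F6|exact G6]].
        intros t x y Ht. symmetry. apply partial_plus; auto.
    + exists (fun t x y => f' t x y + g' t x y). split; [|apply IH; assumption].
      intros t x y H0 HT. apply (is_derive_plus (V := RN)); [apply F3|apply G3]; assumption.
Qed.

Lemma Ck_time_mult T n : forall f g, Ck_time T n f -> Ck_time T n g ->
  Ck_time T n (fun t x y => f t x y * g t x y).
Proof.
  induction n as [|n IH]; intros f g Hf Hg.
  - rewrite Ck_time_0 in *. apply cont_time_mult; assumption.
  - assert (Hf0 := Ck_time_pred _ _ _ Hf). assert (Hg0 := Ck_time_pred _ _ _ Hg).
    rewrite Ck_time_S in Hf, Hg |- *.
    destruct Hf as (F1 & F2 & f' & F3 & F4). destruct Hg as (G1 & G2 & g' & G3 & G4).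
    split; [apply cont_time_mult; assumption|split].
    + intros i. destruct (F2 i) as [F5 F6]. destruct (G2 i) as [G5 G6]. split.
      * intros t x y Ht. apply ex_partial_mult; auto.
      * eapply Ck_time_ext; [|apply Ck_time_plus; [apply (IH _ _ F6 Hg0)|apply (IH _ _ Hf0 G6)]].
        intros t x y Ht. symmetry. apply partial_mult; auto.
    + exists (fun t x y => f' t x y * g t x y + f t x y * g' t x y).
      split; [|apply Ck_time_plus; apply IH; assumption].
      intros t x y H0 HT.
      apply (is_derive_mult (fun s => f s x y) (fun s => g s x y)); [apply F3|apply G3|]; try assumption.
      intros; apply Rmult_comm.
Qed.

Definition other (i : axis) : axis := match i with X1 => X2 | X2 => X1 end.

Lemma Ck_time_swap T n : forall f, Ck_time T n f -> Ck_time T n (swap f).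
Proof.
  induction n as [|n IH]; intros f H.
  - rewrite Ck_time_0 in *. apply cont_time_swap; assumption.
  - rewrite Ck_time_S in *. destruct H as (F1 & F2 & f' & F3 & F4).
    split; [apply cont_time_swap; assumption|split].
    + intros i. destruct (F2 (other i)) as [F5 F6]. split.
      * intros t x y Ht. destruct i; apply (F5 t y x Ht).
      * destruct i; apply (IH _ F6).
    + exists (swap f'). split; [|apply IH; exact F4].
      intros t x y H0 HT. apply F3; assumption.
Qed.

Lemma Ck_time_freeze_y T c n : forall f, Ck_time T n f ->
  Ck_time T n (fun t x _ => f t x c).
Proof.
  induction n as [|n IH]; intros f H.
  - rewrite Ck_time_0 in *. apply cont_time_freeze_y; assumption.
  - rewrite Ck_time_S in *. destruct H as (F1 & F2 & f' & F3 & F4).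
    split; [apply cont_time_freeze_y; assumption|split].
    + intros [|].
      * destruct (F2 X1) as [F5 F6]. split.
        -- intros t x y Ht. apply (F5 t x c Ht).
        -- apply (IH _ F6).
      * split.
        -- intros t x y Ht. simpl. apply (ex_derive_const (V := RN)).
        -- apply Ck_time_ext with (f := fun _ _ _ => 0); [|apply Ck_time_const].
           intros; symmetry; simpl; apply Derive_const.
    + exists (fun t x _ => f' t x c). split; [|apply IH; exact F4].
      intros t x y H0 HT. apply F3; assumption.
Qed.

Lemma cont_time_2d T f t x y : cont_time T f -> in_time T t ->
  continuity_2d_pt (f t) x y.
Proof.
  intros Hf Ht. apply continuity_2d_pt_filterlim.
  apply (continuous_slice T f t (fun z : R * R => fst z) (fun z => snd z) (x, y)); auto.
  - apply continuous_fst.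
  - apply continuous_snd.
Qed.

Lemma cont_time_2d_ty T f t x y : cont_time T f -> 0 < t -> Rbar_lt t T ->
  continuity_2d_pt (fun s v => f s x v) t y.
Proof.
  intros Hf Ht HT. apply continuity_2d_pt_filterlim.
  assert (E : f t x y = f (Rmax 0 t) x y) by (rewrite in_time_Rmax_eq; [reflexivity|lra]).
  rewrite E.
  apply filterlim_ext_loc with (f := fun z : R * R => f (Rmax 0 (fst z)) x (snd z)).
  - assert (Hc : continuous (fun z : R * R => fst z) (t, y)) by apply continuous_fst.
    specialize (Hc _ (locally_pos_time T t Ht HT)). unfold filtermap in Hc. revert Hc.
    apply filter_imp. intros z [Hz _]. rewrite in_time_Rmax_eq; [reflexivity|].
    simpl in Hz. lra.
  - apply (continuous_clamped_comp T f (fun z : R * R => fst z) (fun _ => x) (fun z => snd z) (t, y)).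
    + exact Hf.
    + simpl. rewrite in_time_Rmax_eq by lra. exact HT.
    + apply continuous_fst.
    + apply continuous_const.
    + apply continuous_snd.
Qed.

Lemma is_derive_Iy_y T f t x y : cont_time T f -> in_time T t ->
  is_derive (fun s => Iy f t x s) y (f t x y).
Proof.
  intros Hf Ht. apply (is_derive_RInt (V := RN) (fun s => f t x s) _ 0).
  - exists (mkposreal 1 Rlt_0_1). intros b _.
    apply (RInt_correct (V := RC)), (ex_RInt_slice_y T); assumption.
  - apply (continuous_slice T f t (fun _ => x) (fun s => s)); auto;
    [apply continuous_const|apply continuous_id].
Qed.

Lemma is_derive_Iy_x T f t x y : cont_time T f -> in_time T t ->
  (forall x y, ex_partial X1 (f t) x y) ->
  cont_time T (fun t => partial X1 (f t)) ->
  is_derive (fun s => Iy f t s y) x (Iy (fun t => partial X1 (f t)) t x y).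
Proof.
  intros Hf Ht Hex Hd. unfold Iy.
  apply (is_derive_RInt_param (fun u v => f t u v) 0 y x).
  - exists (mkposreal 1 Rlt_0_1). intros u _ v _. apply (Hex u v).
  - intros v _. apply (cont_time_2d T (fun t => partial X1 (f t)) t x v Hd Ht).
  - exists (mkposreal 1 Rlt_0_1). intros u _. apply (ex_RInt_slice_y T); assumption.
Qed.

Lemma dt_rel_Iy T f g : cont_time T f -> cont_time T g -> dt_rel T f g ->
  dt_rel T (Iy f) (Iy g).
Proof.
  intros Hf Hg Hd t x y H0 HT. unfold Iy.
  assert (Hl := locally_pos_time T t H0 HT).
  rewrite (RInt_ext (g t x) (fun s => Derive (fun u => f u x s) t)).
  2:{ intros s _. symmetry. apply is_derive_unique, Hd; assumption. }
  apply (is_derive_RInt_param (fun u v => f u x v) 0 y t).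
  - revert Hl. apply filter_imp. intros u [Hu HuT] v _. eexists. apply Hd; assumption.
  - intros v _. apply (continuity_2d_pt_ext_loc (fun s v => g s x v)).
    + apply locally_2d_locally.
      assert (Hc : continuous (fun z : R * R => fst z) (t, v)) by apply continuous_fst.
      specialize (Hc _ Hl). unfold filtermap in Hc. revert Hc.
      apply filter_imp. intros z [Hz HzT]. symmetry.
      apply is_derive_unique, Hd; assumption.
    + apply (cont_time_2d_ty T); assumption.
  - revert Hl. apply filter_imp. intros u [Hu HuT].
    apply (ex_RInt_slice_y T); [assumption|apply in_time_pos; assumption].
Qed.

Lemma Ck_time_Iy T n : forall f, Ck_time T n f -> Ck_time T n (Iy f).
Proof.
  induction n as [|n IH]; intros f H.
  - rewrite Ck_time_0 in *. apply cont_time_Iy; assumption.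
  - assert (H' := Ck_time_pred _ _ _ H).
    rewrite Ck_time_S in *. destruct H as (F1 & F2 & f' & F3 & F4).
    split; [apply cont_time_Iy; assumption|split].
    + destruct (F2 X1) as [F5 F6].
      assert (D1 : forall t x y, in_time T t ->
        is_derive (fun s => Iy f t s y) x (Iy (fun t => partial X1 (f t)) t x y)).
      { intros t x y Ht. apply (is_derive_Iy_x T); auto. eapply Ck_time_cont; exact F6. }
      intros [|]; split.
      * intros t x y Ht. eexists. apply D1; exact Ht.
      * apply Ck_time_ext with (f := Iy (fun t => partial X1 (f t))); [|apply IH; exact F6].
        intros t x y Ht. symmetry. apply is_derive_unique, D1; exact Ht.
      * intros t x y Ht. eexists. apply (is_derive_Iy_y T); assumption.
      * apply Ck_time_ext with (f := f); [|exact H'].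
        intros t x y Ht. symmetry. apply is_derive_unique, (is_derive_Iy_y T); assumption.
    + exists (Iy f'). split; [|apply IH; exact F4].
      apply dt_rel_Iy; auto. eapply Ck_time_cont; exact F4.
Qed.

Lemma Ck_time_exp T k n : forall c, Ck_time T n (fun t _ _ => c * exp (k * t)).
Proof.
  induction n as [|n IH]; intros c.
  all: assert (Hc : cont_time T (fun t _ _ => c * exp (k * t))).
  1,3: intros t x y _; unfold clamped;
    apply (continuous_mult (K := RA)); [apply continuous_const|];
    apply (continuous_comp (fun z : R3 => k * Rmax 0 (fst (fst z))) exp);
    [apply (continuous_mult (K := RA)); [apply continuous_const|];
      apply (continuous_comp (fun z : R3 => fst (fst z)) (fun s => Rmax 0 s));
       [apply continuous_z_t|apply continuous_Rmax0]
    |apply continuity_pt_filterlim, derivable_continuous_pt, derivable_pt_exp].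
  - apply Ck_time_0, Hc.
  - apply Ck_time_S. split; [exact Hc|split].
    + intros i. split; [intros; apply ex_partial_const|].
      apply Ck_time_ext with (f := fun _ _ _ => 0); [|apply Ck_time_const].
      intros; symmetry; apply partial_const.
    + exists (fun t _ _ => (c * k) * exp (k * t)). split; [|apply IH].
      intros t x y _ _. auto_derive; [auto|ring].
Qed.

Lemma Ck_time_slice T T' s n : in_time T s -> forall f, Ck_time T n f -> Ck_time T' n (fun _ => f s).
Proof.
  intros Hs. induction n as [|n IH]; intros f H.
  all: assert (Hc : cont_time T' (fun _ => f s)) by
   (intros t x y _; unfold clamped; apply (continuous_slice T f s);
    [eapply Ck_time_cont; exact H|exact Hs|apply continuous_z_x|apply continuous_z_y]).
  - apply Ck_time_0, Hc.
  - apply Ck_time_S. split; [exact Hc|].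
    rewrite Ck_time_S in H. destruct H as (F1 & F2 & f' & F3 & F4). split.
    + intros i. destruct (F2 i) as [F5 F6]. split.
      * intros t x y _. apply F5; exact Hs.
      * apply (IH _ F6).
    + exists (fun _ _ _ => 0). split; [|apply Ck_time_const].
      intros t x y _ _. apply (is_derive_const (V := RN)).
Qed.

Definition smooth_time (T : Rbar) (f : R -> sfield) : Prop := forall n, Ck_time T n f.

Lemma smooth_cont T f : smooth_time T f -> cont_time T f.
Proof. intros H. apply (Ck_time_cont T 0), H. Qed.

Lemma smooth_partial T i f : smooth_time T f -> smooth_time T (fun t => partial i (f t)).
Proof. intros H n. specialize (H (S n)). rewrite Ck_time_S in H. apply H. Qed.

Lemma smooth_ex_partial T i f t x y : smooth_time T f -> in_time T t -> ex_partial i (f t) x y.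
Proof. intros H Ht. specialize (H 1%nat). rewrite Ck_time_S in H. apply H, Ht. Qed.

Lemma cont_time_eq_at_0 T f g x y : Rbar_lt 0 T -> cont_time T f -> cont_time T g ->
  (forall t, 0 < t -> Rbar_lt t T -> f t x y = g t x y) -> f 0 x y = g 0 x y.
Proof.
  intros HT Hf Hg E.
  assert (HT0 : Rbar_lt (Rmax 0 0) T) by (rewrite in_time_Rmax_eq; [exact HT|lra]).
  assert (C : forall h, cont_time T h -> continuous (fun s => h (Rmax 0 s) x y) 0).
  { intros h Hh. apply (continuous_clamped_comp T h (fun s => s) (fun _ => x) (fun _ => y));
    [exact Hh|exact HT0|apply continuous_id|apply continuous_const|apply continuous_const]. }
  assert (Hc : continuous (fun s => f (Rmax 0 s) x y - g (Rmax 0 s) x y) 0).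
  { apply (continuous_minus (V := RN)); auto. }
  apply NNPP; intros Hne.
  assert (Hpos : 0 < Rabs (f 0 x y - g 0 x y)) by (apply Rabs_pos_lt; lra).
  destruct (proj1 (filterlim_locally _ _) Hc (mkposreal _ Hpos)) as [d Hd].
  destruct (open_Rbar_lt' _ _ HT) as [d' Hd'].
  assert (Hm : 0 < Rmin d d' / 2) by (assert (0 < Rmin d d') by (apply Rmin_pos; [apply d|apply d']); lra).
  set (s := Rmin d d' / 2) in *.
  assert (s < d) by (unfold s in *; assert (Rmin d d' <= d) by apply Rmin_l; lra).
  assert (s < d') by (unfold s in *; assert (Rmin d d' <= d') by apply Rmin_r; lra).
  assert (Hs : Rabs (s - 0) = s) by (rewrite Rminus_0_r; apply Rabs_pos_eq; lra).
  assert (B1 : ball 0 d s) by (change (Rabs (s - 0) < d); lra).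
  assert (B2 : ball 0 d' s) by (change (Rabs (s - 0) < d'); lra).
  specialize (Hd s B1). specialize (Hd' s B2).
  change (Rabs ((f (Rmax 0 s) x y - g (Rmax 0 s) x y) - (f (Rmax 0 0) x y - g (Rmax 0 0) x y))
    < Rabs (f 0 x y - g 0 x y)) in Hd.
  rewrite !in_time_Rmax_eq in Hd by lra.
  rewrite E in Hd by (lra || exact Hd').
  replace (g s x y - g s x y - (f 0 x y - g 0 x y)) with (-(f 0 x y - g 0 x y)) in Hd by ring.
  rewrite Rabs_Ropp in Hd. lra.
Qed.

(** The regularity of order [n] comes with a time derivative that may depend on [n]. They
    all agree for [t > 0] by uniqueness of derivatives, and at [t = 0] by continuity. *)
Lemma smooth_dt_exists T f : smooth_time T f ->
  exists g, smooth_time T g /\ dt_rel T f g.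
Proof.
  intros H.
  assert (Hg : forall n, exists g, dt_rel T f g /\ Ck_time T n g).
  { intros n. specialize (H (S n)). rewrite Ck_time_S in H. apply H. }
  destruct (Hg 0%nat) as (g & Dg & Cg).
  exists g. split; [|exact Dg]. intros n.
  destruct (Hg n) as (h & Dh & Ch).
  assert (Hpos : forall t x y, 0 < t -> Rbar_lt t T -> h t x y = g t x y).
  { intros t x y H0 HT. transitivity (Derive (fun s => f s x y) t).
    - symmetry. apply is_derive_unique, Dh; assumption.
    - apply is_derive_unique, Dg; assumption. }
  apply Ck_time_ext with (f := h); [|exact Ch].
  intros t x y [[H0|H0] HT]; [auto|]. subst t.
  apply (cont_time_eq_at_0 T); eauto using Ck_time_cont.
Qed.

(** The time derivative, extended continuously to [t = 0]. *)
Definition Dt (T : Rbar) (f : R -> sfield) : R -> sfield :=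
  epsilon (inhabits f) (fun g => smooth_time T g /\ dt_rel T f g).

Lemma Dt_spec T f : smooth_time T f -> smooth_time T (Dt T f) /\ dt_rel T f (Dt T f).
Proof. intros H. unfold Dt. apply epsilon_spec, smooth_dt_exists, H. Qed.

Lemma smooth_Dt T f : smooth_time T f -> smooth_time T (Dt T f).
Proof. apply Dt_spec. Qed.

Lemma Dt_Derive T f t x y : smooth_time T f -> 0 < t -> Rbar_lt t T ->
  Derive (fun s => f s x y) t = Dt T f t x y.
Proof. intros H H0 HT. apply is_derive_unique, Dt_spec; assumption. Qed.

Lemma smooth_ext T f g : (forall t x y, in_time T t -> f t x y = g t x y) ->
  smooth_time T f -> smooth_time T g.
Proof. intros E H n. eapply Ck_time_ext; eauto. Qed.
Lemma smooth_plus T f g : smooth_time T f -> smooth_time T g ->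
  smooth_time T (fun t x y => f t x y + g t x y).
Proof. intros Hf Hg n. apply Ck_time_plus; auto. Qed.
Lemma smooth_mult T f g : smooth_time T f -> smooth_time T g ->
  smooth_time T (fun t x y => f t x y * g t x y).
Proof. intros Hf Hg n. apply Ck_time_mult; auto. Qed.
Lemma smooth_const T c : smooth_time T (fun _ _ _ => c).
Proof. intros n. apply Ck_time_const. Qed.
Lemma smooth_opp T f : smooth_time T f -> smooth_time T (fun t x y => - f t x y).
Proof.
  intros Hf. apply smooth_ext with (f := fun t x y => (-1) * f t x y).
  - intros; ring.
  - apply smooth_mult; [apply smooth_const|exact Hf].
Qed.
Lemma smooth_minus T f g : smooth_time T f -> smooth_time T g ->
  smooth_time T (fun t x y => f t x y - g t x y).
Proof. intros Hf Hg. apply smooth_plus; [exact Hf|apply smooth_opp; exact Hg]. Qed.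
Lemma smooth_pow T f n : smooth_time T f -> smooth_time T (fun t x y => f t x y ^ n).
Proof.
  intros Hf. induction n as [|n IH]; simpl; [apply smooth_const|].
  apply smooth_mult; assumption.
Qed.
Lemma smooth_slice T T' s f : smooth_time T f -> in_time T s -> smooth_time T' (fun _ => f s).
Proof. intros Hf Hs n. eapply Ck_time_slice; eauto. Qed.
Lemma smooth_shorten T T' f : smooth_time T f -> Rbar_le T' T -> smooth_time T' f.
Proof. intros Hf HT n. eapply Ck_time_shorten; eauto. Qed.
Lemma smooth_exp T k : smooth_time T (fun t _ _ => exp (k * t)).
Proof.
  apply smooth_ext with (f := fun t _ _ => 1 * exp (k * t)); [intros; ring|].
  intros n. apply Ck_time_exp.
Qed.

Lemma partial_comm T i j f t x y : smooth_time T f -> in_time T t ->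
  partial i (partial j (f t)) x y = partial j (partial i (f t)) x y.
Proof.
  intros Hf Ht.
  assert (Hex : forall i x y, ex_partial i (f t) x y)
    by (intros; apply (smooth_ex_partial T); assumption).
  assert (Hex2 : forall i j x y, ex_partial i (partial j (f t)) x y).
  { intros. apply (smooth_ex_partial T i0 (fun t => partial j0 (f t))); [apply smooth_partial|]; assumption. }
  assert (Hc : forall i j x y, continuity_2d_pt (partial i (partial j (f t))) x y).
  { intros. apply (cont_time_2d T (fun t => partial i0 (partial j0 (f t)))); [|exact Ht].
    apply smooth_cont, (smooth_partial T i0 (fun t => partial j0 (f t))), smooth_partial, Hf. }
  assert (E : forall x y, partial X1 (partial X2 (f t)) x y = partial X2 (partial X1 (f t)) x y).
  { intros a b. apply (Schwarz (f t) a b).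
    - apply locally_2d_forall. intros u v. repeat split.
      + apply (Hex X1).
      + apply (Hex X2).
      + apply (Hex2 X1 X2).
      + apply (Hex2 X2 X1).
    - apply (Hc X1 X2).
    - apply (Hc X2 X1). }
  destruct i, j; auto.
Qed.

Lemma dt_rel_swap T f g : dt_rel T f g -> dt_rel T (swap f) (swap g).
Proof. intros H t x y H0 HT. apply H; assumption. Qed.

Lemma smooth_swap T f : smooth_time T f -> smooth_time T (swap f).
Proof. intros H n. apply Ck_time_swap, H. Qed.

(** Schwarz's theorem in the [(t, y)] plane. *)
Lemma dt_rel_partial2 T f g : smooth_time T f -> smooth_time T g -> dt_rel T f g ->
  dt_rel T (fun t => partial X2 (f t)) (fun t => partial X2 (g t)).
Proof.
  intros Hf Hg Hd t x y H0 HT.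
  assert (Hf2 := smooth_partial T X2 f Hf).
  destruct (smooth_dt_exists T _ Hf2) as (h & Hh & Dh).
  assert (Hl := locally_pos_time T t H0 HT).
  assert (Hl2 : locally_2d (fun u _ => 0 < u /\ Rbar_lt u T) t y).
  { apply locally_2d_locally.
    assert (Hc : continuous (fun z : R * R => fst z) (t, y)) by apply continuous_fst.
    apply (Hc _ Hl). }
  assert (E1 : forall u v, 0 < u /\ Rbar_lt u T ->
     Derive (fun z => Derive (fun s => f z x s) v) u = h u x v).
  { intros u v [Hu HuT]. apply is_derive_unique. apply (Dh u x v); assumption. }
  assert (E2 : forall u v, 0 < u /\ Rbar_lt u T ->
     Derive (fun z => Derive (fun s => f s x z) u) v = partial X2 (g u) x v).
  { intros u v [Hu HuT]. simpl. apply Derive_ext. intros z.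
    apply is_derive_unique, Hd; assumption. }
  replace (partial X2 (g t) x y) with (h t x y); [apply Dh; assumption|].
  rewrite <- (E1 t y), <- (E2 t y) by auto.
  apply (Schwarz (fun u v => f u x v) t y).
  - revert Hl2. apply locally_2d_impl, locally_2d_forall. intros u v [Hu HuT]. repeat split.
    + eexists. apply Hd; assumption.
    + apply (smooth_ex_partial T X2 f u x v Hf). apply in_time_pos; assumption.
    + eexists. apply (Dh u x v); assumption.
    + apply ex_derive_ext with (f := fun z => g u x z).
      * intros z. symmetry. apply is_derive_unique, Hd; assumption.
      * apply (smooth_ex_partial T X2 g u x v Hg). apply in_time_pos; assumption.
  - apply (continuity_2d_pt_ext_loc (fun u v => h u x v)).
    + revert Hl2. apply locally_2d_impl, locally_2d_forall. intros u v Hu. symmetry; apply E1; exact Hu.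
    + apply (cont_time_2d_ty T); auto using smooth_cont.
  - apply (continuity_2d_pt_ext_loc (fun u v => partial X2 (g u) x v)).
    + revert Hl2. apply locally_2d_impl, locally_2d_forall. intros u v Hu. symmetry; apply E2; exact Hu.
    + apply (cont_time_2d_ty T (fun u => partial X2 (g u))); auto using smooth_cont, smooth_partial.
Qed.

Lemma dt_rel_partial T i f g : smooth_time T f -> smooth_time T g -> dt_rel T f g ->
  dt_rel T (fun t => partial i (f t)) (fun t => partial i (g t)).
Proof.
  intros Hf Hg Hd. destruct i; [|apply dt_rel_partial2; assumption].
  apply (dt_rel_swap T (fun t => partial X2 (swap f t)) (fun t => partial X2 (swap g t))).
  apply dt_rel_partial2; auto using smooth_swap, dt_rel_swap.
Qed.

Lemma Dt_partial T i f t x y : smooth_time T f -> 0 < t -> Rbar_lt t T ->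
  Dt T (fun t => partial i (f t)) t x y = partial i (Dt T f t) x y.
Proof.
  intros Hf H0 HT.
  rewrite <- Dt_Derive by auto using smooth_partial.
  apply is_derive_unique.
  apply (dt_rel_partial T i f (Dt T f)); auto; apply Dt_spec; assumption.
Qed.

(** * Integration over the torus *)

Definition cont2 (f : sfield) : Prop :=
  forall x y, continuous (fun z : R * R => f (fst z) (snd z)) (x, y).

Lemma cont2_time T f : cont2 f -> cont_time T (fun _ => f).
Proof.
  intros H t x y _. unfold clamped.
  apply (continuous_comp_2 (fun z : R3 => snd (fst z)) (fun z => snd z) f);
  [apply continuous_z_x|apply continuous_z_y|apply H].
Qed.

Lemma cont_time_cont2 T f t : cont_time T f -> in_time T t -> cont2 (f t).
Proof.
  intros H Ht x y.
  apply (continuous_slice T f t (fun z : R * R => fst z) (fun z => snd z) (x, y)); auto;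
  [apply continuous_fst|apply continuous_snd].
Qed.

Lemma in_time_infty : in_time p_infty 0.
Proof. split; [lra|exact I]. Qed.
#[local] Hint Resolve in_time_infty : core.

Lemma cont2_const c : cont2 (fun _ _ => c).
Proof. intros x y. apply continuous_const. Qed.
Lemma cont2_plus f g : cont2 f -> cont2 g -> cont2 (fun x y => f x y + g x y).
Proof. intros Hf Hg x y. apply (continuous_plus (V := RN) (fun z : R * R => f (fst z) (snd z))); [apply Hf|apply Hg]. Qed.
Lemma cont2_mult f g : cont2 f -> cont2 g -> cont2 (fun x y => f x y * g x y).
Proof. intros Hf Hg x y. apply (continuous_mult (K := RA) (fun z : R * R => f (fst z) (snd z))); [apply Hf|apply Hg]. Qed.
Lemma cont2_opp f : cont2 f -> cont2 (fun x y => - f x y).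
Proof. intros Hf x y. apply (continuous_opp (V := RN) (fun z : R * R => f (fst z) (snd z))), Hf. Qed.
Lemma cont2_minus f g : cont2 f -> cont2 g -> cont2 (fun x y => f x y - g x y).
Proof. intros Hf Hg. apply cont2_plus; [exact Hf|apply cont2_opp; exact Hg]. Qed.
Lemma cont2_abs f : cont2 f -> cont2 (fun x y => Rabs (f x y)).
Proof. intros Hf x y. apply (continuous_comp (fun z : R * R => f (fst z) (snd z)) Rabs); [apply Hf|apply continuous_Rabs]. Qed.
Lemma cont2_pow f n : cont2 f -> cont2 (fun x y => f x y ^ n).
Proof.
  intros Hf. induction n as [|n IH]; simpl; [apply cont2_const|apply cont2_mult; assumption].
Qed.
Lemma cont2_swap f : cont2 f -> cont2 (fun x y => f y x).
Proof.
  intros Hf. apply (cont_time_cont2 p_infty (swap (fun _ => f)) 0); [|auto].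
  apply cont_time_swap, cont2_time, Hf.
Qed.

Create HintDb c2.
Ltac reg := auto 15 with c2.
#[local] Hint Resolve cont2_const cont2_plus cont2_mult cont2_opp cont2_minus cont2_abs cont2_pow : c2.

Lemma RInt_const_01 (c : R) : RInt (fun _ => c) 0 1 = c.
Proof. rewrite RInt_const. unfold scal; simpl; unfold mult; simpl. ring. Qed.

Lemma ex_RInt_inner f x a b : cont2 f -> ex_RInt (fun y => f x y) a b.
Proof. intros H. apply (ex_RInt_slice_y p_infty (fun _ => f) 0); [apply cont2_time, H|auto]. Qed.

Lemma cont2_inner f : cont2 f -> cont2 (fun x _ => RInt (fun y => f x y) 0 1).
Proof.
  intros H. apply (cont_time_cont2 p_infty (fun t x _ => Iy (fun _ => f) t x 1) 0); [|auto].
  apply (cont_time_freeze_y p_infty (Iy (fun _ => f)) 1), cont_time_Iy, cont2_time, H.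
Qed.

Lemma ex_RInt_outer f a b : cont2 f -> ex_RInt (fun x => RInt (fun y => f x y) 0 1) a b.
Proof.
  intros H. apply (ex_RInt_inner (fun _ x => RInt (fun y => f x y) 0 1) 0).
  apply (cont2_swap (fun x _ => RInt (fun y => f x y) 0 1)), cont2_inner, H.
Qed.

Lemma integral_ext f g : (forall x y, f x y = g x y) -> integral f = integral g.
Proof.
  intros E. replace g with f; [reflexivity|].
  field_ext x y. apply E.
Qed.

Lemma integral_plus f g : cont2 f -> cont2 g ->
  integral (fun x y => f x y + g x y) = integral f + integral g.
Proof.
  intros Hf Hg. unfold integral.
  rewrite <- (RInt_plus (V := RC)) by (apply ex_RInt_outer; assumption).
  apply RInt_ext. intros x _.
  apply (RInt_plus (V := RC)); apply ex_RInt_inner; assumption.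
Qed.

Lemma integral_scal c f : cont2 f -> integral (fun x y => c * f x y) = c * integral f.
Proof.
  intros Hf. unfold integral.
  rewrite <- (RInt_scal (V := RC) _ _ _ c) by (apply ex_RInt_outer; assumption).
  apply RInt_ext. intros x _.
  apply (RInt_scal (V := RC)); apply ex_RInt_inner; assumption.
Qed.

Lemma integral_opp f : cont2 f -> integral (fun x y => - f x y) = - integral f.
Proof.
  intros Hf. rewrite (integral_ext _ (fun x y => (-1) * f x y)) by (intros; ring).
  rewrite integral_scal by assumption. ring.
Qed.

Lemma integral_minus f g : cont2 f -> cont2 g ->
  integral (fun x y => f x y - g x y) = integral f - integral g.
Proof.
  intros Hf Hg. unfold Rminus. rewrite (integral_plus f (fun x y => - g x y)) by reg.
  rewrite integral_opp by assumption. reflexivity.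
Qed.

Lemma integral_const c : integral (fun _ _ => c) = c.
Proof.
  unfold integral. rewrite (RInt_ext _ (fun _ => c)).
  - apply RInt_const_01.
  - intros x _. apply RInt_const_01.
Qed.

Lemma integral_le_square f g : cont2 f -> cont2 g ->
  (forall x y, 0 <= x <= 1 -> 0 <= y <= 1 -> f x y <= g x y) -> integral f <= integral g.
Proof.
  intros Hf Hg H. unfold integral.
  apply RInt_le; [lra|apply ex_RInt_outer; assumption|apply ex_RInt_outer; assumption|].
  intros x Hx. apply RInt_le; [lra|apply ex_RInt_inner; assumption|apply ex_RInt_inner; assumption|].
  intros y Hy. apply H; lra.
Qed.

Lemma integral_le f g : cont2 f -> cont2 g -> (forall x y, f x y <= g x y) ->
  integral f <= integral g.
Proof. intros Hf Hg H. apply integral_le_square; auto. Qed.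

Lemma integral_ge0 f : cont2 f -> (forall x y, 0 <= f x y) -> 0 <= integral f.
Proof.
  intros Hf H. rewrite <- (integral_const 0). apply integral_le; reg.
Qed.

(** As functions of the upper bound [s] of the integral in [x], both iterated integrals
    vanish at [s = 0] and have the same derivative. *)
Lemma integral_Fubini f : cont2 f -> integral f = integral (fun x y => f y x).
Proof.
  intros Hf.
  assert (Hs := cont2_swap f Hf).
  set (F := Iy (fun _ => (fun x y => f y x))).
  assert (HF : cont_time p_infty F) by (apply cont_time_Iy, cont2_time, Hs).
  assert (H0 := in_time_infty).
  set (G := Iy (fun t x _ => Iy (fun _ => f) t x 1)).
  set (K := fun s => RInt (fun x => RInt (fun y => f x y) 0 1) 0 s - Iy (swap F) 0 s 1).
  assert (Dy : forall s, is_derive (fun s => Iy (swap F) 0 s 1) s (RInt (fun y => f s y) 0 1)).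
  { intros s.
    assert (E : (fun t : R => partial X1 (swap F t)) = fun _ => f).
    { field_ext t x. apply functional_extensionality; intros y.
      apply is_derive_unique.
      apply (is_derive_Iy_y p_infty (fun _ => (fun x y => f y x)) 0 y x (cont2_time _ _ Hs) H0). }
    replace (RInt (fun y => f s y) 0 1) with (Iy (fun t : R => partial X1 (swap F t)) 0 s 1) by (rewrite E; reflexivity).
    apply (is_derive_Iy_x p_infty).
    - apply cont_time_swap, HF.
    - exact H0.
    - intros x y. exists (f x y).
      apply (is_derive_Iy_y p_infty (fun _ => (fun x y => f y x)) 0 y x (cont2_time _ _ Hs) H0).
    - rewrite E. apply cont2_time, Hf. }
  assert (DK : forall s, is_derive K s 0).
  { intros s. replace 0 with (RInt (fun y => f s y) 0 1 - RInt (fun y => f s y) 0 1) by ring.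
    apply (is_derive_minus (V := RN)); [|apply Dy].
    apply (is_derive_Iy_y p_infty (fun _ _ x => RInt (fun y => f x y) 0 1) 0 0 s); [|exact H0].
    apply (cont2_time p_infty (fun _ x => RInt (fun y => f x y) 0 1)).
    apply (cont2_swap (fun x _ => RInt (fun y => f x y) 0 1)), cont2_inner, Hf. }
  assert (E := eq_is_derive K 0 1 (fun t _ => DK t) Rlt_0_1).
  unfold K in E. rewrite RInt_point in E.
  unfold integral.
  assert (E1 : Iy (swap F) 0 1 1 = RInt (fun x => RInt (fun y => f y x) 0 1) 0 1) by reflexivity.
  assert (E0 : Iy (swap F) 0 0 1 = 0).
  { unfold Iy at 1. rewrite (RInt_ext _ (fun _ => 0)).
    - apply RInt_const_01.
    - intros y _. unfold swap, F, Iy. apply (RInt_point (V := RC)). }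
  rewrite <- E1. rewrite E0 in E. unfold zero in E; simpl in E. lra.
Qed.

Lemma integral_tensor a b : cont2 (fun x _ => a x) -> cont2 (fun _ y => b y) ->
  integral (fun x y => a x * b y) = RInt a 0 1 * RInt b 0 1.
Proof.
  intros Ha Hb. unfold integral.
  assert (Hb' : ex_RInt b 0 1) by (apply (ex_RInt_inner (fun _ y => b y) 0 0 1 Hb)).
  assert (Ha' : ex_RInt a 0 1) by (apply (ex_RInt_inner (fun _ y => a y) 0 0 1 (cont2_swap _ Ha))).
  rewrite (RInt_ext _ (fun x => RInt b 0 1 * a x)).
  - rewrite (RInt_scal (V := RC)) by exact Ha'. unfold scal; simpl; unfold mult; simpl. ring.
  - intros x _. rewrite (RInt_scal (V := RC) _ _ _ (a x)) by exact Hb'.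
    unfold scal; simpl; unfold mult; simpl. ring.
Qed.

Lemma cauchy_schwarz f g : cont2 f -> cont2 g ->
  (integral (fun x y => f x y * g x y)) ^ 2
  <= integral (fun x y => f x y ^ 2) * integral (fun x y => g x y ^ 2).
Proof.
  intros Hf Hg.
  set (A := integral (fun x y => f x y ^ 2)). set (C := integral (fun x y => g x y ^ 2)).
  set (B := integral (fun x y => f x y * g x y)).
  assert (HA : 0 <= A) by (apply integral_ge0; [reg|intros; apply pow2_ge_0]).
  assert (HC : 0 <= C) by (apply integral_ge0; [reg|intros; apply pow2_ge_0]).
  assert (H : forall l, 0 <= A + 2 * l * B + l ^ 2 * C).
  { intros l.
    replace (A + 2 * l * B + l ^ 2 * C) with (integral (fun x y => (f x y + l * g x y) ^ 2)).
    - apply integral_ge0; [reg|intros; apply pow2_ge_0].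
    - rewrite (integral_ext _ (fun x y => f x y ^ 2 + ((2 * l) * (f x y * g x y) + l ^ 2 * g x y ^ 2)))
        by (intros; ring).
      rewrite (integral_plus (fun x y => f x y ^ 2)) by reg.
      rewrite (integral_plus (fun x y => (2 * l) * (f x y * g x y))) by reg.
      rewrite !integral_scal by reg. fold A B C. ring. }
  destruct HC as [HC|HC].
  - specialize (H (- B / C)).
    replace (A + 2 * (- B / C) * B + (- B / C) ^ 2 * C) with ((A * C - B ^ 2) / C) in H by (field; lra).
    assert (0 <= (A * C - B ^ 2) / C * C) by (apply Rmult_le_pos; lra).
    replace ((A * C - B ^ 2) / C * C) with (A * C - B ^ 2) in H0 by (field; lra). lra.
  - rewrite <- HC in *. destruct (Req_dec B 0) as [HB|HB]; [rewrite HB; lra|].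
    specialize (H (- (A + 1) / (2 * B))).
    replace (A + 2 * (- (A + 1) / (2 * B)) * B + (- (A + 1) / (2 * B)) ^ 2 * 0) with (-1) in H by (field; exact HB). lra.
Qed.

Lemma normL2_pow2 f : cont2 f -> normL2 f ^ 2 = integral (fun x y => f x y ^ 2).
Proof.
  intros Hf. unfold normL2. apply pow2_sqrt.
  apply integral_ge0; [reg|intros; apply pow2_ge_0].
Qed.

Lemma normL2_ge0 f : 0 <= normL2 f.
Proof. apply sqrt_pos. Qed.

Lemma Rle_of_pow2 a b : 0 <= b -> a ^ 2 <= b ^ 2 -> a <= b.
Proof. intros Hb H. apply Rnot_lt_le. intros Hlt. nra. Qed.

Lemma integral_abs_mult_le f g : cont2 f -> cont2 g ->
  integral (fun x y => Rabs (f x y * g x y)) <= normL2 f * normL2 g.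
Proof.
  intros Hf Hg.
  apply Rle_of_pow2; [apply Rmult_le_pos; apply normL2_ge0|].
  rewrite Rpow_mult_distr, !normL2_pow2 by assumption.
  rewrite (integral_ext (fun x y => f x y ^ 2) (fun x y => Rabs (f x y) ^ 2)) by (intros; rewrite pow2_abs; reflexivity).
  rewrite (integral_ext (fun x y => g x y ^ 2) (fun x y => Rabs (g x y) ^ 2)) by (intros; rewrite pow2_abs; reflexivity).
  rewrite (integral_ext _ (fun x y => Rabs (f x y) * Rabs (g x y))) by (intros; apply Rabs_mult).
  apply cauchy_schwarz; reg.
Qed.

(** Taking fields constant in time, all closure properties of [smooth_time] carry over to
    functions on the torus. *)
Definition smooth (f : sfield) : Prop := smooth_time p_infty (fun _ => f).

Lemma smooth_cont2 f : smooth f -> cont2 f.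
Proof. intros H. apply (cont_time_cont2 p_infty (fun _ => f) 0); [apply smooth_cont, H|auto]. Qed.
Lemma sm_partial i f : smooth f -> smooth (partial i f).
Proof. intros H. apply (smooth_partial p_infty i (fun _ => f) H). Qed.
Lemma sm_ex_partial i f x y : smooth f -> ex_partial i f x y.
Proof. intros H. apply (smooth_ex_partial p_infty i (fun _ => f) 0 x y H); auto. Qed.
Lemma sm_comm i j f x y : smooth f -> partial i (partial j f) x y = partial j (partial i f) x y.
Proof. intros H. apply (partial_comm p_infty i j (fun _ => f) 0 x y H); auto. Qed.
Lemma sm_const c : smooth (fun _ _ => c).
Proof. apply smooth_const. Qed.
Lemma sm_plus f g : smooth f -> smooth g -> smooth (fun x y => f x y + g x y).
Proof. apply smooth_plus. Qed.
Lemma sm_minus f g : smooth f -> smooth g -> smooth (fun x y => f x y - g x y).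
Proof. apply smooth_minus. Qed.
Lemma sm_opp f : smooth f -> smooth (fun x y => - f x y).
Proof. apply smooth_opp. Qed.
Lemma sm_mult f g : smooth f -> smooth g -> smooth (fun x y => f x y * g x y).
Proof. apply smooth_mult. Qed.
Lemma sm_pow f n : smooth f -> smooth (fun x y => f x y ^ n).
Proof. apply smooth_pow. Qed.
Lemma sm_slice T f t : smooth_time T f -> in_time T t -> smooth (f t).
Proof. apply smooth_slice. Qed.

#[local] Hint Resolve sm_partial sm_const sm_plus sm_minus sm_opp sm_mult sm_pow sm_ex_partial
  smooth_cont2 : c2.

Lemma sm_partial_pow i f n x y : smooth f ->
  partial i (fun x y => f x y ^ S n) x y = INR (S n) * (f x y ^ n * partial i f x y).
Proof.
  intros Hf. induction n as [|n IH].
  - simpl. transitivity (partial i f x y); [|ring].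
    f_equal. field_ext a b. ring.
  - change (partial i (fun x y => f x y * f x y ^ S n) x y = INR (S (S n)) * (f x y ^ S n * partial i f x y)).
    rewrite (partial_mult i f (fun x y => f x y ^ S n)) by reg.
    rewrite IH. rewrite (S_INR (S n)). simpl pow. ring.
Qed.

Lemma periodic_partial i f : periodic f -> periodic (partial i f).
Proof.
  intros H.
  assert (E1 : forall y, (fun s => f s (y + 1)) = fun s => f s y).
  { intros y. apply functional_extensionality; intros s. apply H. }
  assert (E2 : forall x, (fun s => f (x + 1) s) = fun s => f x s).
  { intros y. apply functional_extensionality; intros s. apply H. }
  assert (Sh : forall (g : R -> R), (forall s, g (s + 1) = g s) -> forall x, Derive g (x + 1) = Derive g x).
  { intros g Hg x. unfold Derive. apply (f_equal real), Lim_ext. intros h.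
    replace (x + 1 + h) with (x + h + 1) by ring. now rewrite !Hg. }
  intros x y. destruct i; simpl; split.
  - apply (Sh (fun s => f s y)). intros s; apply H.
  - now rewrite E1.
  - now rewrite E2.
  - apply (Sh (fun s => f x s)). intros s; apply H.
Qed.

Ltac periodic_pointwise :=
  intros; intros x y;
  repeat match goal with H : periodic _ |- _ => destruct (H x y) as [-> ->]; clear H end; now split.

Lemma periodic_mult f g : periodic f -> periodic g -> periodic (fun x y => f x y * g x y).
Proof. periodic_pointwise. Qed.
Lemma periodic_plus f g : periodic f -> periodic g -> periodic (fun x y => f x y + g x y).
Proof. periodic_pointwise. Qed.
Lemma periodic_minus f g : periodic f -> periodic g -> periodic (fun x y => f x y - g x y).
Proof. periodic_pointwise. Qed.
Lemma periodic_opp f : periodic f -> periodic (fun x y => - f x y).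
Proof. periodic_pointwise. Qed.
Lemma periodic_const c : periodic (fun _ _ => c).
Proof. split; reflexivity. Qed.
Lemma periodic_pow f n : periodic f -> periodic (fun x y => f x y ^ n).
Proof. periodic_pointwise. Qed.

#[local] Hint Resolve periodic_partial periodic_mult periodic_plus periodic_minus periodic_opp periodic_const periodic_pow : c2.

Lemma RInt_Derive_smooth (g : R -> R) a b : (forall x, ex_derive g x) ->
  (forall x, continuous (Derive g) x) -> RInt (Derive g) a b = g b - g a.
Proof. intros H1 H2. apply RInt_Derive; auto. Qed.

Lemma cont2_slice_y f x : cont2 f -> forall y, continuous (fun s => f x s) y.
Proof.
  intros Hf y. apply (continuous_slice p_infty (fun _ => f) 0 (fun _ => x) (fun s => s));
  [apply cont2_time, Hf|auto|apply continuous_const|apply continuous_id].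
Qed.
Lemma cont2_slice_x f y : cont2 f -> forall x, continuous (fun s => f s y) x.
Proof. intros Hf. apply (cont2_slice_y (fun x y => f y x) y), cont2_swap, Hf. Qed.

Lemma integral_partial i f : smooth f -> periodic f -> integral (partial i f) = 0.
Proof.
  assert (H2 : forall f, smooth f -> periodic f -> integral (partial X2 f) = 0).
  { clear. intros f Hf Hp. unfold integral.
    rewrite (RInt_ext _ (fun _ => 0)).
    - apply RInt_const_01.
    - intros x _. change (RInt (Derive (fun y => f x y)) 0 1 = 0).
      rewrite RInt_Derive_smooth.
      + destruct (Hp x 0) as [_ E]. rewrite Rplus_0_l in E. apply Rminus_diag_eq, E.
      + intros y. apply (sm_ex_partial X2 f x y Hf).
      + intros y. apply (cont2_slice_y (partial X2 f)). reg. }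
  intros Hf Hp. destruct i; [|apply H2; assumption].
  rewrite integral_Fubini by reg.
  apply (H2 (fun x y => f y x)).
  - apply (smooth_swap p_infty (fun _ => f)), Hf.
  - intros x y. destruct (Hp y x); split; assumption.
Qed.

Lemma integral_parts i f g : smooth f -> smooth g -> periodic f -> periodic g ->
  integral (fun x y => partial i f x y * g x y) = - integral (fun x y => f x y * partial i g x y).
Proof.
  intros Hf Hg Pf Pg.
  assert (H := integral_partial i (fun x y => f x y * g x y)).
  rewrite (integral_ext _ (fun x y => partial i f x y * g x y + f x y * partial i g x y)) in H
    by (intros; apply partial_mult; reg).
  rewrite (integral_plus (fun x y => partial i f x y * g x y)) in H by reg.
  specialize (H ltac:(reg) ltac:(reg)). lra.
Qed.

(** * Sobolev inequalities on the torus *)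

Lemma trace_1d (g : R -> R) : (forall x, ex_derive g x) -> (forall x, continuous (Derive g) x) ->
  forall x, 0 <= x <= 1 -> Rabs (g x) <= RInt (fun s => Rabs (g s) + Rabs (Derive g s)) 0 1.
Proof.
  intros H1 H2 x Hx.
  assert (Hg : forall a b, ex_RInt (fun s => Rabs (g s)) a b).
  { intros a b. apply (ex_RInt_continuous (V := RC)). intros z _.
    apply continuous_Rabs_comp, (ex_derive_continuous (V := RN)), H1. }
  assert (Hd : forall a b, ex_RInt (Derive g) a b).
  { intros a b. apply (ex_RInt_continuous (V := RC)). intros z _. apply H2. }
  assert (Ha : forall a b, ex_RInt (fun s => Rabs (Derive g s)) a b).
  { intros a b. apply (ex_RInt_continuous (V := RC)). intros z _.
    apply continuous_Rabs_comp, H2. }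
  set (V := RInt (fun s => Rabs (Derive g s)) 0 1).
  assert (Hmono : forall a b, 0 <= a -> a <= b -> b <= 1 -> RInt (fun s => Rabs (Derive g s)) a b <= V).
  { intros a b H0a Hab Hb1. unfold V.
    rewrite <- (RInt_Chasles (V := RC) _ 0 a 1) by auto.
    rewrite <- (RInt_Chasles (V := RC) _ a b 1) by auto.
    assert (0 <= RInt (fun s => Rabs (Derive g s)) 0 a) by (apply RInt_ge_0; auto; intros; apply Rabs_pos).
    assert (0 <= RInt (fun s => Rabs (Derive g s)) b 1) by (apply RInt_ge_0; auto; intros; apply Rabs_pos).
    unfold plus; simpl. lra. }
  assert (Hw : forall a b, 0 <= a -> a <= b -> b <= 1 -> Rabs (g b - g a) <= V).
  { intros a b H0a Hab Hb1. rewrite <- RInt_Derive_smooth by assumption.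
    eapply Rle_trans; [apply abs_RInt_le; auto|apply Hmono; assumption]. }
  assert (Hpt : forall s, 0 < s < 1 -> Rabs (g x) <= Rabs (g s) + V).
  { intros s Hs.
    assert (Rabs (g x - g s) <= V).
    { destruct (Rle_dec s x); [apply Hw; lra|]. rewrite Rabs_minus_sym. apply Hw; lra. }
    replace (g x) with (g s + (g x - g s)) by ring.
    eapply Rle_trans; [apply Rabs_triang|lra]. }
  rewrite (RInt_plus (V := RC)) by auto. fold V.
  replace (Rabs (g x)) with (RInt (fun _ => Rabs (g x)) 0 1).
  2:{ apply RInt_const_01. }
  replace V with (RInt (fun _ => V) 0 1) at 1.
  2:{ apply RInt_const_01. }
  rewrite <- (RInt_plus (V := RC)) by (auto; apply ex_RInt_const).
  apply RInt_le; [lra|apply ex_RInt_const| |exact Hpt].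
  apply (ex_RInt_plus (V := RN)); [apply Hg|apply ex_RInt_const].
Qed.

Definition trace_y (f : sfield) : sfield :=
  fun x _ => RInt (fun s => Rabs (f x s) + Rabs (partial X2 f x s)) 0 1.
Definition trace_x (f : sfield) : sfield :=
  fun _ y => RInt (fun s => Rabs (f s y) + Rabs (partial X1 f s y)) 0 1.

Lemma trace_y_bound f x y : smooth f -> 0 <= y <= 1 -> Rabs (f x y) <= trace_y f x y.
Proof.
  intros Hf Hy. apply (trace_1d (fun s => f x s)); [| |exact Hy].
  - intros s. apply (sm_ex_partial X2 f x s Hf).
  - intros s. apply (cont2_slice_y (partial X2 f)). reg.
Qed.
Lemma trace_x_bound f x y : smooth f -> 0 <= x <= 1 -> Rabs (f x y) <= trace_x f x y.
Proof.
  intros Hf. apply (trace_y_bound (fun x y => f y x) y x). apply (smooth_swap p_infty (fun _ => f)), Hf.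
Qed.
Lemma cont2_trace_y f : smooth f -> cont2 (trace_y f).
Proof. intros Hf. apply (cont2_inner (fun x s => Rabs (f x s) + Rabs (partial X2 f x s))). reg. Qed.
Lemma cont2_trace_x f : smooth f -> cont2 (trace_x f).
Proof.
  intros Hf. apply (cont2_swap (trace_y (fun x y => f y x))), cont2_trace_y.
  apply (smooth_swap p_infty (fun _ => f)), Hf.
Qed.

Definition normW11 (i : axis) (f : sfield) : R :=
  integral (fun x y => Rabs (f x y) + Rabs (partial i f x y)).

(** By the one-dimensional bound in either variable, [f^2] is at most the product of a
    function of [x] and a function of [y]. *)
Lemma gagliardo_nirenberg f : smooth f -> normL2 f ^ 2 <= normW11 X1 f * normW11 X2 f.
Proof.
  intros Hf. rewrite normL2_pow2 by reg.
  assert (C1 := cont2_trace_x f Hf). assert (C2 := cont2_trace_y f Hf).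
  apply Rle_trans with (integral (fun x y => trace_y f x y * trace_x f x y)).
  - apply integral_le_square; [reg|reg|]. intros x y Hx Hy.
    rewrite <- pow2_abs. simpl; rewrite Rmult_1_r.
    apply Rmult_le_compat; try apply Rabs_pos; [apply trace_y_bound|apply trace_x_bound]; assumption.
  - right. etransitivity; [exact (integral_tensor (fun x => trace_y f x 0) (fun y => trace_x f 0 y) C2 C1)|].
    rewrite Rmult_comm. f_equal. unfold normW11. rewrite integral_Fubini by reg. reflexivity.
Qed.

Lemma periodic_IZR f : periodic f -> forall n x y, f (x + IZR n) y = f x y /\ f x (y + IZR n) = f x y.
Proof.
  intros Hf.
  assert (Hn : forall n x y, f (x + INR n) y = f x y /\ f x (y + INR n) = f x y).
  { induction n as [|n IH]; intros x y.
    - simpl. now rewrite !Rplus_0_r.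
    - rewrite S_INR. split.
      + rewrite <- Rplus_assoc. destruct (Hf (x + INR n) y) as [E _]. rewrite E. apply IH.
      + rewrite <- Rplus_assoc. destruct (Hf x (y + INR n)) as [_ E]. rewrite E. apply IH. }
  intros n x y. destruct (ZArith_dec.Z_le_gt_dec 0 n) as [H|H].
  - rewrite <- (Z2Nat.id n H), <- INR_IZR_INZ. apply Hn.
  - assert (E : IZR n = - INR (Z.to_nat (- n))).
    { rewrite INR_IZR_INZ, Z2Nat.id by lia. rewrite opp_IZR. ring. }
    rewrite E. split.
    + rewrite <- (proj1 (Hn (Z.to_nat (- n)) (x + - INR (Z.to_nat (- n))) y)). f_equal. ring.
    + rewrite <- (proj2 (Hn (Z.to_nat (- n)) x (y + - INR (Z.to_nat (- n))))). f_equal. ring.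
Qed.

Lemma periodic_unit_square f : periodic f -> forall x y, exists x' y',
  0 <= x' <= 1 /\ 0 <= y' <= 1 /\ f x y = f x' y'.
Proof.
  intros Hf x y.
  assert (Hu : forall s, exists n, 0 <= s + IZR n <= 1).
  { intros s. exists (1 - up s)%Z. rewrite minus_IZR. destruct (archimed s). lra. }
  destruct (Hu x) as [n Hn], (Hu y) as [m Hm].
  exists (x + IZR n), (y + IZR m). split; [exact Hn|split; [exact Hm|]].
  rewrite (proj1 (periodic_IZR f Hf n x (y + IZR m))).
  now rewrite (proj2 (periodic_IZR f Hf m x y)).
Qed.

(** The one-dimensional bound, first in [x] and then in [y]. *)
Lemma sup_le_W11 f x y : smooth f -> periodic f ->
  Rabs (f x y) <= normW11 X2 f + normW11 X2 (partial X1 f).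
Proof.
  intros Hf Hp.
  destruct (periodic_unit_square f Hp x y) as (x' & y' & Hx & Hy & E). rewrite E.
  eapply Rle_trans; [apply (trace_x_bound f x' y' Hf Hx)|].
  unfold normW11. rewrite <- integral_plus by reg.
  unfold trace_x. unfold integral.
  assert (Hc : cont2 (fun s _ : R => Rabs (f s y') + Rabs (partial X1 f s y'))).
  { intros a b.
    apply (continuous_comp (fun z : R * R => fst z) (fun s => Rabs (f s y') + Rabs (partial X1 f s y'))).
    - apply continuous_fst.
    - apply (cont2_slice_x (fun s y' => Rabs (f s y') + Rabs (partial X1 f s y'))). reg. }
  apply RInt_le; [lra| | |].
  - apply (ex_RInt_inner (fun _ s => Rabs (f s y') + Rabs (partial X1 f s y')) 0).
    apply (cont2_swap _ Hc).
  - apply ex_RInt_outer. reg.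
  - intros s Hs.
    eapply Rle_trans.
    + apply Rplus_le_compat; [apply (trace_y_bound f s y' Hf Hy)|apply (trace_y_bound (partial X1 f) s y'); reg].
    + unfold trace_y. right.
      rewrite <- (RInt_plus (V := RC)); [reflexivity| |].
      * apply (ex_RInt_inner (fun x s => Rabs (f x s) + Rabs (partial X2 f x s))); reg.
      * apply (ex_RInt_inner (fun x s => Rabs (partial X1 f x s) + Rabs (partial X2 (partial X1 f) x s))); reg.
Qed.

Definition H1_le (f : sfield) (h : R) : Prop :=
  normL2 f <= h /\ forall i, normL2 (partial i f) <= h.

Lemma normW11_le i f a b : smooth f -> integral (fun x y => Rabs (f x y)) <= a ->
  integral (fun x y => Rabs (partial i f x y)) <= b -> normW11 i f <= a + b.
Proof.
  intros Hf Ha Hb. unfold normW11. rewrite integral_plus by reg. lra.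
Qed.

Lemma integral_abs_mult_bound f g a b : cont2 f -> cont2 g -> normL2 f <= a -> normL2 g <= b ->
  integral (fun x y => Rabs (f x y * g x y)) <= a * b.
Proof.
  intros Hf Hg Ha Hb. eapply Rle_trans; [apply integral_abs_mult_le; assumption|].
  apply Rmult_le_compat; auto using normL2_ge0.
Qed.

Lemma normW11_pow_le n i f h q : smooth f -> H1_le f h -> normL2 (fun x y => f x y ^ n) <= q ->
  normW11 i (fun x y => f x y ^ S n) <= (INR n + 2) * h * q.
Proof.
  intros Hf [H0 H1] Hq.
  replace ((INR n + 2) * h * q) with (h * q + INR (S n) * (q * h)) by (rewrite S_INR; ring).
  apply normW11_le; [reg| |].
  - apply (integral_abs_mult_bound f (fun x y => f x y ^ n)); reg.
  - rewrite (integral_ext _ (fun x y => INR (S n) * Rabs (f x y ^ n * partial i f x y))).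
    + rewrite integral_scal by reg.
      apply Rmult_le_compat_l; [apply pos_INR|].
      apply (integral_abs_mult_bound (fun x y => f x y ^ n)); reg.
    + intros x y. rewrite sm_partial_pow by assumption. rewrite Rabs_mult, (Rabs_pos_eq (INR (S n))) by apply pos_INR.
      reflexivity.
Qed.

Lemma normL2_pow_step n f h q : smooth f -> H1_le f h -> normL2 (fun x y => f x y ^ n) <= q ->
  normL2 (fun x y => f x y ^ S n) <= (INR n + 2) * h * q.
Proof.
  intros Hf Hh Hq.
  assert (h0 : 0 <= h) by (destruct Hh as [H _]; eapply Rle_trans; [apply normL2_ge0|exact H]).
  assert (q0 : 0 <= q) by (eapply Rle_trans; [apply normL2_ge0|exact Hq]).
  assert (n0 := pos_INR n).
  assert (B : forall i, normW11 i (fun x y => f x y ^ S n) <= (INR n + 2) * h * q)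
    by (intros; apply normW11_pow_le; assumption).
  apply Rle_of_pow2; [apply Rmult_le_pos; [apply Rmult_le_pos; lra|exact q0]|].
  eapply Rle_trans; [apply gagliardo_nirenberg; reg|].
  simpl; rewrite Rmult_1_r.
  apply Rmult_le_compat; [| |apply B|apply B];
  (apply integral_ge0; [reg|intros; apply Rplus_le_le_0_compat; apply Rabs_pos]).
Qed.

(** [H^1] embeds into every [L^(2n)]: apply [gagliardo_nirenberg] to the powers of [f], whose
    gradients are bounded by Cauchy-Schwarz. *)
Lemma normL2_pow_le n f h : smooth f -> H1_le f h ->
  normL2 (fun x y => f x y ^ n) <= INR (fact (S n)) * h ^ n.
Proof.
  intros Hf Hh. induction n as [|n IH].
  - simpl. unfold normL2. rewrite (integral_ext _ (fun _ _ => 1)) by (intros; ring).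
    rewrite integral_const, sqrt_1. lra.
  - eapply Rle_trans; [apply (normL2_pow_step n f h _ Hf Hh IH)|].
    right. change (fact (S (S n))) with (S (S n) * fact (S n))%nat.
    rewrite mult_INR, !S_INR. simpl pow. ring.
Qed.

(** Since [n] is arbitrary, a polynomial loss in the second derivatives costs an
    arbitrarily small power of the [H^1] norm. *)
Lemma sup_interpolation n : exists c, 0 < c /\ forall f h D, smooth f -> periodic f ->
  H1_le f h -> (forall i j, normL2 (partial i (partial j f)) <= D) ->
  forall x y, Rabs (f x y) ^ S (S n) <= c * h ^ S n * (h + D).
Proof.
  set (N := INR (S (S n))).
  set (F := INR (fact (S (S n)))).
  assert (HN : 2 <= N) by (unfold N; rewrite !S_INR; assert (H := pos_INR n); lra).
  assert (HF : 0 < F) by apply INR_fact_lt_0.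
  exists (F * (1 + 3 * N + 3 * N ^ 2)).
  split; [apply Rmult_lt_0_compat; [exact HF|nra]|].
  intros f h D Hf Hp Hh HD x y.
  assert (h0 : 0 <= h) by (destruct Hh as [H _]; eapply Rle_trans; [apply normL2_ge0|exact H]).
  assert (D0 : 0 <= D) by (eapply Rle_trans; [apply normL2_ge0|apply (HD X1 X1)]).
  assert (Q1 : normL2 (fun x y => f x y ^ S n) <= F * h ^ S n) by (apply normL2_pow_le; assumption).
  assert (Q0 : normL2 (fun x y => f x y ^ n) <= F * h ^ n).
  { eapply Rle_trans; [apply (normL2_pow_le n f h Hf Hh)|].
    apply Rmult_le_compat_r; [apply pow_le; exact h0|].
    apply le_INR, fact_le. lia. }
  assert (Hsq : forall i, normL2 (fun x y => partial i f x y ^ 2) <= 3 * (h + D) * h).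
  { intros i. destruct Hh as [H0 H1].
    replace (3 * (h + D) * h) with ((INR 1 + 2) * (h + D) * h) by (simpl; ring).
    apply (normL2_pow_step 1 (partial i f)); [reg| |].
    - split; [specialize (H1 i); lra|]. intros j. specialize (HD j i). lra.
    - rewrite (functional_extensionality (fun x y => partial i f x y ^ 1) (partial i f)); [apply H1|].
      intros a. apply functional_extensionality; intros b. ring. }
  rewrite RPow_abs.
  eapply Rle_trans; [apply (sup_le_W11 (fun x y => f x y ^ S (S n)) x y); reg|].
  set (p := h ^ n) in *.
  assert (p0 : 0 <= p) by (apply pow_le; exact h0).
  assert (Ep : h ^ S n = h * p) by reflexivity. rewrite Ep in *.
  assert (W1 : normW11 X2 (fun x y => f x y ^ S (S n)) <= (N + 1) * h * (F * (h * p))).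
  { replace (N + 1) with (INR (S n) + 2) by (unfold N; rewrite !S_INR; ring).
    apply normW11_pow_le; assumption. }
  assert (E1 : forall i, partial i (fun x y => f x y ^ S (S n)) =
     fun x y => N * (f x y ^ S n * partial i f x y)).
  { intros i. field_ext a b.
    apply sm_partial_pow; exact Hf. }
  assert (E2 : forall a b, partial X2 (partial X1 (fun x y => f x y ^ S (S n))) a b =
     N * (INR (S n) * (f a b ^ n * (partial X2 f a b * partial X1 f a b)) + f a b ^ S n * partial X2 (partial X1 f) a b)).
  { intros a b. rewrite E1.
    rewrite (partial_mult X2 (fun _ _ => N) (fun x y => f x y ^ S n * partial X1 f x y)) by reg.
    rewrite partial_const.
    rewrite (partial_mult X2 (fun x y => f x y ^ S n) (partial X1 f)) by reg.
    rewrite sm_partial_pow by exact Hf. ring. }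
  assert (W2 : normW11 X2 (partial X1 (fun x y => f x y ^ S (S n))) <=
     N * ((F * (h * p)) * h) + N * (N * ((F * p) * (3 * (h + D) * h)) + (F * (h * p)) * D)).
  { apply normW11_le; [reg| |].
    - rewrite E1.
      rewrite (integral_ext _ (fun x y => N * Rabs (f x y ^ S n * partial X1 f x y))).
      2:{ intros a b. rewrite Rabs_mult, (Rabs_pos_eq N) by lra. reflexivity. }
      rewrite integral_scal by reg.
      apply Rmult_le_compat_l; [lra|].
      apply (integral_abs_mult_bound (fun x y => f x y ^ S n)); reg. apply Hh.
    - apply Rle_trans with (integral (fun a b =>
        N * (N * (/ 2 * Rabs (f a b ^ n * partial X1 f a b ^ 2) + / 2 * Rabs (f a b ^ n * partial X2 f a b ^ 2))
          + Rabs (f a b ^ S n * partial X2 (partial X1 f) a b)))).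
      + apply integral_le; [reg|reg|]. intros a b. rewrite E2.
        rewrite Rabs_mult, (Rabs_pos_eq N) by lra.
        apply Rmult_le_compat_l; [lra|].
        eapply Rle_trans; [apply Rabs_triang|]. apply Rplus_le_compat_r.
        assert (HSn : 0 <= INR (S n) <= N) by (split; [apply pos_INR|apply le_INR; lia]).
        rewrite Rabs_mult, (Rabs_pos_eq (INR (S n))) by lra.
        apply Rmult_le_compat; [lra|apply Rabs_pos|lra|].
        rewrite !(Rabs_mult (f a b ^ n)).
        replace (/ 2 * (Rabs (f a b ^ n) * Rabs (partial X1 f a b ^ 2)) + / 2 * (Rabs (f a b ^ n) * Rabs (partial X2 f a b ^ 2)))
         with (Rabs (f a b ^ n) * (/ 2 * Rabs (partial X1 f a b ^ 2) + / 2 * Rabs (partial X2 f a b ^ 2))) by ring.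
        apply Rmult_le_compat_l; [apply Rabs_pos|].
        rewrite Rabs_mult, <- !RPow_abs.
        assert (Hq := pow2_ge_0 (Rabs (partial X1 f a b) - Rabs (partial X2 f a b))). lra.
      + rewrite integral_scal by reg.
        apply Rmult_le_compat_l; [lra|].
        rewrite integral_plus by reg.
        apply Rplus_le_compat.
        * rewrite integral_scal by reg. apply Rmult_le_compat_l; [lra|].
          rewrite integral_plus by reg. rewrite !integral_scal by reg.
          assert (HB : forall i, integral (fun x y => Rabs (f x y ^ n * partial i f x y ^ 2)) <= F * p * (3 * (h + D) * h)).
          { intros i. apply (integral_abs_mult_bound (fun x y => f x y ^ n) (fun x y => partial i f x y ^ 2)); reg. }
          axes HB. lra.
        * apply (integral_abs_mult_bound (fun x y => f x y ^ S n)); reg. }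
  eapply Rle_trans; [apply Rplus_le_compat; [exact W1|exact W2]|].
  assert (Hm : forall a b, 0 <= a -> 0 <= b -> 0 <= a * b) by exact Rmult_le_pos.
  assert (Zh : 0 <= F * p * h * h) by (repeat apply Hm; lra).
  assert (ZD : 0 <= F * p * h * D) by (repeat apply Hm; lra).
  assert (ZN := Hm N _ ltac:(lra) Zh). assert (ZND := Hm N _ ltac:(lra) ZD).
  ring_simplify. nra.
Qed.

(** After one integration by parts the integrand is [-3 f (d_i f)^2 (d_i d_i f)]; half of the
    left-hand side is absorbed by Young's inequality. *)
Lemma integral_partial_pow4 i f K : smooth f -> periodic f -> (forall x y, Rabs (f x y) <= K) ->
  integral (fun x y => partial i f x y ^ 4) <= 9 * K ^ 2 * integral (fun x y => partial i (partial i f) x y ^ 2).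
Proof.
  intros Hf Hp HK.
  assert (E : integral (fun x y => partial i f x y ^ 4) =
     integral (fun x y => - (3 * (f x y * (partial i f x y ^ 2 * partial i (partial i f) x y))))).
  { rewrite (integral_ext _ (fun x y => partial i f x y * partial i f x y ^ 3)) by (intros; ring).
    rewrite (integral_parts i f (fun x y => partial i f x y ^ 3)) by reg.
    rewrite <- integral_opp by reg. apply integral_ext. intros x y.
    rewrite sm_partial_pow by reg. simpl INR. ring. }
  assert (L : integral (fun x y => - (3 * (f x y * (partial i f x y ^ 2 * partial i (partial i f) x y))))
     <= integral (fun x y => / 2 * partial i f x y ^ 4 + (9 / 2 * K ^ 2) * partial i (partial i f) x y ^ 2)).
  { apply integral_le; [reg|reg|]. intros x y.
    set (a := partial i f x y). set (b := partial i (partial i f) x y).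
    assert (Hk := HK x y). set (v := f x y) in *.
    assert (Hv : v ^ 2 <= K ^ 2).
    { rewrite <- (pow2_abs v). apply pow_incr. split; [apply Rabs_pos|exact Hk]. }
    assert (Hq := pow2_ge_0 (a ^ 2 + 3 * v * b)).
    assert (0 <= b ^ 2) by apply pow2_ge_0.
    assert (v ^ 2 * b ^ 2 <= K ^ 2 * b ^ 2) by (apply Rmult_le_compat_r; assumption). nra. }
  rewrite integral_plus in L by reg.
  rewrite !integral_scal in L by reg. lra.
Qed.

Lemma integral_partial12 f : smooth f -> periodic f ->
  integral (fun x y => partial X1 (partial X2 f) x y ^ 2)
  = integral (fun x y => partial X1 (partial X1 f) x y * partial X2 (partial X2 f) x y).
Proof.
  intros Hf Hp.
  assert (A := integral_parts X1 (partial X1 f) (partial X2 (partial X2 f))).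
  rewrite A by reg.
  assert (B := integral_parts X2 (partial X1 f) (partial X1 (partial X2 f))).
  rewrite (integral_ext (fun x y => partial X1 f x y * partial X1 (partial X2 (partial X2 f)) x y)
     (fun x y => partial X1 f x y * partial X2 (partial X1 (partial X2 f)) x y)).
  - rewrite <- B by reg. apply integral_ext. intros x y.
    rewrite (sm_comm X2 X1) by reg. ring.
  - intros x y. f_equal. apply sm_comm. reg.
Qed.

(** * Smooth periodic fields, Gronwall's lemma and continuous induction *)
Lemma ts_periodic T f t : ts T f -> in_time T t -> periodic (f t).
Proof. intros [H _]; apply H. Qed.
Lemma ts_smooth T f : ts T f -> smooth_time T f.
Proof. intros [_ H]; exact H. Qed.
Lemma ts_slice T f t : ts T f -> in_time T t -> smooth (f t).
Proof. intros H Ht. apply (sm_slice T); [apply ts_smooth|]; assumption. Qed.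
Lemma ts_slice1 T (w : R -> vfield) t : ts_v T w ->
  in_time T t -> forall j, smooth (w t j).
Proof. intros H Ht j. apply (ts_slice T (fun t => w t j)); auto. Qed.
Lemma ts_slice2 T (W : R -> mfield) t : ts_m T W ->
  in_time T t -> forall i j, smooth (W t i j).
Proof. intros H Ht i j. apply (ts_slice T (fun t => W t i j)); auto. Qed.
Lemma ts_intro T f : (forall t, in_time T t -> periodic (f t)) -> smooth_time T f ->
  ts T f.
Proof. intros H1 H2. split; assumption. Qed.
Ltac ts_close P S :=
  intros; apply ts_intro;
  [intros t Ht; apply P;
   match goal with H : torus_smooth_time _ ?f |- periodic (?f _) => apply (ts_periodic _ _ _ H Ht) end
  |apply S; apply ts_smooth; assumption].

Lemma ts_partial T i f : ts T f -> ts T (fun t => partial i (f t)).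
Proof. ts_close periodic_partial smooth_partial. Qed.
Lemma ts_plus T f g : ts T f -> ts T g -> ts T (fun t x y => f t x y + g t x y).
Proof. ts_close periodic_plus smooth_plus. Qed.
Lemma ts_minus T f g : ts T f -> ts T g -> ts T (fun t x y => f t x y - g t x y).
Proof. ts_close periodic_minus smooth_minus. Qed.
Lemma ts_opp T f : ts T f -> ts T (fun t x y => - f t x y).
Proof. ts_close periodic_opp smooth_opp. Qed.
Lemma ts_mult T f g : ts T f -> ts T g -> ts T (fun t x y => f t x y * g t x y).
Proof. ts_close periodic_mult smooth_mult. Qed.
Lemma ts_pow T f n : ts T f -> ts T (fun t x y => f t x y ^ n).
Proof. ts_close periodic_pow smooth_pow. Qed.
Lemma ts_const T c : ts T (fun _ _ _ => c).
Proof. apply ts_intro; [intros; apply periodic_const|apply smooth_const]. Qed.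
Lemma ts_exp T k : ts T (fun t _ _ => exp (k * t)).
Proof. apply ts_intro; [intros t _; apply periodic_const|apply smooth_exp]. Qed.
Lemma ts_freeze T T' s f : ts T f -> in_time T s -> ts T' (fun _ => f s).
Proof.
  intros Hf Hs. apply ts_intro.
  - intros _ _. apply (ts_periodic T); assumption.
  - apply (smooth_slice T); [apply ts_smooth|]; assumption.
Qed.
Lemma ts_shorten T T' f : ts T f -> Rbar_le T' T -> ts T' f.
Proof.
  intros Hf HT. apply ts_intro.
  - intros t [H0 Ht]. apply (ts_periodic T); [exact Hf|]. split; [exact H0|eapply Rbar_lt_le_trans; eauto].
  - apply (smooth_shorten T); [apply ts_smooth; exact Hf|exact HT].
Qed.
Lemma ts_ex_derive T f t x y : ts T f -> 0 < t -> Rbar_lt t T ->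
  ex_derive (fun s => f s x y) t.
Proof. intros [_ H] H0 HT. eexists. apply (Dt_spec T f H); assumption. Qed.

(** For [t > 0] this is the periodicity of derivatives; it passes to the limit [t = 0]. *)
Lemma ts_Dt T f : ts T f -> ts T (Dt T f).
Proof.
  intros Hf. assert (P := fun t => ts_periodic T f t Hf). assert (H := ts_smooth T f Hf).
  apply ts_intro; [|apply smooth_Dt, H].
  assert (Hc := smooth_cont T _ (smooth_Dt T f H)).
  assert (HD : forall (a b : R -> R -> R) t x y, (forall t, in_time T t -> forall x y, f t (a x y) (b x y) = f t x y) ->
     0 < t -> Rbar_lt t T -> Dt T f t (a x y) (b x y) = Dt T f t x y).
  { intros a b t x y E H0 HT. rewrite <- !Dt_Derive by assumption. apply Derive_ext_loc.
    generalize (locally_pos_time T t H0 HT). apply filter_imp. intros s [Hs HsT].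
    apply E. apply in_time_pos; assumption. }
  assert (HD0 : forall (a b : R), (forall t, in_time T t -> forall x y, f t (x + a) (y + b) = f t x y) ->
     forall t x y, in_time T t -> Dt T f t (x + a) (y + b) = Dt T f t x y).
  { intros a b E t x y [[H0|H0] HT].
    - apply (HD (fun x _ => x + a) (fun _ y => y + b)); assumption.
    - subst t.
      apply (cont_time_eq_at_0 T (fun t x y => Dt T f t (x + a) (y + b)) (Dt T f) x y HT); [|exact Hc|].
      + intros t x' y' HT'.
        apply (continuous_clamped_comp T (Dt T f) (fun z : R3 => fst (fst z)) (fun z => snd (fst z) + a) (fun z => snd z + b)).
        * exact Hc.
        * exact HT'.
        * apply continuous_z_t.
        * apply (continuous_plus (V := RN)); [apply continuous_z_x|apply continuous_const].
        * apply (continuous_plus (V := RN)); [apply continuous_z_y|apply continuous_const].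
      + intros t H0 HtT. apply (HD (fun x _ => x + a) (fun _ y => y + b)); assumption. }
  intros t Ht x y. split.
  - assert (E := HD0 1 0 ltac:(intros s Hs a b; rewrite Rplus_0_r; apply (P s Hs)) t x y Ht).
    rewrite Rplus_0_r in E. exact E.
  - assert (E := HD0 0 1 ltac:(intros s Hs a b; rewrite Rplus_0_r; apply (P s Hs)) t x y Ht).
    rewrite Rplus_0_r in E. exact E.
Qed.

Ltac ts_solve :=
  intros; cbv beta;
  lazymatch goal with
  | |- ts ?T (fun t x y => @?f t x y + @?g t x y) => apply (ts_plus T f g); ts_solve
  | |- ts ?T (fun t x y => @?f t x y - @?g t x y) => apply (ts_minus T f g); ts_solve
  | |- ts ?T (fun t x y => - @?f t x y) => apply (ts_opp T f); ts_solve
  | |- ts ?T (fun t x y => @?f t x y * @?g t x y) => apply (ts_mult T f g); ts_solve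
  | |- ts ?T (fun t x y => @?f t x y ^ ?n) => apply (ts_pow T f n); ts_solve
  | |- ts ?T (fun t x y => partial ?i (@?f t) x y) => apply (ts_partial T i f); ts_solve
  | |- ts ?T (fun t => partial ?i (@?f t)) => apply (ts_partial T i f); ts_solve
  | |- ts ?T (fun _ _ _ => ?c) => apply ts_const
  | |- ts ?T (fun t _ _ => exp (?k * t)) => apply ts_exp
  | _ => auto
  end.

Lemma is_derive_integral T f g t : cont_time T f -> cont_time T g -> dt_rel T f g ->
  0 < t -> Rbar_lt t T -> is_derive (fun s => integral (f s)) t (integral (g t)).
Proof.
  intros Hf Hg Hd H0 HT.
  assert (C : forall h, cont_time T h -> cont_time T (swap (fun t x _ => Iy h t x 1))).
  { intros h Hh. apply cont_time_swap, (cont_time_freeze_y T (Iy h) 1), cont_time_Iy, Hh. }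
  apply (dt_rel_Iy T (swap (fun t x _ => Iy f t x 1)) (swap (fun t x _ => Iy g t x 1)) (C f Hf) (C g Hg)) with (x := 0) (y := 1); try assumption.
  intros s x y Hs HsT. apply (dt_rel_Iy T f g Hf Hg Hd s y 1); assumption.
Qed.

Lemma continuous_integral T f t : cont_time T f -> Rbar_lt (Rmax 0 t) T ->
  continuous (fun s => integral (f (Rmax 0 s))) t.
Proof.
  intros Hf HT.
  assert (C : cont_time T (Iy (swap (fun t x _ => Iy f t x 1)))).
  { apply cont_time_Iy, cont_time_swap, (cont_time_freeze_y T (Iy f) 1), cont_time_Iy, Hf. }
  apply (continuous_clamped_comp T _ (fun s => s) (fun _ => 0) (fun _ => 1) t C HT);
  [apply continuous_id|apply continuous_const|apply continuous_const].
Qed.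

(** By [sup_le_W11] the supremum in space is bounded by integrals that are continuous in
    time, so that compactness is only needed for an interval of times. *)
Lemma ts_bounded f T : ts p_infty f -> 0 <= T -> exists K, forall t x y,
  0 <= t <= T -> Rabs (f t x y) <= K.
Proof.
  intros Hf HT.
  set (J := fun t x y => f t x y ^ 2 + partial X2 (f t) x y ^ 2 + partial X1 (f t) x y ^ 2 + partial X2 (partial X1 (f t)) x y ^ 2).
  assert (HJ : ts p_infty J).
  { unfold J. ts_solve. }
  destruct (continuity_ab_maj (fun s => integral (J (Rmax 0 s))) 0 T HT) as [M [HM _]].
  { intros c Hc. apply continuity_pt_filterlim.
    exact (continuous_integral p_infty J c (smooth_cont _ _ (ts_smooth _ _ HJ)) I). }
  exists (4 + integral (J (Rmax 0 M))). intros t x y Ht.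
  assert (Hin : in_time p_infty t) by (split; [lra|exact I]).
  assert (Hs : smooth (f t)) by (apply (ts_slice p_infty); assumption).
  specialize (HM t Ht). cbv beta in HM. rewrite (in_time_Rmax_eq t) in HM by lra.
  eapply Rle_trans; [apply sup_le_W11; [exact Hs|apply (ts_periodic p_infty); assumption]|].
  apply Rle_trans with (4 + integral (J t)); [|lra].
  unfold normW11. rewrite <- integral_plus by reg.
  rewrite <- (integral_const 4). rewrite <- integral_plus.
  2: reg.
  2:{ unfold J. reg. }
  apply integral_le; [reg|unfold J; reg|].
  intros a b. unfold J.
  assert (Q : forall v, Rabs v <= 1 + v ^ 2).
  { intros v. rewrite <- pow2_abs. assert (H := pow2_ge_0 (Rabs v - 1)). assert (H' := Rabs_pos v). nra. }
  assert (Q1 := Q (f t a b)). assert (Q2 := Q (partial X2 (f t) a b)).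
  assert (Q3 := Q (partial X1 (f t) a b)). assert (Q4 := Q (partial X2 (partial X1 (f t)) a b)). lra.
Qed.

Lemma gronwall (Y Y' b b' : R -> R) s : 0 <= s ->
  (forall t, 0 <= t <= s -> continuous Y t) ->
  (forall t, 0 < t < s -> is_derive Y t (Y' t)) ->
  (forall t, is_derive b t (b' t)) ->
  (forall t, 0 < t < s -> Y' t <= b' t * Y t) ->
  Y s <= exp (b s - b 0) * Y 0.
Proof.
  intros Hs Hc Hd Hb Hle.
  set (Z := fun t => exp (- b t) * Y t).
  (* The inequality is only known inside the interval; the value 0 at the endpoints
     is compatible with the conclusion of the mean value theorem. *)
  set (Z' := fun t => if Rlt_dec 0 t then if Rlt_dec t s then
     exp (- b t) * (Y' t - b' t * Y t) else 0 else 0).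
  assert (D3 : forall t, is_derive (fun u => exp (- b u)) t (- b' t * exp (- b t))).
  { intros t. apply (is_derive_comp exp (fun u => - b u)); [apply is_derive_exp|].
    apply (is_derive_opp (V := RN)), Hb. }
  assert (HZ : Z s <= Z 0).
  { destruct (MVT_gen Z 0 s Z') as (c & _ & E).
    - rewrite Rmin_left, Rmax_right by exact Hs. intros t Ht. unfold Z, Z'.
      destruct (Rlt_dec 0 t); [|lra]. destruct (Rlt_dec t s); [|lra].
      assert (D1 := Hd t Ht).
      assert (D4 := is_derive_mult _ _ t _ _ (D3 t) D1 Rmult_comm).
      replace (exp (- b t) * (Y' t - b' t * Y t)) with (- b' t * exp (- b t) * Y t + exp (- b t) * Y' t) by ring.
      exact D4.
    - rewrite Rmin_left, Rmax_right by exact Hs. intros t Ht.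
      apply continuity_pt_filterlim.
      apply (continuous_mult (K := RA) (fun u => exp (- b u)) Y); [|apply Hc; exact Ht].
      apply (ex_derive_continuous (V := RN)). eexists. apply D3.
    - assert (Hz : Z' c <= 0).
      { unfold Z'. destruct (Rlt_dec 0 c); [|lra]. destruct (Rlt_dec c s); [|lra].
        specialize (Hle c (conj r r0)). assert (Hp := exp_pos (- b c)). nra. }
      rewrite Rminus_0_r in E. nra. }
  unfold Z in HZ.
  apply Rmult_le_reg_l with (exp (- b s)); [apply exp_pos|].
  rewrite <- Rmult_assoc, <- exp_plus.
  replace (- b s + (b s - b 0)) with (- b 0) by ring. exact HZ.
Qed.

(** The times up to which [F <= 1] holds form a closed set by continuity; since [F <= 1/2]
    there, the bound survives a little longer. *)
Lemma bootstrap (F : R -> R) T : (forall t, 0 <= t < T -> continuous F t) ->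
  F 0 <= 1 ->
  (forall s, 0 <= s < T -> (forall t, 0 <= t <= s -> F t <= 1) -> F s <= / 2) ->
  forall s, 0 <= s < T -> F s <= 1.
Proof.
  intros Hc H0 Hstep s1 Hs1. apply Rnot_lt_le. intros Hlt.
  set (E := fun t => 0 <= t <= s1 /\ forall r, 0 <= r <= t -> F r <= 1).
  assert (E0 : E 0).
  { split; [lra|]. intros r Hr. replace r with 0 by lra. exact H0. }
  destruct (completeness E) as [m [Hub Hleast]].
  { exists s1. intros t [Ht _]. lra. }
  { exists 0. exact E0. }
  assert (m0 : 0 <= m) by (apply Hub, E0).
  assert (ms : m <= s1) by (apply Hleast; intros t [Ht _]; lra).
  assert (Hbelow : forall r, 0 <= r < m -> F r <= 1).
  { intros r Hr. apply NNPP. intros Hn.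
    apply (Rlt_irrefl m), Rle_lt_trans with r; [|lra].
    apply Hleast. intros t [Ht HF]. apply Rnot_lt_le. intros Hrt. apply Hn, HF. lra. }
  assert (Hcm : continuous F m) by (apply Hc; lra).
  assert (Hm : F m <= 1).
  { apply Rnot_lt_le. intros Hn.
    destruct m0 as [m0|m0]; [|rewrite <- m0 in Hn; lra].
    assert (Hp : 0 < F m - 1) by lra.
    destruct (proj1 (filterlim_locally _ _) Hcm (mkposreal _ Hp)) as [d Hd].
    set (r := Rmax 0 (m - d / 2)).
    assert (d0 := cond_pos d).
    assert (Hr : 0 <= r < m) by (unfold r, Rmax; destruct (Rle_dec 0 (m - d / 2)); lra).
    assert (Hrd : m - r < d) by (unfold r, Rmax; destruct (Rle_dec 0 (m - d / 2)); lra).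
    specialize (Hd r). assert (Hb : ball m d r) by (change (Rabs (r - m) < d); rewrite Rabs_left; lra).
    specialize (Hd Hb). change (Rabs (F r - F m) < F m - 1) in Hd.
    apply Rabs_def2 in Hd. specialize (Hbelow r Hr). lra. }
  assert (Hall : forall r, 0 <= r <= m -> F r <= 1).
  { intros r Hr. destruct (Req_dec r m) as [->|Hne]; [exact Hm|apply Hbelow; lra]. }
  assert (Hhalf : F m <= / 2) by (apply Hstep; [lra|exact Hall]).
  assert (Hms : m < s1) by (destruct ms as [ms|ms]; [exact ms|rewrite ms in Hm; lra]).
  assert (Hp : 0 < / 2) by lra.
  destruct (proj1 (filterlim_locally _ _) Hcm (mkposreal _ Hp)) as [d Hd].
  assert (d0 := cond_pos d).
  set (r := Rmin s1 (m + d / 2)).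
  assert (Hr : m < r) by (unfold r, Rmin; destruct (Rle_dec s1 (m + d / 2)); lra).
  assert (Hrs : r <= s1) by apply Rmin_l.
  assert (Hrd : r <= m + d / 2) by apply Rmin_r.
  apply (Rlt_irrefl m), Rlt_le_trans with r; [exact Hr|].
  apply Hub. split; [lra|]. intros t Ht.
  destruct (Rle_dec t m); [apply Hall; lra|].
  specialize (Hd t). assert (Hb : ball m d t) by (change (Rabs (t - m) < d); rewrite Rabs_pos_eq; lra).
  specialize (Hd Hb). change (Rabs (F t - F m) < / 2) in Hd.
  apply Rabs_def2 in Hd. lra.
Qed.

(** * The linear relaxation system and its energy *)

(** The relaxation system with the quadratic term replaced by a source [Q], and with a force
    [r]. It is solved by the error (up to correctors) and by the solution itself. *)
Record lin_sys (eps del : R) (T : Rbar) (q : R -> sfield) (w : R -> vfield) (W : R -> mfield)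
    (r : R -> vfield) (Q : R -> mfield) : Prop := {
  lin_ts_q : ts T q;
  lin_ts_w : ts_v T w;
  lin_ts_W : ts_m T W;
  lin_ts_r : ts_v T r;
  lin_ts_Q : ts_m T Q;
  lin_q : forall t x y, 0 < t -> Rbar_lt t T ->
    eps * Derive (fun s => q s x y) t + div (w t) x y = 0;
  lin_w : forall t j x y, 0 < t -> Rbar_lt t T ->
    Derive (fun s => w s j x y) t + mdiv (W t) j x y + grad (q t) j x y = r t j x y;
  lin_W : forall t i j x y, 0 < t -> Rbar_lt t T ->
    del * Derive (fun s => W s i j x y) t + vgrad (w t) i j x y + W t i j x y = Q t i j x y
}.

Lemma partial_scal i c f x y : partial i (fun x y => c * f x y) x y = c * partial i f x y.
Proof. destruct i; simpl; apply Derive_scal. Qed.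

Lemma Derive_partial T i f t x y : ts T f -> 0 < t -> Rbar_lt t T ->
  Derive (fun s => partial i (f s) x y) t = partial i (fun x y => Derive (fun s => f s x y) t) x y.
Proof.
  intros Hf H0 HT.
  rewrite (Dt_Derive T (fun t => partial i (f t))) by (auto; apply ts_smooth; auto using ts_partial, ts_Dt).
  rewrite Dt_partial by (auto; apply ts_smooth; exact Hf).
  f_equal. field_ext a b.
  symmetry. apply Dt_Derive; auto. apply ts_smooth; exact Hf.
Qed.

Lemma ex_partial_Derive T i f t x y : ts T f -> 0 < t -> Rbar_lt t T ->
  ex_partial i (fun x y => Derive (fun s => f s x y) t) x y.
Proof.
  intros Hf H0 HT.
  replace (fun x y => Derive (fun s => f s x y) t) with (Dt T f t).
  - apply (smooth_ex_partial T); [apply ts_smooth; auto using ts_partial, ts_Dt|apply in_time_pos; assumption].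
  - field_ext a b.
    symmetry. apply Dt_Derive; auto. apply ts_smooth; exact Hf.
Qed.

Lemma partial_fun_eq i f g x y : (forall x y, f x y = g x y) -> partial i f x y = partial i g x y.
Proof.
  intros E. f_equal. field_ext a b. apply E.
Qed.

Lemma ex_partial_scal i c f x y : ex_partial i f x y -> ex_partial i (fun x y => c * f x y) x y.
Proof. intros H. apply (ex_partial_mult i (fun _ _ => c) f); [apply ex_partial_const|exact H]. Qed.

(** The system has constant coefficients, hence commutes with space derivatives. *)
Lemma lin_sys_partial k eps del T q w W r Q : lin_sys eps del T q w W r Q ->
  lin_sys eps del T (fun t => partial k (q t)) (fun t j => partial k (w t j))
    (fun t i j => partial k (W t i j)) (fun t j => partial k (r t j)) (fun t i j => partial k (Q t i j)).
Proof.
  intros [Hq Hw HW Hr HQ Eq Ew EW].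
  constructor.
  1-5: ts_solve.
  - intros t x y H0 HT.
    assert (Ht := in_time_pos T t H0 HT).
    assert (SQ : smooth (q t)) by (apply (ts_slice T); auto).
    assert (Sw : forall j, smooth (w t j)) by (intros j; apply (ts_slice T (fun t => w t j)); auto).
    rewrite (Derive_partial T k q) by assumption.
    rewrite <- (partial_const k 0 x y).
    rewrite <- (partial_fun_eq k (fun x y => eps * Derive (fun s => q s x y) t + div (w t) x y) (fun _ _ => 0))
      by (intros; apply Eq; assumption).
    unfold div, sum2.
    rewrite (partial_plus k (fun x y => eps * Derive (fun s => q s x y) t) (fun x y => partial X1 (w t X1) x y + partial X2 (w t X2) x y)).
    2: apply ex_partial_scal, (ex_partial_Derive T); assumption.
    2: reg.
    rewrite partial_plus by reg. rewrite partial_scal.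
    rewrite (sm_comm X1 k), (sm_comm X2 k) by auto. reflexivity.
  - intros t j x y H0 HT.
    assert (Ht := in_time_pos T t H0 HT).
    assert (SQ : smooth (q t)) by (apply (ts_slice T); auto).
    assert (SW := ts_slice2 T W t ltac:(auto) Ht).
    rewrite (Derive_partial T k (fun t => w t j)) by auto.
    rewrite <- (partial_fun_eq k (fun x y => Derive (fun s => w s j x y) t + mdiv (W t) j x y + grad (q t) j x y) (r t j))
      by (intros; apply Ew; assumption).
    unfold mdiv, sum2, grad.
    assert (X : ex_partial k (fun x y => Derive (fun s => w s j x y) t) x y) by (apply (ex_partial_Derive T k (fun t => w t j)); auto).
    rewrite (partial_plus k (fun x y => Derive (fun s => w s j x y) t + (partial X1 (W t X1 j) x y + partial X2 (W t X2 j) x y)) (partial j (q t))).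
    2: apply ex_partial_plus; [exact X|reg].
    2: reg.
    rewrite (partial_plus k (fun x y => Derive (fun s => w s j x y) t)) by (exact X || reg).
    rewrite partial_plus by reg.
    rewrite (sm_comm X1 k), (sm_comm X2 k), (sm_comm j k) by auto. reflexivity.
  - intros t i j x y H0 HT.
    assert (Ht := in_time_pos T t H0 HT).
    assert (Sw := ts_slice1 T w t ltac:(auto) Ht).
    assert (SW := ts_slice2 T W t ltac:(auto) Ht).
    rewrite (Derive_partial T k (fun t => W t i j)) by auto.
    rewrite <- (partial_fun_eq k (fun x y => del * Derive (fun s => W s i j x y) t + vgrad (w t) i j x y + W t i j x y) (Q t i j))
      by (intros; apply EW; assumption).
    unfold vgrad.
    assert (X : ex_partial k (fun x y => del * Derive (fun s => W s i j x y) t) x y)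
      by (apply ex_partial_scal, (ex_partial_Derive T k (fun t => W t i j)); auto).
    rewrite (partial_plus k (fun x y => del * Derive (fun s => W s i j x y) t + partial i (w t j) x y) (W t i j)).
    2: apply ex_partial_plus; [exact X|reg].
    2: reg.
    rewrite (partial_plus k (fun x y => del * Derive (fun s => W s i j x y) t)) by (exact X || reg).
    rewrite partial_scal.
    rewrite (sm_comm i k) by auto. reflexivity.
Qed.

Definition energy_density (eps del : R) (q : sfield) (w : vfield) (W : mfield) : sfield :=
  fun x y => eps * q x y ^ 2 + sum2 (fun j => w j x y ^ 2)
    + del * sum2 (fun i => sum2 (fun j => W i j x y ^ 2)).

(** The rate of change of the energy density, up to divergences. *)
Definition power_density (w : vfield) (W : mfield) (r : vfield) (Q : mfield) : sfield :=
  fun x y => 2 * (sum2 (fun j => w j x y * r j x y)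
    + sum2 (fun i => sum2 (fun j => W i j x y * Q i j x y - W i j x y ^ 2))).

Lemma ts_energy_density eps del T q w W : ts T q -> ts_v T w -> ts_m T W ->
  ts T (fun t => energy_density eps del (q t) (w t) (W t)).
Proof. intros Hq Hw HW. unfold energy_density, sum2. ts_solve. Qed.

Lemma is_derive_weighted_squares eps del (f g1 g2 h1 h2 h3 h4 : R -> R) t :
  ex_derive f t -> ex_derive g1 t -> ex_derive g2 t ->
  ex_derive h1 t -> ex_derive h2 t -> ex_derive h3 t -> ex_derive h4 t ->
  is_derive (fun s => eps * f s ^ 2 + (g1 s ^ 2 + g2 s ^ 2)
      + del * ((h1 s ^ 2 + h2 s ^ 2) + (h3 s ^ 2 + h4 s ^ 2))) t
    (2 * (f t * (eps * Derive f t) + (g1 t * Derive g1 t + g2 t * Derive g2 t)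
      + (h1 t * (del * Derive h1 t) + h2 t * (del * Derive h2 t)
      + (h3 t * (del * Derive h3 t) + h4 t * (del * Derive h4 t))))).
Proof.
  intros. auto_derive; [repeat split; assumption|].
  change (fun x => f x) with f. change (fun x => g1 x) with g1. change (fun x => g2 x) with g2.
  change (fun x => h1 x) with h1. change (fun x => h2 x) with h2.
  change (fun x => h3 x) with h3. change (fun x => h4 x) with h4. ring.
Qed.

(** The fluxes [q w + W w] are divergences and drop out. *)
Lemma energy_identity eps del T q w W r Q t : lin_sys eps del T q w W r Q ->
  0 < t -> Rbar_lt t T ->
  is_derive (fun s => integral (energy_density eps del (q s) (w s) (W s))) t
    (integral (power_density (w t) (W t) (r t) (Q t))).
Proof.
  intros [Hq Hw HW Hr HQ Eq Ew EW] H0 HT.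
  assert (Ht := in_time_pos T t H0 HT).
  assert (Hd := ts_energy_density eps del T q w W Hq Hw HW).
  set (d := fun t => energy_density eps del (q t) (w t) (W t)) in *.
  replace (integral (power_density (w t) (W t) (r t) (Q t))) with (integral (Dt T d t)).
  { apply (is_derive_integral T d (Dt T d)); auto.
    - apply smooth_cont, ts_smooth, Hd.
    - apply smooth_cont, ts_smooth, ts_Dt, Hd.
    - apply Dt_spec, ts_smooth, Hd. }
  assert (Sq : smooth (q t)) by (apply (ts_slice T); auto).
  assert (Sw := ts_slice1 T w t ltac:(auto) Ht).
  assert (SW := ts_slice2 T W t ltac:(auto) Ht).
  assert (Sr := ts_slice1 T r t ltac:(auto) Ht).
  assert (SQ := ts_slice2 T Q t ltac:(auto) Ht).
  assert (Pq : periodic (q t)) by (apply (ts_periodic T); auto).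
  assert (Pw : forall j, periodic (w t j)) by (intros a; apply (ts_periodic T (fun t => w t a)); auto).
  assert (PW : forall i j, periodic (W t i j)) by (intros a b; apply (ts_periodic T (fun t => W t a b)); auto).
  set (flux := fun i x y => q t x y * w t i x y + (w t X1 x y * W t i X1 x y + w t X2 x y * W t i X2 x y)).
  assert (Sf : forall i, smooth (flux i)) by (intros; unfold flux; reg).
  assert (Pf : forall i, integral (partial i (flux i)) = 0).
  { intros i. apply integral_partial; [apply Sf|]. unfold flux; reg. }
  assert (E : forall x y, Dt T d t x y = power_density (w t) (W t) (r t) (Q t) x y
     - 2 * (partial X1 (flux X1) x y + partial X2 (flux X2) x y)).
  { intros x y. rewrite <- Dt_Derive by (auto; apply ts_smooth, Hd).
    apply is_derive_unique. unfold d, energy_density, sum2.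
    assert (Xq := ts_ex_derive T q t x y Hq H0 HT).
    assert (Xw := fun j => ts_ex_derive T (fun t => w t j) t x y (Hw j) H0 HT).
    assert (XW := fun i j => ts_ex_derive T (fun t => W t i j) t x y (HW i j) H0 HT).
    assert (X := is_derive_weighted_squares eps del
      (fun s : R => q s x y) (fun s : R => w s X1 x y) (fun s : R => w s X2 x y)
      (fun s : R => W s X1 X1 x y) (fun s : R => W s X1 X2 x y)
      (fun s : R => W s X2 X1 x y) (fun s : R => W s X2 X2 x y) t Xq (Xw X1) (Xw X2)
      (XW X1 X1) (XW X1 X2) (XW X2 X1) (XW X2 X2)).
    refine (eq_ind _ (is_derive _ t) X _ _). clear X.
    assert (F : forall i, partial i (flux i) x y = partial i (q t) x y * w t i x y + q t x y * partial i (w t i) x y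
       + (partial i (w t X1) x y * W t i X1 x y + w t X1 x y * partial i (W t i X1) x y)
       + (partial i (w t X2) x y * W t i X2 x y + w t X2 x y * partial i (W t i X2) x y)).
    { intros i. unfold flux.
      rewrite (partial_plus i (fun x y => q t x y * w t i x y)) by reg.
      rewrite (partial_plus i (fun x y => w t X1 x y * W t i X1 x y)) by reg.
      rewrite !partial_mult by reg. ring. }
    rewrite !F. unfold power_density, sum2.
    specialize (Eq t x y H0 HT). assert (Ew1 := Ew t X1 x y H0 HT). assert (Ew2 := Ew t X2 x y H0 HT).
    assert (E11 := EW t X1 X1 x y H0 HT). assert (E12 := EW t X1 X2 x y H0 HT).
    assert (E21 := EW t X2 X1 x y H0 HT). assert (E22 := EW t X2 X2 x y H0 HT).
    unfold div, mdiv, grad, vgrad, sum2 in *.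
    rewrite <- Ew1, <- Ew2, <- E11, <- E12, <- E21, <- E22.
    apply Rminus_diag_uniq. cbv beta.
    match type of Eq with ?a = 0 => transitivity (2 * q t x y * a); [ring|rewrite Eq; ring] end. }
  rewrite (integral_ext _ _ E).
  rewrite integral_minus.
  - rewrite integral_scal by reg. rewrite integral_plus by reg. rewrite !Pf. ring.
  - unfold power_density, sum2. reg.
  - reg.
Qed.

(** * The corrector and the error equations *)

Lemma periodic_antiderivative (g : R -> R) : (forall s, continuous g s) ->
  (forall s, g (s + 1) = g s) -> RInt g 0 1 = 0 ->
  forall y, RInt g 0 (y + 1) = RInt g 0 y.
Proof.
  intros Hc Hp H0 y.
  assert (Hi : forall a b, ex_RInt g a b).
  { intros. apply (ex_RInt_continuous (V := RC)). auto. }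
  rewrite <- (RInt_Chasles (V := RC) g 0 1 (y + 1)) by auto.
  rewrite H0. unfold plus; simpl. rewrite Rplus_0_l.
  assert (H := RInt_comp_lin (V := RC) g 1 1 0 y (Hi _ _)).
  replace (1 * 0 + 1) with 1 in H by ring. replace (1 * y + 1) with (y + 1) in H by ring.
  rewrite <- H. apply RInt_ext. intros s _. unfold scal; simpl; unfold mult; simpl.
  rewrite !Rmult_1_l. apply Hp.
Qed.

(** A mean-free field is a divergence: integrate the mean over vertical lines in the
    first variable, and the rest along those lines. *)
Lemma divergence_potential p : ts p_infty p ->
  (forall t, 0 <= t -> integral (p t) = 0) ->
  exists Phi : R -> vfield, (ts_v p_infty Phi) /\
    forall t x y, 0 <= t -> div (Phi t) x y = p t x y.
Proof.
  intros Hp Hmean.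
  set (m := fun t x (_ : R) => Iy p t x 1).
  assert (Sp : smooth_time p_infty p) by (apply ts_smooth, Hp).
  assert (Sm : smooth_time p_infty m).
  { intros n. apply (Ck_time_freeze_y p_infty 1 n (Iy p)), Ck_time_Iy, Sp. }
  set (d := fun t x y => p t x y - m t x y).
  assert (Sd : smooth_time p_infty d) by (apply smooth_minus; assumption).
  assert (Hm : forall t x y, in_time p_infty t -> m t (x + 1) y = m t x y).
  { intros t x y Ht. unfold m, Iy. apply RInt_ext. intros s _. apply (ts_periodic p_infty p t Hp Ht). }
  assert (Sms := smooth_swap _ _ Sm).
  assert (S1 : smooth_time p_infty (swap (Iy (swap m)))).
  { apply smooth_swap. intros n. apply Ck_time_Iy, Sms. }
  assert (S2 : smooth_time p_infty (Iy d)) by (intros n; apply Ck_time_Iy, Sd).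
  exists (fun t j => match j with X1 => swap (Iy (swap m)) t | X2 => Iy d t end).
  split.
  - intros [|].
    + apply ts_intro; [|exact S1]. intros t Ht x y. split; [|reflexivity].
      apply (periodic_antiderivative (fun s => m t s y)).
      * intros s. apply (continuous_slice p_infty m t (fun s => s) (fun _ => y));
        [apply smooth_cont, Sm|exact Ht|apply continuous_id|apply continuous_const].
      * intros s. apply Hm, Ht.
      * apply (Hmean t), Ht.
    + apply ts_intro; [|exact S2]. intros t Ht x y. split.
      * unfold Iy. apply RInt_ext. intros s _. unfold d.
        rewrite Hm by exact Ht. f_equal. apply (ts_periodic p_infty p t Hp Ht).
      * apply (periodic_antiderivative (fun s => d t x s)).
        -- intros s. apply (continuous_slice p_infty d t (fun _ => x) (fun s => s));
           [apply smooth_cont, Sd|exact Ht|apply continuous_const|apply continuous_id].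
        -- intros s. unfold d, m. f_equal. apply (ts_periodic p_infty p t Hp Ht).
        -- assert (E := RInt_minus (V := RC) (fun s => p t x s) (fun _ => Iy p t x 1) 0 1).
           etransitivity; [apply E|].
           ++ apply (ex_RInt_slice_y p_infty p); [apply smooth_cont, Sp|exact Ht].
           ++ apply ex_RInt_const.
           ++ rewrite RInt_const. unfold Iy, minus, plus, opp, scal; simpl; unfold mult; simpl. ring.
  - intros t x y Ht. unfold div, sum2.
    assert (Hin : in_time p_infty t) by (split; [exact Ht|exact I]).
    replace (partial X1 (swap (Iy (swap m)) t) x y) with (m t x y).
    + replace (partial X2 (Iy d t) x y) with (d t x y); [unfold d; ring|].
      symmetry. apply is_derive_unique. apply (is_derive_Iy_y p_infty); [apply smooth_cont, Sd|exact Hin].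
    + symmetry. apply is_derive_unique.
      apply (is_derive_Iy_y p_infty (swap m) t y x); [apply smooth_cont, Sms|exact Hin].
Qed.

(** The value of [U] to which the third equation relaxes when [u = v]. *)
Definition stress (v : R -> vfield) : R -> mfield :=
  fun t i j x y => v t i x y * v t j x y - partial i (v t j) x y.

Definition dtv (v : R -> vfield) : R -> vfield := fun t j => Dt p_infty (fun s => v s j) t.
Definition dtm (V : R -> mfield) : R -> mfield := fun t i j => Dt p_infty (fun s => V s i j) t.

(** [U] starts at a distance of order one from equilibrium; this initial layer decays like
    [exp (- t / del)]. *)
Definition layer (uN : R -> vfield) (U : R -> mfield) : mfield :=
  fun i j x y => U 0 i j x y - stress uN 0 i j x y.

Definition err_p (pN p : R -> sfield) : R -> sfield := fun t x y => p t x y - pN t x y.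
(** Both errors carry a corrector. With [div phi] equal to the time derivative of the limit
    pressure, adding [eps phi] makes the first equation homogeneous; its defect would
    otherwise cause an error of order [sqrt eps]. Subtracting the layer makes [err_U] vanish at
    the initial time, and costs a force that is integrable in time. *)
Definition err_u (eps : R) (uN phi u : R -> vfield) : R -> vfield :=
  fun t j x y => u t j x y - uN t j x y + eps * phi t j x y.
Definition err_U (del : R) (uN : R -> vfield) (U : R -> mfield) : R -> mfield :=
  fun t i j x y => U t i j x y - stress uN t i j x y + - exp (- / del * t) * layer uN U i j x y.
Definition src_u (eps del : R) (uN phi : R -> vfield) (U : R -> mfield) : R -> vfield :=
  fun t j x y => eps * dtv phi t j x y - exp (- / del * t) * mdiv (layer uN U) j x y.
Definition src_U (eps del : R) (uN phi u : R -> vfield) : R -> mfield :=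
  fun t i j x y => (u t i x y * u t j x y - uN t i x y * uN t j x y)
    - del * dtm (stress uN) t i j x y + eps * partial i (phi t j) x y.

Lemma Derive_lin3 (f g h : R -> R) c t : ex_derive f t -> ex_derive g t -> ex_derive h t ->
  Derive (fun s => f s - g s + c * h s) t = Derive f t - Derive g t + c * Derive h t.
Proof.
  intros Hf Hg Hh. rewrite (Derive_plus (fun s => f s - g s)).
  - rewrite Derive_minus by assumption. now rewrite Derive_scal.
  - apply (ex_derive_minus (V := RN) f g); assumption.
  - apply ex_derive_scal; assumption.
Qed.

Lemma Derive_layer (f g : R -> R) k c t : ex_derive f t -> ex_derive g t ->
  Derive (fun s => f s - g s + - exp (k * s) * c) t = Derive f t - Derive g t - k * exp (k * t) * c.
Proof.
  intros Hf Hg. rewrite (Derive_plus (fun s => f s - g s)).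
  - rewrite Derive_minus by assumption.
    replace (Derive f t - Derive g t - k * exp (k * t) * c)
      with (Derive f t - Derive g t + - (k * exp (k * t) * c)) by ring.
    apply Rplus_eq_compat_l, is_derive_unique. auto_derive; [exact I|ring].
  - apply (ex_derive_minus (V := RN) f g); assumption.
  - auto_derive. exact I.
Qed.

Lemma partial_minus i f g x y : ex_partial i f x y -> ex_partial i g x y ->
  partial i (fun x y => f x y - g x y) x y = partial i f x y - partial i g x y.
Proof. destruct i; intros Hf Hg; apply (Derive_minus (fun s => _) (fun s => _)); assumption. Qed.

Lemma partial_lin3 i f g h c x y : smooth f -> smooth g -> smooth h ->
  partial i (fun x y => f x y - g x y + c * h x y) x y
  = partial i f x y - partial i g x y + c * partial i h x y.
Proof.
  intros Hf Hg Hh. rewrite (partial_plus i (fun x y => f x y - g x y)) by reg.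
  rewrite partial_minus by reg. now rewrite partial_scal.
Qed.

Lemma ts_stress T uN i j : (ts_v T uN) ->
  ts T (fun t => stress uN t i j).
Proof.
  intros H. unfold stress. ts_solve.
Qed.


(** * Pointwise bounds on the sources *)

Lemma sum5_sq a b c d e : (a + b + c + d + e) ^ 2 <= 5 * (a ^ 2 + b ^ 2 + c ^ 2 + d ^ 2 + e ^ 2).
Proof.
  assert (H1 := pow2_ge_0 (a - b)). assert (H2 := pow2_ge_0 (a - c)). assert (H3 := pow2_ge_0 (a - d)).
  assert (H4 := pow2_ge_0 (a - e)). assert (H5 := pow2_ge_0 (b - c)). assert (H6 := pow2_ge_0 (b - d)).
  assert (H7 := pow2_ge_0 (b - e)). assert (H8 := pow2_ge_0 (c - d)). assert (H9 := pow2_ge_0 (c - e)).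
  assert (H10 := pow2_ge_0 (d - e)). lra.
Qed.

Lemma Rabs_mult_le a b x y : Rabs a <= x -> Rabs b <= y -> Rabs (a * b) <= x * y.
Proof. intros Ha Hb. rewrite Rabs_mult. apply Rmult_le_compat; auto using Rabs_pos. Qed.

Lemma Rabs_plus_le a b x y : Rabs a <= x -> Rabs b <= y -> Rabs (a + b) <= x + y.
Proof. intros Ha Hb. eapply Rle_trans; [apply Rabs_triang|lra]. Qed.

Lemma Rabs_minus_le a b x y : Rabs a <= x -> Rabs b <= y -> Rabs (a - b) <= x + y.
Proof. intros Ha Hb. unfold Rminus. apply Rabs_plus_le; [exact Ha|now rewrite Rabs_Ropp]. Qed.

Lemma Rabs_uncorrect v w f eps K : 0 <= eps -> v = w + eps * f -> Rabs f <= K -> Rabs w <= Rabs v + eps * K.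
Proof.
  intros He E Hf. replace w with (v - eps * f) by (rewrite E; ring).
  apply Rabs_minus_le; [lra|]. rewrite Rabs_mult, (Rabs_pos_eq eps) by exact He.
  apply Rmult_le_compat_l; assumption.
Qed.

(** The source is controlled by the error itself, once this is bounded by one. Here [n] stands
    for the limit, [w] for the error and [w + eps f] for the corrected error; primes are
    derivatives in a fixed direction. The quadratic part equals
    [wi' uj + ni' wj + wj' ui + nj' wi] with [u = w + n]. *)
Lemma source_bound eps del K wi wj ni nj fi fj wi' wj' ni' nj' fi' fj' s g :
  0 <= eps -> 0 <= del -> 0 <= K ->
  Rabs wi <= 1 -> Rabs wj <= 1 -> Rabs ni <= K -> Rabs nj <= K ->
  Rabs ni' <= K -> Rabs nj' <= K ->
  Rabs fi <= K -> Rabs fj <= K -> Rabs fi' <= K -> Rabs fj' <= K -> Rabs s <= K -> Rabs g <= K ->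
  (((wi' + ni') * (wj + nj) + (wi + ni) * (wj' + nj') - (ni' * nj + ni * nj')) - del * s + eps * g) ^ 2
  <= 5 * (K + 1) ^ 2 * ((wi + eps * fi) ^ 2 + (wj + eps * fj) ^ 2 + (wi' + eps * fi') ^ 2 + (wj' + eps * fj') ^ 2)
     + 125 * (K + 1) ^ 4 * (eps + del) ^ 2.
Proof.
  intros He Hd HK Hwi Hwj Hni Hnj Hni' Hnj' Hfi Hfj Hfi' Hfj' Hs Hg.
  set (A := K + 1). set (vi := wi + eps * fi). set (vj := wj + eps * fj).
  set (vi' := wi' + eps * fi'). set (vj' := wj' + eps * fj').
  assert (Bi : Rabs wi <= Rabs vi + eps * K) by (apply (Rabs_uncorrect _ _ fi); auto).
  assert (Bj : Rabs wj <= Rabs vj + eps * K) by (apply (Rabs_uncorrect _ _ fj); auto).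
  assert (Bi' : Rabs wi' <= Rabs vi' + eps * K) by (apply (Rabs_uncorrect _ _ fi'); auto).
  assert (Bj' : Rabs wj' <= Rabs vj' + eps * K) by (apply (Rabs_uncorrect _ _ fj'); auto).
  assert (Bui : Rabs (wi + ni) <= A) by (unfold A; rewrite Rplus_comm; apply Rabs_plus_le; assumption).
  assert (Buj : Rabs (wj + nj) <= A) by (unfold A; rewrite Rplus_comm; apply Rabs_plus_le; assumption).
  set (Q := ((wi' + ni') * (wj + nj) + (wi + ni) * (wj' + nj') - (ni' * nj + ni * nj')) - del * s + eps * g).
  assert (HQ : Rabs Q <= A * Rabs vi + A * Rabs vj + A * Rabs vi' + A * Rabs vj' + 5 * A ^ 2 * (eps + del)).
  { assert (B1 : Rabs (wi' * (wj + nj)) <= (Rabs vi' + eps * K) * A) by (apply Rabs_mult_le; assumption).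
    assert (B2 : Rabs (ni' * wj) <= K * (Rabs vj + eps * K)) by (apply Rabs_mult_le; assumption).
    assert (B1' : Rabs (wj' * (wi + ni)) <= (Rabs vj' + eps * K) * A) by (apply Rabs_mult_le; assumption).
    assert (B2' : Rabs (nj' * wi) <= K * (Rabs vi + eps * K)) by (apply Rabs_mult_le; assumption).
    assert (B3 : Rabs (del * s) <= del * K) by (apply Rabs_mult_le; [rewrite Rabs_pos_eq; lra|assumption]).
    assert (B4 : Rabs (eps * g) <= eps * K) by (apply Rabs_mult_le; [rewrite Rabs_pos_eq; lra|assumption]).
    replace Q with (wi' * (wj + nj) + ni' * wj + (wj' * (wi + ni) + nj' * wi) - del * s + eps * g) by (unfold Q; ring).
    eapply Rle_trans; [apply Rabs_plus_le; [apply Rabs_minus_le; [apply Rabs_plus_le; apply Rabs_plus_le; [exact B1|exact B2|exact B1'|exact B2']|exact B3]|exact B4]|].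
    assert (V := Rabs_pos vj). assert (V' := Rabs_pos vi). unfold A.
    assert (X1 : 0 <= eps * K) by (apply Rmult_le_pos; assumption).
    assert (X2 : 0 <= eps * K * K) by (apply Rmult_le_pos; assumption).
    assert (X3 : 0 <= del * K) by (apply Rmult_le_pos; assumption).
    assert (X4 : 0 <= del * K * K) by (apply Rmult_le_pos; assumption). nra. }
  rewrite <- (pow2_abs Q).
  eapply Rle_trans; [apply pow_incr; split; [apply Rabs_pos|exact HQ]|].
  eapply Rle_trans; [apply sum5_sq|].
  rewrite !Rpow_mult_distr, !pow2_abs. apply Req_le. ring.
Qed.

(** [e / del] is the derivative of the layer profile up to sign; it is integrable in
    time uniformly in [del]. *)
Lemma power_density_le eps del e (w : vfield) W (r f d : vfield) Q x y : 0 < del -> 0 <= e ->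
  (forall j, r j x y = eps * f j x y - e * d j x y) ->
  power_density w W r Q x y <=
    (1 + e / del) * sum2 (fun j => w j x y ^ 2) + eps ^ 2 * sum2 (fun j => f j x y ^ 2)
    + e * del * sum2 (fun j => d j x y ^ 2)
    + / 2 * sum2 (fun i => sum2 (fun j => Q i j x y ^ 2)).
Proof.
  intros Hd He Hr. unfold power_density, sum2. rewrite !Hr.
  assert (HQ : forall i j, 2 * (W i j x y * Q i j x y - W i j x y ^ 2) <= / 2 * Q i j x y ^ 2).
  { intros i j. assert (H := pow2_ge_0 (2 * W i j x y - Q i j x y)). lra. }
  assert (Hw : forall j, 2 * (w j x y * (eps * f j x y - e * d j x y)) <=
     (1 + e / del) * w j x y ^ 2 + eps ^ 2 * f j x y ^ 2 + e * del * d j x y ^ 2).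
  { intros j. assert (H1 := pow2_ge_0 (w j x y - eps * f j x y)).
    assert (H2 := pow2_ge_0 (w j x y + del * d j x y)).
    assert (H3 : 0 <= e / del * (w j x y + del * d j x y) ^ 2).
    { apply Rmult_le_pos; [|exact H2]. apply Rmult_le_pos; [exact He|left; apply Rinv_0_lt_compat, Hd]. }
    replace (e / del * (w j x y + del * d j x y) ^ 2) with
      (e / del * w j x y ^ 2 + 2 * (e * (w j x y * d j x y)) + e * del * d j x y ^ 2) in H3 by (field; lra).
    lra. }
  axes Hw. axes HQ. lra.
Qed.

Definition sq_v (w : vfield) : sfield := fun x y => sum2 (fun j => w j x y ^ 2).

Definition h1_density (w : vfield) : sfield :=
  fun x y => sq_v w x y + sum2 (fun k => sq_v (fun j => partial k (w j)) x y).

Definition bdd (T K : R) (g : R -> sfield) : Prop :=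
  forall t x y, 0 <= t <= T -> Rabs (g t x y) <= K.

Definition bdd1 (T K : R) (g : R -> sfield) : Prop :=
  bdd T K g /\ forall k, bdd T K (fun t => partial k (g t)).

(** [stress uN 0] is frozen in time so that all bounds have the same form. *)
Record limit_bounds (uN phi : R -> vfield) (T K : R) : Prop := {
  lb_u : forall j, bdd1 T K (fun t => uN t j);
  lb_du : forall k j, bdd1 T K (fun t => partial k (uN t j));
  lb_phi : forall j, bdd1 T K (fun t => phi t j);
  lb_dphi : forall k j, bdd1 T K (fun t => partial k (phi t j));
  lb_phit : forall j, bdd1 T K (fun t => dtv phi t j);
  lb_st : forall i j, bdd1 T K (fun t => dtm (stress uN) t i j);
  lb_s0 : forall k i j, bdd1 T K (fun _ => partial k (stress uN 0 i j))
}.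

Lemma axis_eventually (P : axis -> R -> Prop) : (forall i, Rbar_locally p_infty (P i)) ->
  Rbar_locally p_infty (fun K => forall i, P i K).
Proof.
  intros H. generalize (filter_and _ _ (H X1) (H X2)). apply filter_imp. intros K [H1 H2] [|]; assumption.
Qed.

Lemma bdd_eventually T f : 0 <= T -> ts p_infty f ->
  Rbar_locally p_infty (fun K => bdd T K f).
Proof.
  intros HT Hf. destruct (ts_bounded f T Hf HT) as [K0 H]. exists K0. intros K HK t x y Ht.
  specialize (H t x y Ht). lra.
Qed.

Lemma bdd1_eventually T f : 0 <= T -> ts p_infty f ->
  Rbar_locally p_infty (fun K => bdd1 T K f).
Proof.
  intros HT Hf. apply filter_and; [apply bdd_eventually; assumption|].
  apply axis_eventually. intros k. apply bdd_eventually; [exact HT|apply ts_partial, Hf].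
Qed.

(** Each bound holds for all large [K], and there are finitely many of them. *)
Lemma limit_bounds_exist uN phi T : 0 <= T ->
  (ts_v p_infty uN) ->
  (ts_v p_infty phi) ->
  exists K, 0 <= K /\ limit_bounds uN phi T K.
Proof.
  intros HT Hu Hphi.
  assert (Hs : forall i j, ts p_infty (fun t => stress uN t i j)) by (intros; apply ts_stress, Hu).
  assert (B := fun f Hf => bdd1_eventually T f HT Hf).
  assert (B1 := axis_eventually _ (fun j => B _ (Hu j))).
  assert (B2 := axis_eventually _ (fun k => axis_eventually _ (fun j => B _ (ts_partial _ k _ (Hu j))))).
  assert (B3 := axis_eventually _ (fun j => B _ (Hphi j))).
  assert (B4 := axis_eventually _ (fun k => axis_eventually _ (fun j => B _ (ts_partial _ k _ (Hphi j))))).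
  assert (B5 := axis_eventually _ (fun j => B _ (ts_Dt _ _ (Hphi j)))).
  assert (B6 := axis_eventually _ (fun i => axis_eventually _ (fun j => B _ (ts_Dt _ _ (Hs i j))))).
  assert (B7 := axis_eventually _ (fun k => axis_eventually _ (fun i => axis_eventually _ (fun j =>
    B _ (ts_partial _ k _ (ts_freeze _ p_infty 0 _ (Hs i j) in_time_infty)))))).
  assert (B0 : Rbar_locally p_infty (fun K => 0 <= K)) by (exists 0; intros; lra).
  destruct (filter_ex _ (filter_and _ _ B0 (filter_and _ _ B1 (filter_and _ _ B2 (filter_and _ _ B3
    (filter_and _ _ B4 (filter_and _ _ B5 (filter_and _ _ B6 B7)))))))) as (K & H0 & H1 & H2 & H3 & H4 & H5 & H6 & H7).
  exists K. split; [exact H0|]. constructor; assumption.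
Qed.

Definition layer_density (uN : R -> vfield) (U : R -> mfield) : sfield := h1_density (mdiv (layer uN U)).

Definition h1_power (w : vfield) (W : mfield) (r : vfield) (Q : mfield) : sfield :=
  fun x y => power_density w W r Q x y
    + sum2 (fun k => power_density (fun j => partial k (w j)) (fun i j => partial k (W i j))
        (fun j => partial k (r j)) (fun i j => partial k (Q i j)) x y).

Definition h1_energy_density (eps del : R) (q : sfield) (w : vfield) (W : mfield) : sfield :=
  fun x y => energy_density eps del q w W x y
    + sum2 (fun k => energy_density eps del (partial k q) (fun j => partial k (w j)) (fun i j => partial k (W i j)) x y).


(** * Norms as integrals *)

Definition I2 (f : sfield) : R := integral (fun x y => f x y ^ 2).

Lemma I2_ge0 f : cont2 f -> 0 <= I2 f.
Proof. intros Hf. apply integral_ge0; [reg|intros; apply pow2_ge_0]. Qed.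

Lemma sum2_ge0 f : (forall i, 0 <= f i) -> 0 <= sum2 f.
Proof. intros H. apply Rplus_le_le_0_compat; apply H. Qed.

Lemma normL2v_pow2 w : (forall j, cont2 (w j)) -> normL2v w ^ 2 = sum2 (fun j => I2 (w j)).
Proof.
  intros H. unfold normL2v. rewrite pow2_sqrt by (apply sum2_ge0; intros; apply pow2_ge_0).
  unfold sum2. rewrite !normL2_pow2 by apply H. reflexivity.
Qed.

Lemma normL2m_pow2 W : (forall i j, cont2 (W i j)) ->
  normL2m W ^ 2 = sum2 (fun i => sum2 (fun j => I2 (W i j))).
Proof.
  intros H. unfold normL2m. rewrite pow2_sqrt by (apply sum2_ge0; intros; apply sum2_ge0; intros; apply pow2_ge_0).
  unfold sum2. rewrite !normL2_pow2 by apply H. reflexivity.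
Qed.

Lemma normH1_pow2 f : smooth f -> normH1 f ^ 2 = I2 f + sum2 (fun k => I2 (partial k f)).
Proof.
  intros H. unfold normH1. rewrite pow2_sqrt by (apply Rplus_le_le_0_compat; apply pow2_ge_0).
  rewrite normL2_pow2 by reg.
  rewrite (normL2v_pow2 (grad f)); [reflexivity|]. intros j. unfold grad. reg.
Qed.

Lemma normH1m_pow2 W : (forall i j, smooth (W i j)) ->
  normH1m W ^ 2 = sum2 (fun i => sum2 (fun j => I2 (W i j) + sum2 (fun k => I2 (partial k (W i j))))).
Proof.
  intros H. unfold normH1m. rewrite pow2_sqrt by (apply sum2_ge0; intros; apply sum2_ge0; intros; apply pow2_ge_0).
  unfold sum2 at 1 2 3. rewrite !normH1_pow2 by apply H. reflexivity.
Qed.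

Lemma integral_sum2 (f : axis -> sfield) : (forall i, cont2 (f i)) ->
  integral (fun x y => sum2 (fun i => f i x y)) = sum2 (fun i => integral (f i)).
Proof. intros H. apply (integral_plus (f X1) (f X2)); apply H. Qed.

Lemma cont2_sum2 (f : axis -> sfield) : (forall i, cont2 (f i)) -> cont2 (fun x y => sum2 (fun i => f i x y)).
Proof. intros H. apply (cont2_plus (f X1) (f X2)); apply H. Qed.

Lemma integral_plus_sum2 d0 (d : axis -> sfield) : cont2 d0 -> (forall k, cont2 (d k)) ->
  integral (fun x y => d0 x y + sum2 (fun k => d k x y)) = integral d0 + sum2 (fun k => integral (d k)).
Proof.
  intros H0 H. rewrite <- (integral_sum2 d H). apply integral_plus; [exact H0|apply cont2_sum2, H].
Qed.

Lemma cont2_sq_v w : (forall j, cont2 (w j)) -> cont2 (sq_v w).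
Proof. intros H. apply (cont2_sum2 (fun j x y => w j x y ^ 2)). intros j. reg. Qed.

Lemma cont2_h1_density w : (forall j, smooth (w j)) -> cont2 (h1_density w).
Proof.
  intros H. apply (cont2_plus (sq_v w)); [apply cont2_sq_v; reg|].
  apply (cont2_sum2 (fun k => sq_v (fun j => partial k (w j)))). intros k.
  apply cont2_sq_v. reg.
Qed.

Lemma integral_sq_v w : (forall j, cont2 (w j)) -> integral (sq_v w) = sum2 (fun j => I2 (w j)).
Proof. intros H. apply (integral_sum2 (fun j x y => w j x y ^ 2)). intros j. reg. Qed.

Lemma integral_h1_density w : (forall j, smooth (w j)) ->
  integral (h1_density w) = sum2 (fun j => I2 (w j)) + sum2 (fun k => sum2 (fun j => I2 (partial k (w j)))).
Proof.
  intros H. unfold h1_density.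
  rewrite (integral_plus_sum2 (sq_v w) (fun k => sq_v (fun j => partial k (w j)))) by (intros; apply cont2_sq_v; reg).
  unfold sum2 at 1. rewrite !integral_sq_v by reg. reflexivity.
Qed.

Lemma normH1v_pow2 w : (forall j, smooth (w j)) -> normH1v w ^ 2 = integral (h1_density w).
Proof.
  intros H. rewrite integral_h1_density by exact H.
  unfold normH1v. rewrite pow2_sqrt by (apply sum2_ge0; intros; apply pow2_ge_0).
  unfold sum2. rewrite !normH1_pow2 by apply H. unfold sum2. ring.
Qed.

Lemma cont2_energy_density eps del q w W : cont2 q -> (forall j, cont2 (w j)) -> (forall i j, cont2 (W i j)) ->
  cont2 (energy_density eps del q w W).
Proof.
  intros Hq Hw HW. unfold energy_density, sum2. reg.
Qed.

Lemma integral_energy_density eps del q w W : cont2 q -> (forall j, cont2 (w j)) -> (forall i j, cont2 (W i j)) ->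
  integral (energy_density eps del q w W) =
  eps * I2 q + sum2 (fun j => I2 (w j)) + del * sum2 (fun i => sum2 (fun j => I2 (W i j))).
Proof.
  intros Hq Hw HW. unfold energy_density, sum2, I2.
  rewrite !integral_plus, !integral_scal by reg.
  rewrite !integral_plus by reg. reflexivity.
Qed.

(** * Energy estimates *)

Lemma is_derive_clamped (e : R -> sfield) t l : 0 < t ->
  is_derive (fun s => integral (e s)) t l -> is_derive (fun s => integral (e (Rmax 0 s))) t l.
Proof.
  intros H0. apply is_derive_ext_loc.
  generalize (locally_pos_time p_infty t H0 I). apply filter_imp. intros s [Hs _].
  now rewrite (in_time_Rmax_eq s) by lra.
Qed.

(** The additive constant [c] absorbs inhomogeneous terms of the differential inequality. *)
Lemma integral_gronwall T e (P : R -> sfield) b b' c s : ts T e -> 0 <= s -> Rbar_lt s T ->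
  (forall t, 0 < t < s -> is_derive (fun r => integral (e r)) t (integral (P t))) ->
  (forall t, is_derive b t (b' t)) ->
  (forall t, 0 < t < s -> integral (P t) <= b' t * (integral (e t) + c)) ->
  integral (e s) + c <= exp (b s - b 0) * (integral (e 0) + c).
Proof.
  intros He H0 HT Hd Hb HP.
  assert (Hlt : forall t, t <= s -> Rbar_lt t T) by (intros t Ht; apply Rbar_le_lt_trans with s; [exact Ht|exact HT]).
  assert (G := gronwall (fun t => integral (e (Rmax 0 t)) + c) (fun t => integral (P t)) b b' s H0).
  cbv beta in G. rewrite !(in_time_Rmax_eq s), !(in_time_Rmax_eq 0) in G by lra.
  apply G; [| |exact Hb|].
  - intros t Ht. apply (continuous_plus (V := RN)); [|apply continuous_const].
    apply (continuous_integral T); [apply smooth_cont, ts_smooth, He|].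
    rewrite in_time_Rmax_eq by lra. apply Hlt; lra.
  - intros t Ht. replace (integral (P t)) with (integral (P t) + 0) by ring.
    apply (is_derive_plus (V := RN)); [|apply (is_derive_const (V := RN))].
    apply is_derive_clamped; [lra|apply Hd, Ht].
  - intros t Ht. rewrite in_time_Rmax_eq by lra. apply HP, Ht.
Qed.

Lemma ts_h1_energy_density eps del T q w W : ts T q ->
  (ts_v T w) ->
  (ts_m T W) ->
  ts T (fun t => h1_energy_density eps del (q t) (w t) (W t)).
Proof.
  intros Hq Hw HW.
  unfold h1_energy_density, energy_density, sum2. ts_solve.
Qed.

Lemma cont2_power_density w W r Q : (forall j, cont2 (w j)) -> (forall i j, cont2 (W i j)) ->
  (forall j, cont2 (r j)) -> (forall i j, cont2 (Q i j)) -> cont2 (power_density w W r Q).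
Proof. intros Hw HW Hr HQ. unfold power_density, sum2. reg. Qed.

Lemma h1_energy_identity eps del T q w W r Q t : lin_sys eps del T q w W r Q ->
  0 < t -> Rbar_lt t T ->
  is_derive (fun s => integral (h1_energy_density eps del (q s) (w s) (W s))) t
    (integral (h1_power (w t) (W t) (r t) (Q t))).
Proof.
  intros HL H0 HT. assert (Ht := in_time_pos T t H0 HT).
  assert (D0 := energy_identity _ _ _ _ _ _ _ _ t HL H0 HT).
  assert (D := fun k => energy_identity _ _ _ _ _ _ _ _ t (lin_sys_partial k _ _ _ _ _ _ _ _ HL) H0 HT).
  destruct HL as [Hq Hw HW Hr HQ _ _ _].
  assert (Sw : forall s, in_time T s -> forall j, smooth (w s j)) by (intros s Hs a; apply (ts_slice T (fun t => w t a)); auto).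
  assert (SW : forall s, in_time T s -> forall i j, smooth (W s i j)) by (intros s Hs a b; apply (ts_slice T (fun t => W t a b)); auto).
  assert (Sq : forall s, in_time T s -> smooth (q s)) by (intros s Hs; apply (ts_slice T); auto).
  assert (Sr := ts_slice1 T r t ltac:(auto) Ht).
  assert (SQ := ts_slice2 T Q t ltac:(auto) Ht).
  set (dk := fun k s => energy_density eps del (partial k (q s)) (fun j => partial k (w s j)) (fun i j => partial k (W s i j))).
  set (pk := fun k => power_density (fun j => partial k (w t j)) (fun i j => partial k (W t i j))
        (fun j => partial k (r t j)) (fun i j => partial k (Q t i j))).
  replace (integral (h1_power (w t) (W t) (r t) (Q t))) with
    (integral (power_density (w t) (W t) (r t) (Q t)) + sum2 (fun k => integral (pk k)))
    by (symmetry; apply (integral_plus_sum2 _ pk); intros; apply cont2_power_density; reg).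
  apply is_derive_ext_loc with (f := fun s => integral (energy_density eps del (q s) (w s) (W s)) + sum2 (fun k => integral (dk k s))).
  - generalize (locally_pos_time T t H0 HT). apply filter_imp. intros s [Hs HsT].
    assert (Hin := in_time_pos T s Hs HsT). symmetry.
    apply (integral_plus_sum2 _ (fun k => dk k s)); intros; apply cont2_energy_density; reg.
  - apply (is_derive_plus (V := RN)); [exact D0|].
    apply (is_derive_plus (V := RN)); [exact (D X1)|exact (D X2)].
Qed.


Lemma h1_density_shift (f g phi : vfield) c eta K : (forall j, smooth (g j)) -> (forall j, smooth (phi j)) ->
  (forall j x y, f j x y = g j x y + c * phi j x y) -> c ^ 2 <= eta ^ 2 ->
  (forall j x y, Rabs (phi j x y) <= K) -> (forall k j x y, Rabs (partial k (phi j) x y) <= K) ->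
  integral (h1_density f) <= 2 * integral (h1_density g) + 12 * K ^ 2 * eta ^ 2.
Proof.
  intros Sg Sphi E Hc B0 B1.
  assert (Sf : forall j, smooth (f j)).
  { intros j. replace (f j) with (fun x y => g j x y + c * phi j x y); [reg|].
    field_ext x y. symmetry; apply E. }
  assert (E1 : forall k j x y, partial k (f j) x y = partial k (g j) x y + c * partial k (phi j) x y).
  { intros k j x y. rewrite (partial_fun_eq k _ _ x y (E j)). rewrite partial_plus by reg. now rewrite partial_scal. }
  assert (Cf := cont2_h1_density f Sf). assert (Cg := cont2_h1_density g Sg).
  rewrite <- (integral_const (12 * K ^ 2 * eta ^ 2)). rewrite <- integral_scal by exact Cg.
  rewrite <- integral_plus by reg.
  apply integral_le; [exact Cf|reg|]. intros x y.
  unfold h1_density, sq_v, sum2. rewrite !E1, !E.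
  assert (Q : forall a b, Rabs b <= K -> (a + c * b) ^ 2 <= 2 * a ^ 2 + 2 * (K ^ 2 * eta ^ 2)).
  { intros a b Hb.
    assert (Hb2 : b ^ 2 <= K ^ 2) by (rewrite <- (pow2_abs b); apply pow_incr; split; [apply Rabs_pos|exact Hb]).
    assert (H : b ^ 2 * c ^ 2 <= K ^ 2 * eta ^ 2) by (apply Rmult_le_compat; auto using pow2_ge_0).
    assert (H' := pow2_ge_0 (a - c * b)). lra. }
  assert (Q0 := fun j => Q (g j x y) _ (B0 j x y)). assert (Q1 := fun k j => Q (partial k (g j) x y) _ (B1 k j x y)).
  axes Q0. axes Q1. lra.
Qed.

Lemma h1_energy_density_ge eps del q w W x y : 0 <= eps -> 0 <= del ->
  eps * (q x y ^ 2 + (partial X1 q x y ^ 2 + partial X2 q x y ^ 2)) + h1_density w x y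
  <= h1_energy_density eps del q w W x y.
Proof.
  intros He Hd. unfold h1_energy_density, energy_density, h1_density, sq_v.
  assert (Z : forall V : mfield, 0 <= del * sum2 (fun i => sum2 (fun j => V i j x y ^ 2))).
  { intros V. apply Rmult_le_pos; [exact Hd|]. apply sum2_ge0; intros; apply sum2_ge0; intros; apply pow2_ge_0. }
  assert (Z0 := Z W). assert (Z1 := Z (fun i j => partial X1 (W i j))). assert (Z2 := Z (fun i j => partial X2 (W i j))).
  unfold sum2 in *. lra.
Qed.

Lemma h1_density_ge0 w x y : 0 <= h1_density w x y.
Proof.
  unfold h1_density, sq_v. apply Rplus_le_le_0_compat; repeat (apply sum2_ge0; intros); apply pow2_ge_0.
Qed.

(** The numerical factors are those of [source_bound] and [power_density_le], summed over all
    components and derivatives of order at most one. *)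
Definition growth_rate (K : R) : R := 1 + 120 * (K + 1) ^ 2 + 6 * K ^ 2 + 750 * (K + 1) ^ 4.
Definition h1_const (K C T : R) : R :=
  exp (growth_rate K * T + 1) * (3 * C ^ 2 + 12 * K ^ 2 + (6 * C ^ 2 + 48 * K ^ 2 + 1)).
Definition h2_const (K C T : R) : R := exp (114 * (K + 1) ^ 2 * T) * C ^ 2.


(** The layer produces the force [exp (- t / del) mdiv layer], whose integral in time is of
    size [del]. Its [H^1] norm times [del] is of order [eta] because the stress and
    [del] times the gradient of its divergence are controlled initially. *)
Lemma layer_integral del eta K C uN (U : R -> mfield) :
  0 <= del -> del <= eta -> 0 <= C -> 0 <= K ->
  (forall i j, smooth (U 0 i j)) -> (forall i j, smooth (stress uN 0 i j)) ->
  (forall k i j x y, Rabs (partial k (stress uN 0 i j) x y) <= K) ->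
  (forall l k i j x y, Rabs (partial l (partial k (stress uN 0 i j)) x y) <= K) ->
  normH1m (U 0) <= C -> del * normL2m (vgrad (mdiv (U 0))) <= C * eta ->
  del ^ 2 * integral (layer_density uN U) <= (6 * C ^ 2 + 48 * K ^ 2 + 1) * eta ^ 2.
Proof.
  intros Hd Hde HC HK SU SS Bs Bds N1 N2.
  assert (Sm : forall V : mfield, (forall i j, smooth (V i j)) -> forall j, smooth (mdiv V j))
    by (intros V HV j; unfold mdiv, sum2; reg).
  assert (B2 : forall a b, Rabs a <= K -> Rabs b <= K -> Rabs (a + b) <= 2 * K).
  { intros a b Ha Hb. eapply Rle_trans; [apply (Rabs_plus_le a b K K); assumption|lra]. }
  assert (IL : integral (layer_density uN U) <= 2 * integral (h1_density (mdiv (U 0))) + 12 * (2 * K) ^ 2 * 1 ^ 2).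
  { apply (h1_density_shift _ (mdiv (U 0)) (mdiv (stress uN 0)) (-1)); auto.
    - intros j x y. unfold mdiv, sum2, layer. rewrite !partial_minus by reg. ring.
    - lra.
    - intros j x y. apply B2; apply Bs.
    - intros k j x y. unfold mdiv, sum2. rewrite partial_plus by reg. apply B2; apply Bds. }
  rewrite integral_h1_density in IL by auto.
  assert (IA : sum2 (fun j => I2 (mdiv (U 0) j)) <= 2 * C ^ 2).
  { apply Rle_trans with (2 * normH1m (U 0) ^ 2).
    2:{ apply Rmult_le_compat_l; [lra|]. apply pow_incr; split; [apply sqrt_pos|exact N1]. }
    rewrite normH1m_pow2 by auto.
    assert (Q : forall j, I2 (mdiv (U 0) j) <= 2 * (I2 (partial X1 (U 0 X1 j)) + I2 (partial X2 (U 0 X2 j)))).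
    { intros j. assert (Smj := Sm _ SU j). unfold I2. rewrite <- integral_plus, <- integral_scal by reg.
      apply integral_le; [reg|reg|]. intros x y. unfold mdiv, sum2.
      assert (H := pow2_ge_0 (partial X1 (U 0 X1 j) x y - partial X2 (U 0 X2 j) x y)). lra. }
    assert (Z := fun i j => I2_ge0 (U 0 i j) ltac:(reg)).
    assert (Z' := fun k i j => I2_ge0 (partial k (U 0 i j)) ltac:(reg)).
    axes Q. axes Z. axes Z'. unfold sum2. lra. }
  assert (IB : normL2m (vgrad (mdiv (U 0))) ^ 2 = sum2 (fun k => sum2 (fun j => I2 (partial k (mdiv (U 0) j)))))
    by (apply normL2m_pow2; intros; unfold vgrad; reg).
  assert (N2' : (del * normL2m (vgrad (mdiv (U 0)))) ^ 2 <= (C * eta) ^ 2).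
  { apply pow_incr. split; [|exact N2]. apply Rmult_le_pos; [exact Hd|apply sqrt_pos]. }
  rewrite Rpow_mult_distr, IB in N2'.
  assert (D2 : del ^ 2 <= eta ^ 2) by (apply pow_incr; lra).
  assert (H1 : del ^ 2 * (4 * C ^ 2 + 48 * K ^ 2) <= eta ^ 2 * (4 * C ^ 2 + 48 * K ^ 2)).
  { apply Rmult_le_compat_r; [|exact D2]. assert (H := pow2_ge_0 C). assert (H' := pow2_ge_0 K). lra. }
  apply (Rmult_le_compat_l (del ^ 2)) in IL; [|apply pow2_ge_0].
  apply (Rmult_le_compat_l (del ^ 2)) in IA; [|apply pow2_ge_0].
  assert (eta2 := pow2_ge_0 eta). lra.
Qed.

(** The product of first derivatives is estimated by [integral_partial_pow4]. *)
Lemma I2_partial2_product k f g A : smooth f -> smooth g -> periodic f -> periodic g ->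
  (forall x y, Rabs (f x y) <= A) -> (forall x y, Rabs (g x y) <= A) ->
  I2 (partial k (partial k (fun x y => f x y * g x y)))
  <= 57 * A ^ 2 * (I2 (partial k (partial k f)) + I2 (partial k (partial k g))).
Proof.
  intros Hf Hg Pf Pg Bf Bg.
  assert (E : forall x y, partial k (partial k (fun x y => f x y * g x y)) x y =
     partial k (partial k f) x y * g x y + 2 * (partial k f x y * partial k g x y) + f x y * partial k (partial k g) x y).
  { intros x y. rewrite (partial_fun_eq k _ (fun x y => partial k f x y * g x y + f x y * partial k g x y))
      by (intros; apply partial_mult; reg).
    rewrite (partial_plus k (fun x y => partial k f x y * g x y)) by reg.
    rewrite !partial_mult by reg. ring. }
  assert (F4 := integral_partial_pow4 k f A Hf Pf Bf). assert (G4 := integral_partial_pow4 k g A Hg Pg Bg).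
  apply Rle_trans with (integral (fun x y => 3 * A ^ 2 * partial k (partial k f) x y ^ 2 + 6 * partial k f x y ^ 4 + 6 * partial k g x y ^ 4
     + 3 * A ^ 2 * partial k (partial k g) x y ^ 2)).
  - unfold I2. apply integral_le; [reg|reg|]. intros x y. rewrite E.
    assert (SqA : forall v, Rabs v <= A -> v ^ 2 <= A ^ 2).
    { intros v Hv. rewrite <- (pow2_abs v). apply pow_incr. split; [apply Rabs_pos|exact Hv]. }
    assert (F := SqA _ (Bf x y)). assert (G := SqA _ (Bg x y)).
    set (a := partial k (partial k f) x y). set (b := partial k (partial k g) x y).
    set (c := partial k f x y). set (d := partial k g x y).
    assert (H1 : a ^ 2 * g x y ^ 2 <= a ^ 2 * A ^ 2) by (apply Rmult_le_compat_l; [apply pow2_ge_0|exact G]).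
    assert (H2 : b ^ 2 * f x y ^ 2 <= b ^ 2 * A ^ 2) by (apply Rmult_le_compat_l; [apply pow2_ge_0|exact F]).
    assert (H3 := pow2_ge_0 (c ^ 2 - d ^ 2)).
    assert (H4 := pow2_ge_0 (a * g x y - 2 * (c * d))). assert (H5 := pow2_ge_0 (a * g x y - f x y * b)).
    assert (H6 := pow2_ge_0 (2 * (c * d) - f x y * b)). nra.
  - rewrite !integral_plus, !integral_scal by reg. fold (I2 (partial k (partial k f))) (I2 (partial k (partial k g))) in *. lra.
Qed.

(** The relaxation system itself, with the quadratic term as a source. *)
Lemma relax_lin_sys eps del T u0 p0 U0 u p U : relax_solution eps del T u0 p0 U0 u p U ->
  lin_sys eps del T p u U (fun _ _ _ _ => 0) (fun t => tensor (u t) (u t)).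
Proof.
  intros [HT Hu Hp HU Ep Eu EU _ _ _]. constructor; auto.
  - intros j. apply ts_const.
  - intros i j. apply (ts_mult T (fun t => u t i) (fun t => u t j)); apply Hu.
  - intros t i j x y H0 HtT. rewrite EU by assumption. ring.
Qed.

Definition second_energy (eps del : R) (p : sfield) (u : vfield) (U : mfield) (k : axis) : R :=
  integral (energy_density eps del (partial k (partial k p)) (fun j => partial k (partial k (u j)))
    (fun i j => partial k (partial k (U i j)))).

(** Each pure second derivative obeys a closed estimate as long as the velocity is bounded,
    because the quadratic source then is bounded by the same second derivative. Their
    initial size is a negative power of [eta], which [sup_interpolation] can afford. *)
Lemma second_energy_estimate eps del T u0 p0 U0 u p U A s k : 0 <= eps -> 0 <= del ->
  relax_solution eps del T u0 p0 U0 u p U -> 0 <= s -> Rbar_lt s T ->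
  (forall t j x y, 0 < t < s -> Rabs (u t j x y) <= A) ->
  second_energy eps del (p s) (u s) (U s) k
  <= exp (114 * A ^ 2 * s) * second_energy eps del (p 0) (u 0) (U 0) k.
Proof.
  intros He Hd HR Hs HsT HA.
  assert (HL := lin_sys_partial k _ _ _ _ _ _ _ _ (lin_sys_partial k _ _ _ _ _ _ _ _ (relax_lin_sys _ _ _ _ _ _ _ _ _ HR))).
  assert (Hlt : forall t, t <= s -> Rbar_lt t T) by (intros t Ht; apply Rbar_le_lt_trans with s; [exact Ht|exact HsT]).
  set (e := fun t => energy_density eps del (partial k (partial k (p t))) (fun j => partial k (partial k (u t j)))
    (fun i j => partial k (partial k (U t i j)))).
  assert (Hu := relax_smooth_u _ _ _ _ _ _ _ _ _ HR).
  assert (Hp := relax_smooth_p _ _ _ _ _ _ _ _ _ HR).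
  assert (HU := relax_smooth_U _ _ _ _ _ _ _ _ _ HR).
  assert (He' : ts T e) by (unfold e, energy_density, sum2; ts_solve).
  assert (G := integral_gronwall T e (fun t => power_density (fun j => partial k (partial k (u t j)))
     (fun i j => partial k (partial k (U t i j))) (fun _ => partial k (partial k (fun _ _ => 0))) (fun i j => partial k (partial k (tensor (u t) (u t) i j))))
    (fun t => 114 * A ^ 2 * t) (fun _ => 114 * A ^ 2) 0 s He' Hs HsT).
  rewrite !Rplus_0_r, Rmult_0_r, Rminus_0_r in G. apply G.
  - intros t Ht. apply (energy_identity _ _ _ _ _ _ _ _ t HL); [lra|apply Hlt; lra].
  - intros t. auto_derive; [exact I|ring].
  - intros t Ht. rewrite Rplus_0_r.
    assert (Hin : in_time T t) by (apply in_time_pos; [lra|apply Hlt; lra]).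
    assert (Su := ts_slice1 T u t ltac:(auto) Hin).
    assert (Pu : forall j, periodic (u t j)) by (intros a; apply (ts_periodic T (fun t => u t a)); auto).
    assert (Sp : smooth (p t)) by (apply (ts_slice T); auto).
    assert (SU := ts_slice2 T U t ltac:(auto) Hin).
    assert (ST : forall i j, smooth (tensor (u t) (u t) i j)) by (intros i j; unfold tensor; reg).
    assert (Z : forall x y, partial k (partial k (fun _ _ => 0)) x y = 0).
    { intros x y. rewrite (partial_fun_eq k _ (fun _ _ => 0)) by (intros; apply partial_const). apply partial_const. }
    apply Rle_trans with (integral (fun x y => / 2 * sum2 (fun i => sum2 (fun j => partial k (partial k (tensor (u t) (u t) i j)) x y ^ 2)))).
    + apply integral_le; [unfold power_density, sum2; reg|unfold sum2; reg|].
      intros x y. unfold power_density, sum2. rewrite !Z.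
      assert (HQ : forall a b, 2 * (a * b - a ^ 2) <= / 2 * b ^ 2) by (intros a b; assert (H := pow2_ge_0 (2 * a - b)); lra).
      assert (HQ' := fun i j => HQ (partial k (partial k (U t i j)) x y) (partial k (partial k (tensor (u t) (u t) i j)) x y)).
      axes HQ'. lra.
    + unfold e. rewrite integral_energy_density by reg.
      unfold sum2. rewrite integral_scal by reg. rewrite !integral_plus by reg.
      fold (I2 (partial k (partial k (tensor (u t) (u t) X1 X1)))) (I2 (partial k (partial k (tensor (u t) (u t) X1 X2))))
       (I2 (partial k (partial k (tensor (u t) (u t) X2 X1)))) (I2 (partial k (partial k (tensor (u t) (u t) X2 X2)))).
      assert (B := fun i j => I2_partial2_product k (u t i) (u t j) A (Su i) (Su j) (Pu i) (Pu j)
        (fun x y => HA t i x y Ht) (fun x y => HA t j x y Ht)).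
      axes B.
      unfold tensor in *.
      assert (N1 : 0 <= eps * I2 (partial k (partial k (p t)))) by (apply Rmult_le_pos; [exact He|apply I2_ge0; reg]).
      assert (N2 : 0 <= del * (I2 (partial k (partial k (U t X1 X1))) + I2 (partial k (partial k (U t X1 X2))) +
          (I2 (partial k (partial k (U t X2 X1))) + I2 (partial k (partial k (U t X2 X2)))))).
      { apply Rmult_le_pos; [exact Hd|]. assert (Z' := fun i j => I2_ge0 (partial k (partial k (U t i j))) ltac:(reg)).
        axes Z'. lra. }
      assert (A2 : 0 <= 114 * A ^ 2) by (assert (H := pow2_ge_0 A); lra).
      assert (N := Rmult_le_pos _ _ A2 (Rplus_le_le_0_compat _ _ N1 N2)). lra.
Qed.

(** The cross term is the square of a mixed derivative by [integral_partial12]. *)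
Lemma I2_laplacian f : smooth f -> periodic f ->
  I2 (partial X1 (partial X1 f)) + I2 (partial X2 (partial X2 f)) <= I2 (laplacian f).
Proof.
  intros Hf Pf. assert (H := integral_partial12 f Hf Pf).
  assert (H0 : 0 <= integral (fun x y => partial X1 (partial X2 f) x y ^ 2)) by (apply I2_ge0; reg).
  unfold I2, laplacian, sum2.
  rewrite (integral_ext (fun x y => (partial X1 (partial X1 f) x y + partial X2 (partial X2 f) x y) ^ 2)
    (fun x y => partial X1 (partial X1 f) x y ^ 2 + partial X2 (partial X2 f) x y ^ 2 + 2 * (partial X1 (partial X1 f) x y * partial X2 (partial X2 f) x y)))
    by (intros; ring).
  rewrite !integral_plus, integral_scal by reg. lra.
Qed.

Lemma second_energy_laplacian eps del p u U : 0 <= eps <= 1 -> 0 <= del <= 1 ->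
  smooth p -> periodic p -> (forall j, smooth (u j)) -> (forall j, periodic (u j)) ->
  (forall i j, smooth (U i j)) -> (forall i j, periodic (U i j)) ->
  second_energy eps del p u U X1 + second_energy eps del p u U X2
  <= normL2_tuple (vlaplacian u) (laplacian p) (mlaplacian U) ^ 2.
Proof.
  intros He Hd Sp Pp Su Pu SU PU. unfold second_energy.
  rewrite !integral_energy_density by reg.
  unfold normL2_tuple. rewrite pow2_sqrt by (repeat apply Rplus_le_le_0_compat; apply pow2_ge_0).
  assert (SL : forall f, smooth f -> smooth (laplacian f)) by (intros; unfold laplacian, sum2; reg).
  rewrite normL2v_pow2 by (intros; unfold vlaplacian; reg).
  rewrite normL2m_pow2 by (intros; unfold mlaplacian; reg).
  rewrite normL2_pow2 by reg. fold (I2 (laplacian p)).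
  assert (Lp := I2_laplacian p Sp Pp). assert (Lu := fun j => I2_laplacian (u j) (Su j) (Pu j)).
  assert (LU := fun i j => I2_laplacian (U i j) (SU i j) (PU i j)).
  unfold vlaplacian, mlaplacian, sum2.
  axes Lu.
  assert (Sc : forall c a b l, 0 <= c <= 1 -> 0 <= a -> 0 <= b -> a + b <= l -> c * a + c * b <= l).
  { intros c a b l Hc Ha Hb H. nra. }
  assert (Z : forall k f, smooth f -> 0 <= I2 (partial k (partial k f))) by (intros; apply I2_ge0; reg).
  assert (Mp := Sc eps _ _ _ He (Z X1 p Sp) (Z X2 p Sp) Lp).
  assert (MU := fun i j => Sc del _ _ _ Hd (Z X1 (U i j) (SU i j)) (Z X2 (U i j) (SU i j)) (LU i j)).
  axes MU. lra.
Qed.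

(** * Uniform estimates for the error *)

Section RelaxationLimit.
Variables (eps del : R) (T : Rbar) (u0N : vfield) (uN Phi : R -> vfield) (pN : R -> sfield).
Variables (u0 : vfield) (p0 : sfield) (U0 : mfield) (u : R -> vfield) (p : R -> sfield) (U : R -> mfield).
Hypothesis (Heps : 0 < eps) (Hdel : 0 < del).
Hypothesis (HN : NS_solution u0N uN pN).
Hypothesis (HPhi : ts_v p_infty Phi).
Hypothesis (Hdiv : forall t x y, 0 <= t -> div (Phi t) x y = pN t x y).
Hypothesis (HR : relax_solution eps del T u0 p0 U0 u p U).

Let phi := dtv Phi.
Let eta := eps + del.

Let Hu := relax_smooth_u _ _ _ _ _ _ _ _ _ HR.
Let Hp := relax_smooth_p _ _ _ _ _ _ _ _ _ HR.
Let HU := relax_smooth_U _ _ _ _ _ _ _ _ _ HR.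
Let HuN := NS_smooth_u _ _ _ HN.

Lemma ts_infty f : ts p_infty f -> ts T f.
Proof. intros H. apply (ts_shorten p_infty); [exact H|]. destruct T; simpl; auto. Qed.

Lemma ts_phi j : ts p_infty (fun t => phi t j).
Proof. apply (ts_Dt p_infty (fun t => Phi t j)), HPhi. Qed.

Lemma ts_dt_phi j : ts p_infty (fun t => dtv phi t j).
Proof. apply (ts_Dt p_infty (fun t => phi t j)), ts_phi. Qed.

Lemma ts_stress_N i j : ts p_infty (fun t => stress uN t i j).
Proof. apply ts_stress. intros a. apply (NS_smooth_u _ _ _ HN). Qed.

Lemma slices t : in_time T t ->
  (forall j, smooth (u t j)) /\ (forall j, periodic (u t j)) /\
  (forall j, smooth (uN t j)) /\ (forall j, periodic (uN t j)) /\ (forall j, smooth (phi t j)) /\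
  smooth (p t) /\ periodic (p t) /\ smooth (pN t) /\
  (forall i j, smooth (U t i j)) /\ (forall i j, periodic (U t i j)) /\ (forall i j, smooth (stress uN t i j)).
Proof.
  intros Hin. assert (Hin' : in_time p_infty t) by (split; [apply Hin|exact I]).
  assert (HpN := NS_smooth_p _ _ _ HN).
  repeat match goal with |- _ /\ _ => split end.
  - apply (ts_slice1 T u), Hin. apply Hu.
  - intros j. apply (ts_periodic T (fun t => u t j)); auto.
  - apply (ts_slice1 p_infty uN), Hin'. apply HuN.
  - intros j. apply (ts_periodic p_infty (fun t => uN t j)); auto.
  - apply (ts_slice1 p_infty phi), Hin'. apply ts_phi.
  - apply (ts_slice T); auto.
  - apply (ts_periodic T); auto.
  - apply (ts_slice p_infty); auto.
  - apply (ts_slice2 T U), Hin. apply HU.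
  - intros i j. apply (ts_periodic T (fun t => U t i j)); auto.
  - apply (ts_slice2 p_infty (stress uN)), Hin'. apply ts_stress_N.
Qed.

Ltac get_slices H :=
  destruct (slices _ H) as (Su & Pu & SN & PN & Sphi & Sp & Pp & SpN & SU & PU & SS).

Lemma in_time_0_T : in_time T 0.
Proof. split; [lra|apply (relax_time_pos _ _ _ _ _ _ _ _ _ HR)]. Qed.

Lemma ts_layer T' i j : ts T' (fun _ => layer uN U i j).
Proof.
  unfold layer. ts_solve.
  - apply (ts_freeze T T' 0 (fun t => U t i j)); [apply (relax_smooth_U _ _ _ _ _ _ _ _ _ HR)|apply in_time_0_T].
  - apply (ts_freeze p_infty T' 0 (fun t => stress uN t i j)); [apply ts_stress_N|apply in_time_infty].
Qed.

Lemma smooth_layer i j : smooth (layer uN U i j).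
Proof. apply ts_smooth, ts_layer. Qed.

Lemma ts_layer_div T' j : ts T' (fun _ => mdiv (layer uN U) j).
Proof.
  unfold mdiv, sum2. ts_solve; apply ts_layer.
Qed.

Lemma div_phi t x y : 0 < t -> div (phi t) x y = Derive (fun s => pN s x y) t.
Proof.
  intros H0.
  assert (HD : forall j, partial j (phi t j) x y = Derive (fun s => partial j (Phi s j) x y) t).
  { intros j. rewrite (Derive_partial p_infty j (fun s => Phi s j)) by (auto; exact I).
    apply partial_fun_eq. intros a b. symmetry. apply (Dt_Derive p_infty (fun s => Phi s j)); [|exact H0|exact I].
    apply ts_smooth, HPhi. }
  unfold div, sum2. rewrite !HD.
  assert (X : forall j, ex_derive (fun s => partial j (Phi s j) x y) t).
  { intros j. apply (ts_ex_derive p_infty (fun s => partial j (Phi s j))); [|exact H0|exact I].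
    apply (ts_partial p_infty j (fun s => Phi s j)), HPhi. }
  rewrite <- Derive_plus by apply X.
  apply Derive_ext_loc. generalize (locally_pos_time p_infty t H0 I). apply filter_imp.
  intros s [Hs _]. apply (Hdiv s x y). lra.
Qed.

Lemma error_system : lin_sys eps del T (err_p pN p) (err_u eps uN phi u) (err_U del uN U)
  (src_u eps del uN phi U) (src_U eps del uN phi u).
Proof.
  assert (HpN := NS_smooth_p _ _ _ HN).
  constructor.
  - unfold err_p. ts_solve. apply ts_infty, HpN.
  - unfold err_u. ts_solve; apply ts_infty; auto using ts_phi.
  - unfold err_U. ts_solve; [apply ts_infty, ts_stress_N|apply ts_layer].
  - unfold src_u. ts_solve; [apply ts_infty, ts_dt_phi|apply ts_layer_div].
  - unfold src_U. ts_solve; apply ts_infty; auto using ts_phi.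
    apply (ts_Dt p_infty (fun t => stress uN t i j)), ts_stress_N.
  - intros t x y H0 HtT. assert (Ht := in_time_pos T t H0 HtT).
    get_slices Ht.
    unfold err_p. rewrite Derive_minus.
    2: apply (ts_ex_derive T p); assumption.
    2: apply (ts_ex_derive p_infty pN); assumption || exact I.
    assert (E1 := relax_p _ _ _ _ _ _ _ _ _ HR t x y H0 HtT).
    assert (E2 := NS_incompressible _ _ _ HN t x y H0).
    assert (E3 := div_phi t x y H0).
    unfold div, sum2, err_u in *. rewrite !partial_lin3 by auto.
    rewrite <- E3. rewrite Rmult_minus_distr_l. lra.
  - intros t j x y H0 HtT. assert (Ht := in_time_pos T t H0 HtT).
    get_slices Ht.
    unfold err_u.
    rewrite (Derive_lin3 (fun s : R => u s j x y) (fun s : R => uN s j x y) (fun s : R => phi s j x y)).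
    2: apply (ts_ex_derive T (fun s => u s j)); auto.
    2: apply (ts_ex_derive p_infty (fun s => uN s j)); auto; exact I.
    2: apply (ts_ex_derive p_infty (fun s => phi s j)); auto using ts_phi; exact I.
    assert (E1 := relax_u _ _ _ _ _ _ _ _ _ HR t j x y H0 HtT).
    assert (E2 := NS_momentum _ _ _ HN t j x y H0).
    assert (E3 : Derive (fun s => phi s j x y) t = dtv phi t j x y).
    { apply (Dt_Derive p_infty (fun s => phi s j)); [|exact H0|exact I]. apply ts_smooth, ts_phi. }
    rewrite E3. unfold src_u, mdiv, grad, sum2, err_U, err_p in *.
    rewrite !partial_lin3 by auto using smooth_layer.
    rewrite partial_minus.
    2, 3: reg.
    assert (E4 : forall i, partial i (stress uN t i j) x y = partial i (tensor (uN t) (uN t) i j) x y - partial i (partial i (uN t j)) x y).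
    { intros i. apply (partial_minus i (tensor (uN t) (uN t) i j)); [|reg].
      apply ex_partial_mult; reg. }
    rewrite !E4. unfold vlaplacian, laplacian, sum2 in E2. lra.
  - intros t i j x y H0 HtT. assert (Ht := in_time_pos T t H0 HtT).
    get_slices Ht.
    unfold err_U.
    rewrite (Derive_layer (fun s : R => U s i j x y) (fun s : R => stress uN s i j x y)).
    2: apply (ts_ex_derive T (fun s => U s i j)); auto.
    2: apply (ts_ex_derive p_infty (fun s => stress uN s i j)); auto using ts_stress_N; exact I.
    assert (E1 := relax_U _ _ _ _ _ _ _ _ _ HR t i j x y H0 HtT).
    assert (E3 : Derive (fun s => stress uN s i j x y) t = dtm (stress uN) t i j x y).
    { apply (Dt_Derive p_infty (fun s => stress uN s i j)); [|exact H0|exact I]. apply ts_smooth, ts_stress_N. }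
    rewrite E3. unfold vgrad, tensor, err_u, src_U in *. rewrite partial_lin3 by auto.
    unfold stress at 2.
    assert (E4 : del * (- / del * exp (- / del * t) * layer uN U i j x y) = - exp (- / del * t) * layer uN U i j x y) by (field; lra).
    rewrite !Rmult_minus_distr_l. rewrite E4. lra.
Qed.
(** [rho] stands for the size [eta^(-a)] of the initial second derivatives. *)
Variables (Tf K C rho : R).
Hypothesis (HTf : 0 < Tf) (HT : Rbar_lt Tf T) (HK : 0 <= K) (HC : 0 < C).
Hypothesis (HB : limit_bounds uN (dtv Phi) Tf K).

Let w t j x y := u t j x y - uN t j x y.

Let L := growth_rate K.
Let M := 6 * C ^ 2 + 48 * K ^ 2 + 1.
Let M1 := h1_const K C Tf.
Let M2 := h2_const K C Tf.

Lemma h1_power_le t x y : 0 <= t <= Tf -> Rbar_lt t T ->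
  (forall j, Rabs (w t j x y) <= 1) ->
  h1_power (err_u eps uN phi u t) (err_U del uN U t) (src_u eps del uN phi U t) (src_U eps del uN phi u t) x y
  <= (L + exp (- / del * t) / del) * h1_density (err_u eps uN phi u t) x y
     + L * eta ^ 2 + exp (- / del * t) * del * layer_density uN U x y.
Proof.
  intros Ht HtT Hw.
  assert (Hin : in_time T t) by (split; [lra|exact HtT]).
  assert (Hin' : in_time p_infty t) by (split; [lra|exact I]).
  get_slices Hin.
  assert (Sdphi := ts_slice1 p_infty (dtv phi) t ts_dt_phi Hin').
  assert (Sst := ts_slice2 p_infty (dtm (stress uN)) t (fun i j => ts_Dt p_infty _ (ts_stress_N i j)) Hin').
  assert (Sl : forall j, smooth (mdiv (layer uN U) j)) by (intros j; apply ts_smooth, ts_layer_div).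
  set (e := exp (- / del * t)).
  assert (He : 0 <= e) by (left; apply exp_pos).
  set (v := err_u eps uN phi u t).
  assert (Ev : forall j a b, v j a b = w t j a b + eps * phi t j a b) by reflexivity.
  assert (Edv : forall k j, partial k (v j) x y = (partial k (u t j) x y - partial k (uN t j) x y) + eps * partial k (phi t j) x y).
  { intros k j. apply partial_lin3; auto. }
  set (S := h1_density v x y).
  destruct (HB : limit_bounds uN phi Tf K) as [LBu LBdu LBphi LBdphi LBphit LBst LBs0].
  assert (Bu := fun j => proj1 (LBu j) t x y Ht). assert (Bdu := fun k j => proj2 (LBu j) k t x y Ht).
  assert (Bphi := fun j => proj1 (LBphi j) t x y Ht). assert (Bdphi := fun k j => proj2 (LBphi j) k t x y Ht).
  assert (Bddphi := fun l k j => proj2 (LBdphi k j) l t x y Ht).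
  assert (Bphit := fun j => proj1 (LBphit j) t x y Ht). assert (Bdphit := fun k j => proj2 (LBphit j) k t x y Ht).
  assert (Bst := fun i j => proj1 (LBst i j) t x y Ht). assert (Bdst := fun k i j => proj2 (LBst i j) k t x y Ht).
  cbv beta in *.
  assert (Sq : forall j, v j x y ^ 2 <= S /\ forall k, partial k (v j) x y ^ 2 <= S).
  { intros j. unfold S, h1_density, sq_v, sum2.
    assert (Z := fun a => pow2_ge_0 (v a x y)). assert (Z' := fun a b => pow2_ge_0 (partial a (v b) x y)).
    axes Z. axes Z'. split; [destruct j; lra|]. intros k; destruct j, k; lra. }
  set (bnd := 20 * (K + 1) ^ 2 * S + 125 * (K + 1) ^ 4 * eta ^ 2).
  assert (HS : forall a b c d, a <= S -> b <= S -> c <= S -> d <= S ->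
    5 * (K + 1) ^ 2 * (a + b + c + d) + 125 * (K + 1) ^ 4 * (eps + del) ^ 2 <= bnd).
  { intros a b c d Ha Hb Hc Hd. apply Rplus_le_compat_r.
    replace (20 * (K + 1) ^ 2 * S) with (5 * (K + 1) ^ 2 * (4 * S)) by ring.
    apply Rmult_le_compat_l; [|lra]. assert (H := pow2_ge_0 (K + 1)). lra. }
  assert (Q0 : forall i j, src_U eps del uN phi u t i j x y ^ 2 <= bnd).
  { intros i j.
    (* [source_bound] with the derivation replaced by the identity on the first factor and
       by zero on the second *)
    assert (H := source_bound eps del K (w t i x y) (w t j x y) (uN t i x y) (uN t j x y)
      (phi t i x y) (phi t j x y) (w t i x y) 0 (uN t i x y) 0 (phi t i x y) 0
      (dtm (stress uN) t i j x y) (partial i (phi t j) x y)).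
    replace (src_U eps del uN phi u t i j x y) with ((w t i x y + uN t i x y) * (w t j x y + uN t j x y)
      + (w t i x y + uN t i x y) * (0 + 0) - (uN t i x y * uN t j x y + uN t i x y * 0)
      - del * dtm (stress uN) t i j x y + eps * partial i (phi t j) x y) by (unfold src_U, w; ring).
    eapply Rle_trans; [apply H; auto; try rewrite Rabs_R0; lra|]. rewrite <- !Ev.
    apply HS; try apply Sq. replace ((0 + eps * 0) ^ 2) with 0 by ring. apply h1_density_ge0. }
  assert (Q1 : forall k i j, partial k (src_U eps del uN phi u t i j) x y ^ 2 <= bnd).
  { intros k i j.
    assert (H := source_bound eps del K (w t i x y) (w t j x y) (uN t i x y) (uN t j x y)
      (phi t i x y) (phi t j x y)
      (partial k (u t i) x y - partial k (uN t i) x y) (partial k (u t j) x y - partial k (uN t j) x y)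
      (partial k (uN t i) x y) (partial k (uN t j) x y) (partial k (phi t i) x y) (partial k (phi t j) x y)
      (partial k (dtm (stress uN) t i j) x y) (partial k (partial i (phi t j)) x y)).
    replace (partial k (src_U eps del uN phi u t i j) x y) with
     ((partial k (u t i) x y - partial k (uN t i) x y + partial k (uN t i) x y) * (w t j x y + uN t j x y) +
      (w t i x y + uN t i x y) * (partial k (u t j) x y - partial k (uN t j) x y + partial k (uN t j) x y) -
      (partial k (uN t i) x y * uN t j x y + uN t i x y * partial k (uN t j) x y) -
      del * partial k (dtm (stress uN) t i j) x y + eps * partial k (partial i (phi t j)) x y).
    2:{ symmetry. unfold src_U.
      rewrite (partial_plus k (fun x y => (u t i x y * u t j x y - uN t i x y * uN t j x y) - del * dtm (stress uN) t i j x y)) by reg.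
      rewrite (partial_minus k (fun x y => u t i x y * u t j x y - uN t i x y * uN t j x y)) by reg.
      rewrite (partial_minus k (fun x y => u t i x y * u t j x y)) by reg.
      rewrite !partial_mult by reg. rewrite !partial_const. unfold w. ring. }
    eapply Rle_trans; [apply H; auto; lra|]. rewrite <- !Ev, <- !Edv. apply HS; apply Sq. }
  assert (P0 := power_density_le eps del e v (err_U del uN U t) (src_u eps del uN phi U t) (dtv phi t) (mdiv (layer uN U))
     (src_U eps del uN phi u t) x y Hdel He (fun j => eq_refl)).
  assert (P1 : forall k, _) by exact (fun k => power_density_le eps del e (fun j => partial k (v j)) (fun i j => partial k (err_U del uN U t i j))
     (fun j => partial k (src_u eps del uN phi U t j)) (fun j => partial k (dtv phi t j)) (fun j => partial k (mdiv (layer uN U) j))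
     (fun i j => partial k (src_U eps del uN phi u t i j)) x y Hdel He
     (fun j => eq_trans (partial_minus k (fun x y => eps * dtv phi t j x y) (fun x y => e * mdiv (layer uN U) j x y) x y
        (ex_partial_scal _ _ _ _ _ (sm_ex_partial k _ x y (Sdphi j))) (ex_partial_scal _ _ _ _ _ (sm_ex_partial k _ x y (Sl j))))
        (f_equal2 Rminus (partial_scal k eps (dtv phi t j) x y) (partial_scal k e (mdiv (layer uN U) j) x y)))).
  assert (F2 : forall f, Rabs f <= K -> f ^ 2 <= K ^ 2).
  { intros f Hf. rewrite <- (pow2_abs f). apply pow_incr. split; [apply Rabs_pos|exact Hf]. }
  assert (e2 : eps ^ 2 <= eta ^ 2) by (apply pow_incr; unfold eta; lra).
  assert (eF : forall f, Rabs f <= K -> eps ^ 2 * f ^ 2 <= K ^ 2 * eta ^ 2).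
  { intros f Hf. rewrite Rmult_comm. apply Rmult_le_compat; auto using pow2_ge_0. }
  unfold h1_power. fold e.
  axes P1. unfold sum2 in *.
  axes Q0. axes Q1. unfold bnd in *.
  assert (V := fun j => eF _ (Bphit j)). assert (V' := fun k j => eF _ (Bdphit k j)). axes V. axes V'.
  assert (S0 : 0 <= S) by apply h1_density_ge0.
  assert (K2S : 0 <= K ^ 2 * S) by (apply Rmult_le_pos; [apply pow2_ge_0|exact S0]).
  assert (K4S : 0 <= (K + 1) ^ 4 * S).
  { apply Rmult_le_pos; [|exact S0]. replace ((K + 1) ^ 4) with (((K + 1) ^ 2) ^ 2) by ring. apply pow2_ge_0. }
  assert (eta2 : 0 <= eta ^ 2) by apply pow2_ge_0.
  assert (K2eta : 0 <= (K + 1) ^ 2 * eta ^ 2) by (apply Rmult_le_pos; apply pow2_ge_0).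
  assert (ES : S = v X1 x y ^ 2 + v X2 x y ^ 2 + (partial X1 (v X1) x y ^ 2 + partial X1 (v X2) x y ^ 2
      + (partial X2 (v X1) x y ^ 2 + partial X2 (v X2) x y ^ 2))) by reflexivity.
  unfold layer_density, h1_density, sq_v, sum2.
  replace ((L + e / del) * S) with ((1 + e / del) * S + (L - 1) * S) by ring.
  unfold L, growth_rate in *.
  set (m := mdiv (layer uN U)) in *.
  apply (f_equal (Rmult (1 + e / del))) in ES.
  assert (HL : 120 * (K + 1) ^ 2 * S + (6 * K ^ 2 + 750 * (K + 1) ^ 4) * eta ^ 2
     <= (1 + 120 * (K + 1) ^ 2 + 6 * K ^ 2 + 750 * (K + 1) ^ 4 - 1) * S
       + (1 + 120 * (K + 1) ^ 2 + 6 * K ^ 2 + 750 * (K + 1) ^ 4) * eta ^ 2) by lra.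
  lra.
Qed.

Hypothesis (Heta : eta <= 1).
Hypothesis (Hrho : 1 <= rho).
Hypothesis (D1 : normH1v (vminus (u 0) (uN 0)) <= C * eta).
Hypothesis (D2 : sqrt eps * normH1 (sminus (p 0) (pN 0)) <= C * eta).
Hypothesis (D3 : normH1m (U 0) <= C).
Hypothesis (D4 : del * normL2m (vgrad (mdiv (U 0))) <= C * eta).
Hypothesis (D5 : normL2_tuple (vlaplacian (u 0)) (laplacian (p 0)) (mlaplacian (U 0)) <= C * rho).

Let ed t := h1_energy_density eps del (err_p pN p t) (err_u eps uN phi u t) (err_U del uN U t).
Let E1 t := integral (ed t).
Let E2 t := second_energy eps del (p t) (u t) (U t) X1 + second_energy eps del (p t) (u t) (U t) X2.

Lemma in_T t : 0 <= t <= Tf -> in_time T t.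
Proof. intros Ht. split; [lra|apply Rbar_le_lt_trans with Tf; [simpl; lra|exact HT]]. Qed.

Lemma eps_sq_le : eps ^ 2 <= eta ^ 2.
Proof. apply pow_incr. unfold eta; lra. Qed.

Lemma err_u_smooth t : 0 <= t <= Tf -> forall j, smooth (err_u eps uN phi u t j).
Proof.
  intros Ht j. get_slices (in_T t Ht).
  unfold err_u. reg.
Qed.

Lemma ts_ed : ts T ed.
Proof.
  destruct error_system as [Hq Hw HW _ _ _ _ _].
  apply (ts_h1_energy_density eps del T _ _ _ Hq Hw HW).
Qed.

Lemma ed_cont2 t : 0 <= t <= Tf -> cont2 (ed t).
Proof.
  intros Ht. apply smooth_cont2, (ts_slice T ed); [apply ts_ed|apply in_T, Ht].
Qed.

Lemma h1_norms_as_integral q v : smooth q -> (forall j, smooth (v j)) ->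
  eps * normH1 q ^ 2 + integral (h1_density v) = integral (fun x y =>
    eps * (q x y ^ 2 + (partial X1 q x y ^ 2 + partial X2 q x y ^ 2)) + h1_density v x y).
Proof.
  intros Sq Sv. assert (Cv := cont2_h1_density _ Sv).
  rewrite normH1_pow2 by exact Sq. unfold sum2, I2.
  rewrite integral_plus, integral_scal, !integral_plus by reg. reflexivity.
Qed.

Lemma E1_ge t : 0 <= t <= Tf ->
  eps * normH1 (sminus (p t) (pN t)) ^ 2 <= E1 t /\
  0 <= integral (h1_density (err_u eps uN phi u t)) <= E1 t.
Proof.
  intros Ht. get_slices (in_T t Ht).
  assert (Sq : smooth (sminus (p t) (pN t))) by (unfold sminus; reg).
  assert (Sv := err_u_smooth t Ht). assert (Cv := cont2_h1_density _ Sv).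
  assert (H : eps * normH1 (sminus (p t) (pN t)) ^ 2 + integral (h1_density (err_u eps uN phi u t)) <= E1 t).
  { rewrite h1_norms_as_integral by assumption. apply integral_le; [reg|apply ed_cont2, Ht|].
    intros x y. apply h1_energy_density_ge; lra. }
  assert (0 <= eps * normH1 (sminus (p t) (pN t)) ^ 2) by (apply Rmult_le_pos; [lra|apply pow2_ge_0]).
  assert (0 <= integral (h1_density (err_u eps uN phi u t)))
    by (apply integral_ge0; [exact Cv|intros; apply h1_density_ge0]). lra.
Qed.

Lemma sq_of_mult_le s x b : 0 <= s -> 0 <= x -> sqrt s * x <= b -> s * x ^ 2 <= b ^ 2.
Proof.
  intros Hs Hx H. rewrite <- (pow2_sqrt s) at 1 by exact Hs. rewrite <- Rpow_mult_distr.
  apply pow_incr. split; [apply Rmult_le_pos; [apply sqrt_pos|exact Hx]|exact H].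
Qed.

(** The stress error does not contribute, since the layer has been subtracted. *)
Lemma E1_initial : E1 0 <= (3 * C ^ 2 + 12 * K ^ 2) * eta ^ 2.
Proof.
  assert (H0 : 0 <= 0 <= Tf) by lra.
  get_slices (in_T 0 H0).
  assert (Sq : smooth (sminus (p 0) (pN 0))) by (unfold sminus; reg).
  assert (Sv := err_u_smooth 0 H0).
  assert (EU : forall i j x y, err_U del uN U 0 i j x y = 0).
  { intros i j x y. unfold err_U, layer. rewrite Rmult_0_r, exp_0. ring. }
  assert (EdU : forall k i j x y, partial k (err_U del uN U 0 i j) x y = 0).
  { intros k i j x y. rewrite (partial_fun_eq k _ (fun _ _ => 0) x y (EU i j)). apply partial_const. }
  assert (E : E1 0 = eps * normH1 (sminus (p 0) (pN 0)) ^ 2 + integral (h1_density (err_u eps uN phi u 0))).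
  { rewrite h1_norms_as_integral by assumption.
    apply integral_ext. intros x y. unfold ed, h1_energy_density, energy_density, h1_density, sq_v, sum2.
    rewrite !EU, !EdU. unfold err_p, sminus. ring. }
  rewrite E.
  assert (B1 : eps * normH1 (sminus (p 0) (pN 0)) ^ 2 <= (C * eta) ^ 2).
  { apply sq_of_mult_le; [lra|apply sqrt_pos|exact D2]. }
  assert (B2 : integral (h1_density (err_u eps uN phi u 0)) <= 2 * integral (h1_density (vminus (u 0) (uN 0))) + 12 * K ^ 2 * eta ^ 2).
  { apply (h1_density_shift _ (vminus (u 0) (uN 0)) (phi 0) eps).
    - intros j. unfold vminus, sminus. reg.
    - exact Sphi.
    - reflexivity.
    - apply eps_sq_le.
    - intros j x y. apply (proj1 (lb_phi _ _ _ _ HB j) 0 x y H0).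
    - intros k j x y. apply (proj2 (lb_phi _ _ _ _ HB j) k 0 x y H0). }
  assert (B3 : integral (h1_density (vminus (u 0) (uN 0))) <= (C * eta) ^ 2).
  { rewrite <- normH1v_pow2.
    - apply pow_incr. split; [apply sqrt_pos|exact D1].
    - intros j. unfold vminus, sminus. reg. }
  lra.
Qed.

Definition small_on (s : R) : Prop := forall t j x y, 0 < t < s -> Rabs (w t j x y) <= 1.

(** Gronwall with rate [L + exp (- t / del) / del], a primitive of which stays bounded
    uniformly in [del]. *)
Lemma E1_estimate s : 0 <= s <= Tf -> small_on s -> E1 s <= M1 * eta ^ 2.
Proof.
  intros Hs Hsmall.
  assert (HsT := proj2 (in_T s Hs)).
  assert (HL := error_system).
  fold phi in HL.
  assert (M0 : 1 <= M) by (unfold M; assert (H := pow2_ge_0 C); assert (H' := pow2_ge_0 K); lra).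
  assert (L0 : 1 <= L).
  { unfold L, growth_rate. assert (H := pow2_ge_0 (K + 1)). assert (H' := pow2_ge_0 K).
    assert (H'' := pow2_ge_0 ((K + 1) ^ 2)). replace (((K + 1) ^ 2) ^ 2) with ((K + 1) ^ 4) in H'' by ring. lra. }
  assert (e2 : 0 <= eta ^ 2) by apply pow2_ge_0.
  assert (G := integral_gronwall T ed
    (fun t => h1_power (err_u eps uN phi u t) (err_U del uN U t) (src_u eps del uN phi U t) (src_U eps del uN phi u t))
    (fun t => L * t - exp (- / del * t)) (fun t => L + exp (- / del * t) / del) (M * eta ^ 2) s ts_ed (proj1 Hs) HsT).
  assert (CL : cont2 (layer_density uN U)).
  { apply cont2_h1_density. intros j. apply ts_smooth. apply ts_layer_div. }
  assert (Hlay : del ^ 2 * integral (layer_density uN U) <= M * eta ^ 2).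
  { get_slices (in_T 0 ltac:(lra)).
    apply (layer_integral del eta K C uN U); auto; try lra; try (unfold eta; lra).
    - intros k i j x y. apply (proj1 (lb_s0 _ _ _ _ HB k i j) 0 x y). lra.
    - intros l k i j x y. apply (proj2 (lb_s0 _ _ _ _ HB k i j) l 0 x y). lra. }
  assert (Hfin : E1 s + M * eta ^ 2 <= exp (L * Tf + 1) * ((3 * C ^ 2 + 12 * K ^ 2 + M) * eta ^ 2)).
  { eapply Rle_trans; [apply G|].
    - intros t Ht. apply (h1_energy_identity eps del T _ _ _ _ _ t HL); [lra|apply in_T; lra].
    - intros t. auto_derive; [exact I|field; lra].
    - intros t Ht. assert (Ht' : 0 <= t <= Tf) by lra.
      set (e := exp (- / del * t)). assert (e0 : 0 < e) by apply exp_pos.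
      assert (ed0 : 0 <= e / del) by (apply Rmult_le_pos; [lra|left; apply Rinv_0_lt_compat, Hdel]).
      assert (Sv := err_u_smooth t Ht'). assert (Cv := cont2_h1_density _ Sv).
      apply Rle_trans with (integral (fun x y => (L + e / del) * h1_density (err_u eps uN phi u t) x y + L * eta ^ 2 + e * del * layer_density uN U x y)).
      + apply integral_le; [|reg|].
        * destruct HL as [Hq Hw HW Hr HQ _ _ _].
          assert (Hin := in_T t Ht').
          assert (Y1 := ts_slice1 T _ t Hw Hin). assert (Y2 := ts_slice2 T _ t HW Hin).
          assert (Y3 := ts_slice1 T _ t Hr Hin). assert (Y4 := ts_slice2 T _ t HQ Hin).
          apply cont2_plus; [apply cont2_power_density; reg|].
          apply (cont2_sum2 (fun k => power_density (fun j => partial k (err_u eps uN phi u t j)) (fun i j => partial k (err_U del uN U t i j))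
            (fun j => partial k (src_u eps del uN phi U t j)) (fun i j => partial k (src_U eps del uN phi u t i j)))).
          intros k. apply cont2_power_density; reg.
        * intros x y. apply (h1_power_le t x y Ht').
          -- apply in_T; lra.
          -- intros j. apply (Hsmall t j x y Ht).
      + rewrite !integral_plus, !integral_scal, integral_const by reg.
        assert (B1 := proj2 (proj2 (E1_ge t Ht'))).
        assert (B2 : (L + e / del) * integral (h1_density (err_u eps uN phi u t)) <= (L + e / del) * E1 t) by (apply Rmult_le_compat_l; [lra|exact B1]).
        assert (B3 : e * del * integral (layer_density uN U) <= e / del * (M * eta ^ 2)).
        { replace (e * del * integral (layer_density uN U)) with (e / del * (del ^ 2 * integral (layer_density uN U))) by (field; lra).
          apply Rmult_le_compat_l; assumption. }
        assert (B4 : L * eta ^ 2 <= L * (M * eta ^ 2)) by (apply Rmult_le_compat_l; [lra|]; nra).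
        fold (E1 t). lra.
    - apply Rmult_le_compat.
      + left; apply exp_pos.
      + assert (H := E1_ge 0 ltac:(lra)). fold (E1 0). assert (0 <= M * eta ^ 2) by (apply Rmult_le_pos; lra). lra.
      + assert (Hm : L * s - exp (- / del * s) - (L * 0 - exp (- / del * 0)) <= L * Tf + 1).
        { rewrite (Rmult_0_r (- / del)), exp_0. assert (He := exp_pos (- / del * s)). nra. }
        destruct Hm as [Hm|Hm]; [left; apply exp_increasing, Hm|rewrite Hm; lra].
      + fold (E1 0). assert (H := E1_initial). lra. }
  assert (0 <= M * eta ^ 2) by (apply Rmult_le_pos; lra).
  unfold M1, h1_const. fold L M. rewrite Rmult_assoc. lra.
Qed.

Lemma E2_estimate s : 0 <= s <= Tf -> small_on s -> E2 s <= M2 * rho ^ 2.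
Proof.
  intros Hs Hsmall.
  assert (HsT := proj2 (in_T s Hs)).
  assert (HA : forall t j x y, 0 < t < s -> Rabs (u t j x y) <= K + 1).
  { intros t j x y Ht. replace (u t j x y) with (w t j x y + uN t j x y) by (unfold w; ring).
    rewrite (Rplus_comm K 1). apply Rabs_plus_le; [apply Hsmall, Ht|]. apply (proj1 (lb_u _ _ _ _ HB j) t x y). lra. }
  assert (G := fun k => second_energy_estimate eps del T u0 p0 U0 u p U (K + 1) s k (Rlt_le _ _ Heps) (Rlt_le _ _ Hdel) HR (proj1 Hs) HsT HA).
  get_slices (in_T 0 ltac:(lra)).
  assert (G0 := second_energy_laplacian eps del (p 0) (u 0) (U 0) ltac:(unfold eta in Heta; lra) ltac:(unfold eta in Heta; lra) Sp Pp Su Pu SU PU).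
  assert (G1 : E2 s <= exp (114 * (K + 1) ^ 2 * s) * E2 0).
  { unfold E2. axes G. lra. }
  eapply Rle_trans; [exact G1|]. unfold M2, h2_const.
  replace (exp (114 * (K + 1) ^ 2 * Tf) * C ^ 2 * rho ^ 2) with (exp (114 * (K + 1) ^ 2 * Tf) * (C * rho) ^ 2) by ring.
  apply Rmult_le_compat.
  - left; apply exp_pos.
  - assert (Z : forall k, 0 <= second_energy eps del (p 0) (u 0) (U 0) k).
    { intros k. apply integral_ge0.
      - apply cont2_energy_density; reg.
      - intros x y. unfold energy_density. repeat apply Rplus_le_le_0_compat; try (apply Rmult_le_pos; [lra|]);
        repeat (apply sum2_ge0; intros); apply pow2_ge_0. }
    unfold E2. apply Rplus_le_le_0_compat; apply Z.
  - assert (Hm : 114 * (K + 1) ^ 2 * s <= 114 * (K + 1) ^ 2 * Tf).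
    { apply Rmult_le_compat_l; [|lra]. assert (H := pow2_ge_0 (K + 1)). lra. }
    destruct Hm as [Hm|Hm]; [left; apply exp_increasing, Hm|rewrite Hm; lra].
  - eapply Rle_trans; [exact G0|]. apply pow_incr. split; [apply sqrt_pos|exact D5].
Qed.

Lemma M1_pos : 0 < M1.
Proof.
  unfold M1, h1_const. apply Rmult_lt_0_compat; [apply exp_pos|].
  assert (H := pow2_ge_0 C). assert (H' := pow2_ge_0 K). lra.
Qed.

Lemma M2_pos : 0 < M2.
Proof. unfold M2, h2_const. apply Rmult_lt_0_compat; [apply exp_pos|apply pow_lt, HC]. Qed.

Lemma eta_pos : 0 < eta.
Proof. unfold eta; lra. Qed.

Lemma w_smooth t : 0 <= t <= Tf -> forall j,
  smooth (vminus (u t) (uN t) j) /\ periodic (vminus (u t) (uN t) j).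
Proof. intros Ht j. get_slices (in_T t Ht). unfold vminus, sminus. split; reg. Qed.

Lemma w_h1 t B : 0 <= t <= Tf -> E1 t <= B * eta ^ 2 ->
  integral (h1_density (vminus (u t) (uN t))) <= (2 * B + 12 * K ^ 2) * eta ^ 2.
Proof.
  intros Ht HE. get_slices (in_T t Ht).
  assert (H : integral (h1_density (vminus (u t) (uN t))) <= 2 * integral (h1_density (err_u eps uN phi u t)) + 12 * K ^ 2 * eta ^ 2).
  { apply (h1_density_shift _ (err_u eps uN phi u t) (phi t) (- eps)).
    - apply err_u_smooth, Ht.
    - exact Sphi.
    - intros j x y. unfold vminus, sminus, err_u. ring.
    - replace ((- eps) ^ 2) with (eps ^ 2) by ring. apply eps_sq_le.
    - intros j x y. apply (proj1 (lb_phi _ _ _ _ HB j) t x y Ht).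
    - intros k j x y. apply (proj2 (lb_phi _ _ _ _ HB j) k t x y Ht). }
  assert (H' := E1_ge t Ht). lra.
Qed.

Lemma normL2_le_of_I2 f b : cont2 f -> 0 <= b -> I2 f <= b ^ 2 -> normL2 f <= b.
Proof.
  intros Hf Hb H. apply Rle_of_pow2; [exact Hb|]. rewrite normL2_pow2 by exact Hf. exact H.
Qed.

Lemma I2_partial2_u t j k : 0 <= t <= Tf -> I2 (partial k (partial k (u t j))) <= E2 t.
Proof.
  intros Ht. get_slices (in_T t Ht).
  unfold E2, second_energy.
  rewrite !integral_energy_density by reg.
  assert (Z0 : forall k j, 0 <= I2 (partial k (partial k (u t j)))) by (intros a b; apply I2_ge0; reg).
  assert (Z1 : forall k, 0 <= eps * I2 (partial k (partial k (p t)))) by (intros a; apply Rmult_le_pos; [lra|apply I2_ge0; reg]).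
  assert (Z2 : forall k, 0 <= del * sum2 (fun i => sum2 (fun j => I2 (partial k (partial k (U t i j)))))).
  { intros a. apply Rmult_le_pos; [lra|]. apply sum2_ge0; intros b; apply sum2_ge0; intros c. apply I2_ge0. reg. }
  axes Z0. axes Z1. axes Z2.
  unfold sum2 at 1 4. destruct j, k; lra.
Qed.

Lemma w_h2 t i j l B : 0 <= t <= Tf -> E2 t <= B * rho ^ 2 ->
  I2 (partial i (partial l (vminus (u t) (uN t) j))) <= (2 * B + 2 * K ^ 2) * rho ^ 2.
Proof.
  intros Ht HE. get_slices (in_T t Ht).
  set (f := vminus (u t) (uN t) j).
  destruct (w_smooth t Ht j : smooth f /\ periodic f) as [Sf Pf].
  assert (r2 : 1 <= rho ^ 2) by nra.
  assert (D : forall k, I2 (partial k (partial k f)) <= (2 * B + 2 * K ^ 2) * rho ^ 2).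
  { intros k.
    assert (E : forall x y, partial k (partial k f) x y = partial k (partial k (u t j)) x y - partial k (partial k (uN t j)) x y).
    { intros x y. rewrite (partial_fun_eq k _ (fun x y => partial k (u t j) x y - partial k (uN t j) x y))
        by (intros; apply partial_minus; reg). apply partial_minus; reg. }
    apply Rle_trans with (2 * I2 (partial k (partial k (u t j))) + 2 * K ^ 2).
    - unfold I2. rewrite <- (integral_const (2 * K ^ 2)). rewrite <- integral_scal by reg.
      rewrite <- integral_plus by reg.
      apply integral_le; [reg|reg|]. intros x y. rewrite E.
      assert (H := proj2 (lb_du _ _ _ _ HB k j) k t x y Ht). cbv beta in H.
      assert (H2 : partial k (partial k (uN t j)) x y ^ 2 <= K ^ 2).
      { rewrite <- (pow2_abs (partial k (partial k (uN t j)) x y)). apply pow_incr. split; [apply Rabs_pos|exact H]. }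
      assert (H3 := pow2_ge_0 (partial k (partial k (u t j)) x y + partial k (partial k (uN t j)) x y)). lra.
    - assert (H := I2_partial2_u t j k Ht). assert (K2 := pow2_ge_0 K). nra. }
  assert (Dx : I2 (partial X1 (partial X2 f)) <= (2 * B + 2 * K ^ 2) * rho ^ 2).
  { unfold I2. rewrite (integral_partial12 f Sf Pf).
    apply Rle_trans with (/ 2 * I2 (partial X1 (partial X1 f)) + / 2 * I2 (partial X2 (partial X2 f))).
    - unfold I2. rewrite <- !integral_scal by reg. rewrite <- integral_plus by reg.
      apply integral_le; [reg|reg|]. intros x y.
      assert (H := pow2_ge_0 (partial X1 (partial X1 f) x y - partial X2 (partial X2 f) x y)). lra.
    - axes D. lra. }
  destruct i, l; [apply D|exact Dx| |apply D].
  unfold I2. rewrite (integral_ext _ (fun x y => partial X1 (partial X2 f) x y ^ 2)); [exact Dx|].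
  intros x y. now rewrite (sm_comm X2 X1).
Qed.

Lemma H1_le_of_density v h : (forall j, smooth (v j)) -> 0 <= h -> integral (h1_density v) <= h ^ 2 ->
  forall j, H1_le (v j) h.
Proof.
  intros Sv Hh H j. rewrite integral_h1_density in H by exact Sv.
  assert (Z0 := fun j => I2_ge0 (v j) ltac:(reg)).
  assert (Z1 := fun k j => I2_ge0 (partial k (v j)) ltac:(reg)).
  axes Z0. axes Z1.
  unfold sum2 in H.
  split; [|intros k]; apply normL2_le_of_I2; reg; [destruct j|destruct j, k]; lra.
Qed.

Variables (n : nat) (c : R).
Hypothesis (Hc : 0 < c).
Hypothesis (Hinterp : forall f h D, smooth f -> periodic f ->
  H1_le f h -> (forall i j, normL2 (partial i (partial j f)) <= D) ->
  forall x y, Rabs (f x y) ^ S (S n) <= c * h ^ S n * (h + D)).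

Let h1 := sqrt (2 * (4 * M1) + 12 * K ^ 2).
Let h2 := sqrt (2 * (4 * M2) + 2 * K ^ 2).

Hypothesis (Hrate : eta ^ n * rho <= 1).
Hypothesis (Hsmall : c * h1 ^ S n * (h1 + h2) * eta <= 1).

(** The place where [eta] has to be small: the gain [eta ^ n] of
    [sup_interpolation] beats the loss [rho] in the second derivatives. *)
Lemma w_sup t j x y : 0 <= t <= Tf -> E1 t <= 4 * M1 * eta ^ 2 -> E2 t <= 4 * M2 * rho ^ 2 ->
  Rabs (w t j x y) <= 1.
Proof.
  intros Ht H1 H2.
  assert (m1 := M1_pos). assert (m2 := M2_pos). assert (e0 := eta_pos). assert (K2 := pow2_ge_0 K).
  assert (Sf := fun j => proj1 (w_smooth t Ht j)). assert (Pf := proj2 (w_smooth t Ht j)).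
  assert (h10 : 0 <= h1) by apply sqrt_pos. assert (h20 : 0 <= h2) by apply sqrt_pos.
  assert (Hh : H1_le (vminus (u t) (uN t) j) (h1 * eta)).
  { apply H1_le_of_density; [exact Sf|apply Rmult_le_pos; lra|].
    eapply Rle_trans; [apply (w_h1 t (4 * M1) Ht H1)|].
    rewrite Rpow_mult_distr. unfold h1. rewrite pow2_sqrt by lra. lra. }
  assert (HD : forall i l, normL2 (partial i (partial l (vminus (u t) (uN t) j))) <= h2 * rho).
  { intros i l. apply normL2_le_of_I2; [reg|apply Rmult_le_pos; lra|].
    eapply Rle_trans; [apply (w_h2 t i j l (4 * M2) Ht H2)|].
    rewrite Rpow_mult_distr. unfold h2. rewrite pow2_sqrt by lra. lra. }
  assert (B := Hinterp _ _ _ (Sf j) Pf Hh HD x y).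
  change (vminus (u t) (uN t) j x y) with (w t j x y) in B.
  apply Rnot_lt_le. intros Hlt.
  apply (Rlt_irrefl 1). apply Rlt_le_trans with (Rabs (w t j x y) ^ S (S n)); [apply Rlt_pow_R1; [exact Hlt|lia]|].
  eapply Rle_trans; [exact B|]. eapply Rle_trans; [|exact Hsmall].
  assert (q0 : 0 <= h1 ^ S n) by (apply pow_le; exact h10).
  assert (en : 0 <= eta ^ n) by (apply pow_le; lra).
  rewrite Rpow_mult_distr. simpl (eta ^ S n).
  replace (c * (h1 ^ S n * (eta * eta ^ n)) * (h1 * eta + h2 * rho)) with
    (c * h1 ^ S n * (h1 * eta * eta ^ n + h2 * (eta ^ n * rho)) * eta) by ring.
  apply Rmult_le_compat_r; [lra|]. apply Rmult_le_compat_l; [apply Rmult_le_pos; lra|].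
  assert (en1 : eta * eta ^ n <= 1).
  { change (eta ^ S n <= 1). rewrite <- (pow1 (S n)). apply pow_incr. lra. }
  assert (h1 * (eta * eta ^ n) <= h1 * 1) by (apply Rmult_le_compat_l; assumption).
  assert (h2 * (eta ^ n * rho) <= h2 * 1) by (apply Rmult_le_compat_l; assumption). lra.
Qed.

(** The energies relative to four times the sizes found in [E1_estimate] and
    [E2_estimate]. *)
Let F t := E1 (Rmax 0 t) / (4 * M1 * eta ^ 2) + E2 (Rmax 0 t) / (4 * M2 * rho ^ 2).

Lemma E2_ge0 t : 0 <= t <= Tf -> 0 <= E2 t.
Proof.
  intros Ht. eapply Rle_trans; [|apply (I2_partial2_u t X1 X1 Ht)].
  apply I2_ge0. get_slices (in_T t Ht). reg.
Qed.

Lemma expected_sizes_pos : 0 < 4 * M1 * eta ^ 2 /\ 0 < 4 * M2 * rho ^ 2.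
Proof.
  assert (m1 := M1_pos). assert (m2 := M2_pos).
  split; (apply Rmult_lt_0_compat; [lra|]); apply pow_lt; [apply eta_pos|lra].
Qed.

Lemma bounds_of_F t : 0 <= t <= Tf -> F t <= 1 -> E1 t <= 4 * M1 * eta ^ 2 /\ E2 t <= 4 * M2 * rho ^ 2.
Proof.
  intros Ht HF. unfold F in HF. rewrite in_time_Rmax_eq in HF by lra.
  destruct expected_sizes_pos as [a1 a2].
  assert (P1 : 0 <= E1 t / (4 * M1 * eta ^ 2)) by (apply Rdiv_le_0_compat; [assert (H := E1_ge t Ht); lra|exact a1]).
  assert (P2 : 0 <= E2 t / (4 * M2 * rho ^ 2)) by (apply Rdiv_le_0_compat; [apply E2_ge0, Ht|exact a2]).
  assert (Q1 : E1 t / (4 * M1 * eta ^ 2) <= 1) by lra. assert (Q2 : E2 t / (4 * M2 * rho ^ 2) <= 1) by lra.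
  apply Rle_div_l in Q1; [|exact a1]. apply Rle_div_l in Q2; [|exact a2]. lra.
Qed.

(** A quarter for each energy: the estimates improve the bounds assumed in [w_sup] by a
    factor four. *)
Lemma F_half s : 0 <= s <= Tf -> small_on s -> F s <= / 2.
Proof.
  intros Hs Hsm. unfold F. rewrite in_time_Rmax_eq by lra.
  destruct expected_sizes_pos as [a1 a2].
  assert (B1 : E1 s / (4 * M1 * eta ^ 2) <= / 4).
  { apply Rle_div_l; [exact a1|]. assert (H := E1_estimate s Hs Hsm). lra. }
  assert (B2 : E2 s / (4 * M2 * rho ^ 2) <= / 4).
  { apply Rle_div_l; [exact a2|]. assert (H := E2_estimate s Hs Hsm). lra. }
  lra.
Qed.

Lemma F_continuous t : 0 <= t < Tf -> continuous F t.
Proof.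
  intros Ht.
  assert (HtT : Rbar_lt (Rmax 0 t) T).
  { rewrite in_time_Rmax_eq by lra. apply Rbar_lt_trans with Tf; [simpl; lra|exact HT]. }
  assert (Hk : forall k, continuous (fun s => second_energy eps del (p (Rmax 0 s)) (u (Rmax 0 s)) (U (Rmax 0 s)) k) t).
  { intros k. apply (continuous_integral T (fun t => energy_density eps del (partial k (partial k (p t))) (fun j => partial k (partial k (u t j)))
      (fun i j => partial k (partial k (U t i j))))); [|exact HtT].
    apply smooth_cont, ts_smooth. unfold energy_density, sum2. ts_solve. }
  apply (continuous_plus (V := RN)).
  - apply (continuous_mult (K := RA)); [|apply continuous_const].
    apply (continuous_integral T ed); [apply smooth_cont, ts_smooth, ts_ed|exact HtT].
  - apply (continuous_mult (K := RA)); [|apply continuous_const].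
    apply (continuous_plus (V := RN)); [apply (Hk X1)|apply (Hk X2)].
Qed.

Lemma F_le_1 s : 0 <= s < Tf -> F s <= 1.
Proof.
  apply bootstrap.
  - apply F_continuous.
  - assert (H := F_half 0). apply Rle_trans with (/ 2); [apply H; [lra|intros t j x y Ht; lra]|lra].
  - intros r Hr HF. apply F_half; [lra|]. intros t j x y Ht.
    destruct (bounds_of_F t ltac:(lra) (HF t ltac:(lra))). apply w_sup; auto; lra.
Qed.

Lemma stability t : 0 < t < Tf ->
  total_error eps (u t) (uN t) (p t) (pN t) <= (sqrt (2 * (4 * M1) + 12 * K ^ 2) + sqrt (4 * M1)) * eta.
Proof.
  intros Ht. assert (Ht' : 0 <= t <= Tf) by lra.
  destruct (bounds_of_F t Ht' (F_le_1 t ltac:(lra))) as [HE _].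
  assert (m1 := M1_pos). assert (e0 := eta_pos). assert (K2 := pow2_ge_0 K).
  assert (Sf := fun j => proj1 (w_smooth t Ht' j)).
  assert (B1 : normH1v (vminus (u t) (uN t)) <= sqrt (2 * (4 * M1) + 12 * K ^ 2) * eta).
  { apply Rle_of_pow2; [apply Rmult_le_pos; [apply sqrt_pos|lra]|].
    rewrite normH1v_pow2 by exact Sf. rewrite Rpow_mult_distr, pow2_sqrt by lra.
    apply w_h1; assumption. }
  assert (B2 : sqrt eps * normH1 (sminus (p t) (pN t)) <= sqrt (4 * M1) * eta).
  { apply Rle_of_pow2; [apply Rmult_le_pos; [apply sqrt_pos|lra]|].
    rewrite !Rpow_mult_distr, !pow2_sqrt by lra.
    assert (H := E1_ge t Ht'). lra. }
  unfold total_error. lra.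
Qed.
End RelaxationLimit.

Lemma exp_le_1 x : x <= 0 -> exp x <= 1.
Proof.
  intros [H|H]; [|rewrite H, exp_0; lra]. left. rewrite <- exp_0. apply exp_increasing, H.
Qed.

Theorem theorem2p4
  (u0NS : vfield) (uNS : R -> vfield) (pNS : R -> sfield)
  (Hu0NS : forall i, torus_smooth (u0NS i))
  (HNS : NS_solution u0NS uNS pNS)
  (Lambda : R -> R -> Prop)
  (HLambda : forall eps del, Lambda eps del -> 0 < eps /\ 0 < del)
  (u0 : R -> R -> vfield) (p0 : R -> R -> sfield) (U0 : R -> R -> mfield)
  (Hu0 : forall eps del, Lambda eps del ->
     forall i, torus_smooth (u0 eps del i))
  (Hp0 : forall eps del, Lambda eps del -> torus_smooth (p0 eps del))
  (HU0 : forall eps del, Lambda eps del ->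
     forall i j, torus_smooth (U0 eps del i j))
  (Tmax : R -> R -> Rbar)
  (u : R -> R -> R -> vfield) (p : R -> R -> R -> sfield)
  (U : R -> R -> R -> mfield)
  (Hsol : forall eps del, Lambda eps del ->
     maximal_relax_solution eps del (Tmax eps del)
       (u0 eps del) (p0 eps del) (U0 eps del)
       (u eps del) (p eps del) (U eps del))
  (C : R) (HC : 0 < C)
  (Hdel : forall eps del, Lambda eps del -> del <= C * sqrt eps)
  (Hdata1 : forall eps del, Lambda eps del ->
     normH1v (vminus (u0 eps del) u0NS)
     + sqrt eps * normH1 (sminus (p0 eps del) (pNS 0))
     + (eps + del) * normH1m (U0 eps del)
     <= C * (eps + del))
  (Hdata2 : forall eps del, Lambda eps del ->
     normL2v (grad (div (u0 eps del)))
     + del * (normL2 (laplacian (p0 eps del)) + normL2m (vgrad (mdiv (U0 eps del))))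
     <= C * (eps + del))
  (a : R) (Ha : 0 < a)
  (Hdata3 : forall eps del, Lambda eps del ->
     normL2_tuple (vlaplacian (u0 eps del)) (laplacian (p0 eps del))
       (mlaplacian (U0 eps del))
     <= C * Rpower (eps + del) (- a)) :
  forall T : R, 0 < T ->
  exists CT etaT : R, 0 < CT /\ 0 < etaT /\
    forall eps del, Lambda eps del ->
      eps + del <= etaT -> Rbar_lt T (Tmax eps del) ->
      Rbar_le
        (Lub_Rbar (fun r => exists t, 0 < t < T /\
           r = total_error eps (u eps del t) (uNS t) (p eps del t) (pNS t)))
        (CT * (eps + del)).

Proof.
  intros T HT.
  destruct (divergence_potential pNS (NS_smooth_p _ _ _ HNS) (NS_pressure_mean _ _ _ HNS)) as (Phi & HPhi & Hdiv).
  destruct (limit_bounds_exist uNS (dtv Phi) T (Rlt_le _ _ HT) (NS_smooth_u _ _ _ HNS) (fun j => ts_phi Phi HPhi j)) as (K & HK & HB).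
  destruct (INR_unbounded a) as [n Hn].
  destruct (sup_interpolation n) as (c & Hc & Hinterp).
  set (M1 := h1_const K C T). set (M2 := h2_const K C T).
  set (h1 := sqrt (2 * (4 * M1) + 12 * K ^ 2)). set (h2 := sqrt (2 * (4 * M2) + 2 * K ^ 2)).
  assert (m1 : 0 < M1) by (apply M1_pos; assumption).
  set (q := c * h1 ^ S n * (h1 + h2)).
  assert (q0 : 0 <= q).
  { unfold q. apply Rmult_le_pos; [apply Rmult_le_pos; [lra|apply pow_le, sqrt_pos]|apply Rplus_le_le_0_compat; apply sqrt_pos]. }
  exists (h1 + sqrt (4 * M1)), (Rmin 1 (/ (1 + q))).
  split; [|split].
  - apply Rplus_le_lt_0_compat; [apply sqrt_pos|apply sqrt_lt_R0; lra].
  - apply Rmin_pos; [lra|apply Rinv_0_lt_compat; lra].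
  - intros eps del HL Heta HTmax.
    destruct (HLambda eps del HL) as [Heps Hd].
    set (eta := eps + del) in *.
    assert (e0 : 0 < eta) by (unfold eta; lra).
    assert (e1 : eta <= 1) by (eapply Rle_trans; [exact Heta|apply Rmin_l]).
    assert (e2 : q * eta <= 1).
    { assert (H : eta <= / (1 + q)) by (eapply Rle_trans; [exact Heta|apply Rmin_r]).
      apply Rle_trans with ((1 + q) * / (1 + q)); [|rewrite Rinv_r by lra; lra].
      apply Rmult_le_compat; lra. }
    destruct (Hsol eps del HL) as [HR _].
    assert (Eu : u eps del 0 = u0 eps del).
    { field_ext j x.
      apply functional_extensionality; intros y. apply (relax_initial_u _ _ _ _ _ _ _ _ _ HR). }
    assert (EU : U eps del 0 = U0 eps del).
    { field_ext i j.
      field_ext x y.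
      apply (relax_initial_U _ _ _ _ _ _ _ _ _ HR). }
    assert (Ep : p eps del 0 = p0 eps del).
    { field_ext x y.
      apply (relax_initial_p _ _ _ _ _ _ _ _ _ HR). }
    assert (EN : uNS 0 = u0NS).
    { field_ext j x.
      apply functional_extensionality; intros y. apply (NS_initial _ _ _ HNS). }
    specialize (Hdata1 eps del HL). specialize (Hdata2 eps del HL). specialize (Hdata3 eps del HL).
    rewrite <- Eu, <- EU, <- Ep in Hdata1, Hdata2, Hdata3. rewrite <- EN in Hdata1. fold eta in Hdata1, Hdata2, Hdata3.
    assert (N1 : 0 <= normH1v (vminus (u eps del 0) (uNS 0))) by apply sqrt_pos.
    assert (N2 : 0 <= sqrt eps * normH1 (sminus (p eps del 0) (pNS 0))) by (apply Rmult_le_pos; apply sqrt_pos).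
    assert (N3 : 0 <= eta * normH1m (U eps del 0)) by (apply Rmult_le_pos; [lra|apply sqrt_pos]).
    assert (N4 : 0 <= normL2v (grad (div (u eps del 0)))) by apply sqrt_pos.
    assert (N5 : 0 <= del * normL2 (laplacian (p eps del 0))) by (apply Rmult_le_pos; [lra|apply sqrt_pos]).
    assert (l0 : ln eta <= 0).
    { destruct e1 as [e1|e1]; [left; rewrite <- ln_1; apply ln_increasing; lra|rewrite e1, ln_1; lra]. }
    assert (r1 : 1 <= Rpower eta (- a)).
    { unfold Rpower. rewrite <- exp_0. assert (H : 0 <= - a * ln eta) by nra.
      destruct H as [H|H]; [left; apply exp_increasing, H|rewrite <- H; lra]. }
    assert (rn : eta ^ n * Rpower eta (- a) <= 1).
    { rewrite <- Rpower_pow, <- Rpower_plus by exact e0. unfold Rpower. apply exp_le_1. nra. }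
    apply (proj2 (Lub_Rbar_correct _)). intros r (t & Ht & ->). simpl.
    apply (stability eps del (Tmax eps del) u0NS uNS Phi pNS (u0 eps del) (p0 eps del) (U0 eps del)
      (u eps del) (p eps del) (U eps del) Heps Hd HNS HPhi Hdiv HR T K C (Rpower eta (- a)) HT HTmax HK HC HB e1 r1)
      with (n := n) (c := c); auto.
    + fold eta. lra.
    + fold eta. lra.
    + apply Rmult_le_reg_l with eta; [exact e0|]. lra.
    + fold eta. lra.
Qed.
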